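(* Let $G$ and $\Omega$ be domains in $\mathbb{C}$ with $G$ simply connected, and let $\Phi=(\phi_n)_n$ be any sequence of holomorphic mappings from $G$ to $\Omega$. There exists a $(\Phi,G,\Omega)$-universal function if and only if for any compact set $K\subset G$ and any compact set $L\subset\Omega$, there exists $n\in\mathbb{N}$ such that $\phi_n(K)\cap L=\emptyset$ and $\phi_n$ is injective on a neighbourhood of $K$.
   Context: A domain is a connected open subset of $\mathbb{C}$; it is simply connected if $\mathbb{C}\setminus G$ has no non-empty bounded connected component. $H(\Omega)$ is the Fréchet space of holomorphic functions on $\Omega$ with the locally uniform topology. $f\in H(\Omega)$ is $(\Phi,G,\Omega)$-universal if $\{f\circ\phi_n:\,n\in\mathbb{N}\}$ is dense in $H(G)$. *)

(* Defs.v *)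
(* The complex plane is C := R[i] (mathcomp-real-closed
   `complex`) over Stdlib's reals R (a realType via Rstruct), seen through the
   regular alias ^o so that it is a normed module over itself (topology = the
   usual Euclidean one given by the modulus). *)
From HB Require Import structures.
From mathcomp Require Import all_boot all_algebra.
From mathcomp Require Import all_classical all_reals all_analysis.
From mathcomp Require Import complex Rstruct Rstruct_topology.
Import numFieldNormedType.Exports.
Set Implicit Arguments. Unset Strict Implicit. Unset Printing Implicit Defensive.
Local Open Scope ring_scope.
Local Open Scope classical_set_scope.

Definition C := ((Rdefinitions.R)[i])^o.

Definition domain (A : set C) : Prop := open A /\ connected A /\ A !=set0.

Definition simply_connected (G : set C) : Prop :=
  forall x : C, (~` G) x -> ~ bounded_set (connected_component (~` G) x).

Definition holomorphic_on (U : set C) (f : C -> C) : Prop :=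
  forall z, U z -> derivable f z 1.

Definition holomorphic_map (G Omega : set C) (phi : C -> C) : Prop :=
  holomorphic_on G phi /\ phi @` G `<=` Omega.

(* f in H(Omega) is (Phi,G,Omega)-universal: {f o phi_n} is dense in H(G) for
   the topology of locally uniform convergence, i.e. every basic neighbourhood
   {h : sup_K |h - g| < eps} (K compact in G, eps > 0) of every g in H(G)
   contains some f o phi_n. *)
Definition universal (Phi : nat -> C -> C) (G Omega : set C) (f : C -> C) : Prop :=
  holomorphic_on Omega f /\
  forall g : C -> C, holomorphic_on G g ->
  forall K : set C, compact K -> K `<=` G ->
  forall eps : C, 0 < eps ->
  exists n : nat, forall z, K z -> `| f (Phi n z) - g z | < eps.

(* Main.v *)
(** Necessity: if f o phi_n is uniformly close to z + c on a neighbourhood of K, with c large, then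
    |f| exceeds its maximum over L on phi_n(K), and a Cauchy estimate for f o phi_n - z - c
    shows that f o phi_n, hence phi_n, is injective near K.

    Sufficiency: the compact sets K = {|z| <= n, dist(z, ~G) >= 1/n} exhaust G, and similarly L in Omega.
    Given n with B = phi_n(K) disjoint from L and phi_n injective near K, Runge's theorem on the union
    of L and B produces a function holomorphic on Omega which is small on L and close to a prescribed
    function on B; iterating over a countable dense set of targets gives a universal function.
    Pushing the poles off the union of L and B requires that no open set V, relatively compact in Omega,
    has its boundary in that union. Plane topology is avoided: since G is simply connected, every
    nonvanishing holomorphic function near K has a logarithm, which phi_n carries to B; so for a in V
    the form dw/(w-a), up to a form without singularities in V, has a primitive near the union of L and B,
    whereas its integral along a grid contour in V around a is 2 i pi. *)
Require Import Defs.
From mathcomp Require Import all_boot all_algebra.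
From mathcomp Require Import all_classical all_reals all_analysis.
From mathcomp Require Import complex Rstruct Rstruct_topology.
From mathcomp Require Import all_order ring lra.
From Coquelicot Require RInt RInt_analysis.
Import Order.TTheory GRing.Theory Num.Theory.
Import numFieldNormedType.Exports.
Local Open Scope ring_scope.
Local Open Scope classical_set_scope.

Local Notation R := Rdefinitions.R.
Local Notation Cx := R[i].
Local Notation Re := complex.Re.
Local Notation Im := complex.Im.

(** * Modulus, discs and compactness in the complex plane *)

(** The obstacle is a statement of Janiszewski type. No component of the complement of L is
    relatively compact in Omega, and B does not separate the plane, but this does not pass to their
    union for formal reasons. Primitives make it additive: on disjoint compact sets, primitives of
    the same form glue over disjoint neighbourhoods, whatever their constants. The shape of the
    exhaustion is what makes poles movable. A point a off the n-th compact set has modulus > n, or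
    lies within 1/n of some b off the domain. On the compact set, z/a or (a-b)/(z-b) is then bounded
    by a constant < 1, so 1/(z-a) expands in a geometric series in that ratio u, while a branch of
    log(1-u) yields a primitive. Poles and primitives thus move along the same chains. No closed
    curve is ever assembled: integrals run along edges of a grid, and summation by parts shows that
    only edges between a marked and an unmarked cell count. One estimate, for integrals of h/(phi -
    w) as a function of w, gives both Cauchy's estimates (phi = id) and the holomorphy of inverses
    (phi injective). *)

Definition cmod (z : Cx) : R := ComplexField.Normc.normc z.

#[global] Arguments cmod : simpl never.

(** The library norm takes its values in [C] itself. Estimates are carried out with the real-valued
    [cmod], and radii and tolerances are taken in [R]. *)
Lemma cmod_norm (z : C) : `|z| = (cmod z)%:C%C.
Proof. by []. Qed.

Lemma cmod_ge0 z : 0 <= cmod z.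
Proof. by case: z => a b; rewrite /cmod /= sqrtr_ge0. Qed.

Lemma cmod0 : cmod 0 = 0.
Proof. exact: ComplexField.Normc.normc0. Qed.

Lemma cmod1 : cmod 1 = 1.
Proof. exact: ComplexField.Normc.normc1. Qed.

Lemma cmod_eq0 z : (cmod z == 0) = (z == 0).
Proof.
apply/eqP/eqP => [|->]; last exact: cmod0.
exact: ComplexField.Normc.eq0_normc.
Qed.

Lemma cmod_gt0 z : (0 < cmod z) = (z != 0).
Proof. by rewrite lt_neqAle cmod_ge0 andbT eq_sym cmod_eq0. Qed.

Lemma cmodM x y : cmod (x * y) = cmod x * cmod y.
Proof. exact: ComplexField.Normc.normcM. Qed.

Lemma cmodV x : cmod x^-1 = (cmod x)^-1.
Proof. exact: ComplexField.Normc.normcV. Qed.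

Lemma cmodX x n : cmod (x ^+ n) = cmod x ^+ n.
Proof. by elim: n => [|n IH]; rewrite ?expr0 ?cmod1 // !exprS cmodM IH. Qed.

Lemma cmodN x : cmod (- x) = cmod x.
Proof. exact: complex.normcN. Qed.

Lemma cmodD x y : cmod (x + y) <= cmod x + cmod y.
Proof. exact: complex.le_normcD. Qed.

Lemma cmodB x y : cmod (x - y) = cmod (y - x).
Proof. by rewrite -cmodN opprB. Qed.

Lemma cmod_tri y x z : cmod (x - z) <= cmod (x - y) + cmod (y - z).
Proof. by rewrite (_ : x - z = (x - y) + (y - z)) ?cmodD //; ring. Qed.

Lemma cmod_leB x y : cmod x - cmod y <= cmod (x - y).
Proof. by have := cmodD (x - y) y; rewrite subrK; lra. Qed.

Lemma cmod_real (x : R) : cmod x%:C%C = `|x|.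
Proof. by rewrite /cmod /= expr0n /= addr0 sqrtr_sqr. Qed.

Lemma cmod_i : cmod 'i%C = 1.
Proof. by rewrite /cmod /= expr0n /= add0r expr1n sqrtr1. Qed.

Lemma normRe (z : Cx) : `|Re z| <= cmod z.
Proof.
case: z => a b; rewrite /cmod /= -sqrtr_sqr ler_wsqrtr //.
by rewrite lerDl sqr_ge0.
Qed.

Lemma normIm (z : Cx) : `|Im z| <= cmod z.
Proof.
case: z => a b; rewrite /cmod /= -sqrtr_sqr ler_wsqrtr //.
by rewrite lerDr sqr_ge0.
Qed.

Lemma ReImE (z : Cx) : z = (Re z)%:C%C + 'i%C * (Im z)%:C%C.
Proof. exact: complexE. Qed.

Lemma cmod_ReIm z : cmod z <= `|Re z| + `|Im z|.
Proof.
rewrite {1}(ReImE z); apply: le_trans (cmodD _ _) _.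
by rewrite cmodM cmod_i mul1r !cmod_real.
Qed.

Definition disc (z : Cx) (r : R) : set C := [set w : C | cmod (w - z) < r].

Lemma disc_center z r : 0 < r -> disc z r z.
Proof. by rewrite /disc /= subrr cmod0. Qed.

Lemma gt0_realP (e : C) : 0 < e -> exists2 r : R, 0 < r & e = r%:C%C.
Proof.
case: e => a b; rewrite ltcE /= => /andP[/eqP -> h]; by exists a.
Qed.

Lemma nbhs_discP (z : C) (A : set C) :
  nbhs z A <-> exists2 r : R, 0 < r & disc z r `<=` A.
Proof.
split=> [/nbhs_ballP[e e0]|[r r0] h].
  have [r r0 ->] := gt0_realP _ e0 => h.
  exists r => // w wz; apply: h.
  rewrite -ball_normE /= cmod_norm ltcR.
  by rewrite cmodB; exact: wz.
apply/nbhs_ballP; exists (r%:C%C : C); first by rewrite /= ltcR.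
move=> w; rewrite -ball_normE /= cmod_norm ltcR => ?.
by apply: h; rewrite /disc /= cmodB.
Qed.

Lemma open_discP (U : set C) :
  open U <-> forall z, U z -> exists2 r : R, 0 < r & disc z r `<=` U.
Proof. by rewrite openE; split => h z /h /nbhs_discP. Qed.

Lemma open_disc z r : open (disc z r).
Proof.
apply/open_discP => w wz; exists (r - cmod (w - z)); first by rewrite subr_gt0.
move=> v; rewrite /disc /= => vw.
by have := cmod_tri w v z; lra.
Qed.

Lemma bounded_setP (A : set C) :
  bounded_set A <-> exists m : R, forall z, A z -> cmod z <= m.
Proof.
split=> [[M [Mr hM]]|[m hm]].
  have [m Mm] : exists m : R, M < m%:C%C.
    move/complex_realP: Mr => [k ->]; exists (k + 1).
    by rewrite ltcR ltrDl.
  by exists m => z Az; have := hM _ Mm z Az; rewrite /= cmod_norm lecR.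
exists (m%:C%C : C); split; first by apply/complex_realP; exists m.
move=> M mM z Az /=; apply: le_trans (ltW mM).
by rewrite cmod_norm lecR; exact: hm.
Qed.

(** If [A K] failed, the sets S with [A (K \ S)] would form a proper filter containing K, and a
    cluster point of it would contradict the local hypothesis. This replaces finite subcovers in all
    compactness arguments below. *)
Lemma compact_ind (K : set C) (A : set C -> Prop) : compact K ->
  A set0 -> (forall S T, S `<=` T -> A T -> A S) ->
  (forall S T, A S -> A T -> A (S `|` T)) ->
  (forall z, K z -> exists2 r, 0 < r & A (K `&` disc z r)) -> A K.
Proof.
move=> cK A0 Asub AU loc; apply: contrapT => nAK.
pose F : set_system C := fun S => A (K `&` ~` S).
have FF : ProperFilter F.
  apply: Build_ProperFilter_ex.
    move=> S FS; apply: contrapT => nS; apply: nAK.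
    apply: Asub FS => z Kz; split=> // Sz; apply: nS; by exists z.
  split.
  - by apply: Asub A0 => z [_]; apply.
  - move=> S T FS FT; apply: Asub (AU _ _ FS FT) => z [Kz nST].
    have [Sz|nSz] := pselect (S z); [right|left] => //.
    by split => // Tz; apply: nST.
  - by move=> S T ST; apply: Asub => z [Kz nT]; split=> // /ST.
have FK : F K by apply: Asub A0 => z [Kz]; apply.
have [z [Kz clz]] := cK F FF FK.
have [r r0 Ar] := loc z Kz.
have Fc : F (~` disc z r) by rewrite /F setCK.
have nd : nbhs (z : C) (disc z r) by apply/nbhs_discP; exists r.
by have [w [nw dw]] := clz _ _ Fc nd; apply: nw.
Qed.

Definition ccont (f : Cx -> Cx) (z : Cx) := forall e : R, 0 < e ->
  exists2 d : R, 0 < d & forall w, cmod (w - z) < d -> cmod (f w - f z) < e.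

Lemma compact_bounded (K : set C) : compact K -> exists m : R, forall z, K z -> cmod z <= m.
Proof.
move=> cK; apply: (@compact_ind K (fun S => exists m : R, forall z, S z -> cmod z <= m)) => //.
- by exists 0.
- by move=> S T ST [m h]; exists m => z /ST /h.
- move=> S T [m h] [n k]; exists (Num.max m n) => z [/h|/k] ?; rewrite le_max; apply/orP; by [left|right].
- move=> z Kz; exists 1 => //; exists (cmod z + 1) => w [_]; rewrite /disc /= => wz.
  by have := cmod_tri z w 0; rewrite !subr0; lra.
Qed.

Lemma compact_disc_sub (K : set C) (U : set C) : compact K -> open U -> K `<=` U ->
  exists2 r : R, 0 < r & forall z, K z -> disc z r `<=` U.
Proof.
move=> cK oU KU.
apply: (@compact_ind K (fun S => exists2 r : R, 0 < r & forall z, S z -> disc z r `<=` U)) => //.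
- by exists 1.
- by move=> S T ST [m m0 h]; exists m => // z /ST /h.
- move=> S T [m m0 h] [n n0 k]; exists (Num.min m n); first by rewrite lt_min m0.
  by move=> z + w; rewrite /disc /= lt_min => -[zS|zT] /andP[? ?]; [apply: (h z)|apply: (k z)].
- move=> z Kz; have [r r0 h] := proj1 (open_discP _) oU z (KU _ Kz).
  exists (r / 2); first by lra.
  exists (r / 2); first by lra.
  move=> w [_]; rewrite /disc /= => wz v; rewrite /disc /= => vw; apply: h.
  by rewrite /disc /=; have := cmod_tri w v z; lra.
Qed.

Lemma compact_ccont_bounded (K : set C) f : compact K -> (forall z, K z -> ccont f z) ->
  exists2 m : R, 0 < m & forall z, K z -> cmod (f z) <= m.
Proof.
move=> cK cf; apply: (@compact_ind K (fun S => exists2 m : R, 0 < m & forall z, S z -> cmod (f z)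
  <= m)) => //.
- by exists 1.
- by move=> S T ST [m m0 h]; exists m => // z /ST /h.
- move=> S T [m m0 h] [n n0 k]; exists (Num.max m n); first by rewrite lt_max m0.
  by move=> z [/h|/k] ?; rewrite le_max; apply/orP; [left|right].
- move=> z Kz; have [d d0 h] := cf z Kz 1 ltr01.
  exists d => //; exists (cmod (f z) + 1); first by rewrite ltr_wpDl ?cmod_ge0.
  move=> w [_ /h]; have := cmod_leB (f w) (f z); lra.
Qed.

Lemma compact_ccont_lower (K : set C) f : compact K -> (forall z, K z -> ccont f z) ->
  (forall z, K z -> f z != 0) ->
  exists2 m : R, 0 < m & forall z, K z -> m <= cmod (f z).
Proof.
move=> cK cf f0; apply: (@compact_ind K (fun S => exists2 m : R, 0 < m & forall z, S z -> m <= cmod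
  (f z))) => //.
- by exists 1.
- by move=> S T ST [m m0 h]; exists m => // z /ST /h.
- move=> S T [m m0 h] [n n0 k]; exists (Num.min m n); first by rewrite lt_min m0.
  by move=> z [/h|/k] ?; rewrite ge_min; apply/orP; [left|right].
- move=> z Kz; have fz : 0 < cmod (f z) by rewrite cmod_gt0 f0.
  have [|d d0 h] := cf z Kz (cmod (f z) / 2); first by lra.
  exists d => //; exists (cmod (f z) / 2); first by lra.
  move=> w [_ /h]; have := cmod_leB (f z) (f w); rewrite (cmodB (f z)); lra.
Qed.

Lemma compact_ucont (K : set C) f : compact K -> (forall z, K z -> ccont f z) ->
  forall e : R, 0 < e -> exists2 d : R, 0 < d &
    forall z w, K z -> cmod (w - z) < d -> cmod (f w - f z) < e.
Proof.
move=> cK cf e e0; apply: (@compact_ind K (fun S => exists2 d : R, 0 < d &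
    forall z w, S z -> cmod (w - z) < d -> cmod (f w - f z) < e)) => //.
- by exists 1.
- by move=> S T ST [m m0 h]; exists m => // z w /ST /h; apply.
- move=> S T [m m0 h] [n n0 k]; exists (Num.min m n); first by rewrite lt_min m0.
  by move=> z w [/h|/k] {}h; rewrite lt_min => /andP[]; auto.
- move=> z Kz; have [|d d0 h] := cf z Kz (e / 2); first by lra.
  exists (d / 2); first by lra.
  exists (d / 2); first by lra.
  move=> w v [_]; rewrite /disc /= => wz vw.
  have hv : cmod (f v - f z) < e / 2 by apply: h; have := cmod_tri w v z; lra.
  have hw : cmod (f w - f z) < e / 2 by apply: h; lra.
  have := cmod_tri (f z) (f v) (f w); rewrite (cmodB (f z)); lra.
Qed.

(** * Continuity and complex derivatives *)

Lemma ccontP f (z : Cx) : ccont f z <-> {for (z : C), continuous (f : C -> C)}.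
Proof.
split=> [cf A /nbhs_discP[r r0 rA]|cf e e0].
  apply/nbhs_discP; have [d d0 h] := cf r r0; exists d => // w /h; exact: rA.
have /nbhs_discP[d d0 h] := cf _ (open_nbhs_nbhs (conj (open_disc (f z) e) (disc_center (f z) e e0))).
by exists d => // w /h.
Qed.

Lemma ccont_id z : ccont id z.
Proof. by move=> e e0; exists e. Qed.

Lemma ccont_cst c z : ccont (fun=> c) z.
Proof. by move=> e e0; exists 1 => // w _; rewrite subrr cmod0. Qed.

Lemma ccontD f g z : ccont f z -> ccont g z -> ccont (fun w => f w + g w) z.
Proof. by move=> /ccontP cf /ccontP cg; apply/ccontP; exact: (cvgD cf cg). Qed.

Lemma ccontB f g z : ccont f z -> ccont g z -> ccont (fun w => f w - g w) z.
Proof. by move=> /ccontP cf /ccontP cg; apply/ccontP; exact: (cvgB cf cg). Qed.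

Lemma ccontM f g z : ccont f z -> ccont g z -> ccont (fun w => f w * g w) z.
Proof.
move=> /ccontP cf /ccontP cg; apply/ccontP.
exact: (@cvgM Cx C (nbhs (z : C)) _ f g (f z) (g z) cf cg).
Qed.

Lemma ccontV f z : f z != 0 -> ccont f z -> ccont (fun w => (f w)^-1) z.
Proof.
move=> fz /ccontP cf; apply/ccontP.
exact: (@cvgV Cx C (nbhs (z : C)) _ f (f z) fz cf).
Qed.

Lemma ccont_comp f g z : ccont f z -> ccont g (f z) -> ccont (fun w => g (f w)) z.
Proof.
move=> cf cg e /cg[d d0 hd]; have [r r0 hr] := cf _ d0.
by exists r => // w /hr /hd.
Qed.

Lemma ccont_ext f g z r : 0 < r -> (forall w, cmod (w - z) < r -> f w = g w) ->
  ccont f z -> ccont g z.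
Proof.
move=> r0 fg cf e /cf[d d0 hd]; exists (Num.min d r); first by rewrite lt_min d0.
move=> w; rewrite lt_min => /andP[/hd h1 h2].
by rewrite -!fg // subrr cmod0.
Qed.

Definition cder (f : Cx -> Cx) (z D : Cx) := forall e : R, 0 < e ->
  exists2 d : R, 0 < d & forall w, cmod (w - z) < d ->
    cmod (f w - f z - D * (w - z)) <= e * cmod (w - z).

(** Carathéodory's form of the derivative: the slope extends continuously to z. The product,
    quotient and chain rules become algebraic identities between slopes plus continuity. *)
Lemma cder_carath f z D : cder f z D <->
  exists g, [/\ ccont g z, g z = D & forall w, f w = f z + g w * (w - z)].
Proof.
split=> [df|[g [cg gz fg]] e e0].
  exists (fun w => if w == z then D else (f w - f z) / (w - z)); split; last 1 first.
  - move=> w; case: eqP => [->|/eqP wz]; first by rewrite subrr mulr0 addr0.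
    by field; rewrite subr_eq0.
  - move=> e e0; have [|d d0 h] := df (e / 2); first by lra.
    exists d => // w /h; rewrite eqxx; case: eqP => [->|/eqP wz]; first by move=> _; rewrite subrr cmod0.
    have wz0 : w - z != 0 by rewrite subr_eq0.
    rewrite (_ : f w - f z - D * (w - z) = ((f w - f z) / (w - z) - D) * (w - z)); last by field.
    by rewrite cmodM ler_pM2r ?cmod_gt0 //; lra.
  - by rewrite eqxx.
have [d d0 h] := cg e e0; exists d => // w wz.
rewrite fg (_ : _ - _ - _ = (g w - D) * (w - z)); last by ring.
by rewrite cmodM -gz ler_wpM2r ?cmod_ge0 // ltW // h.
Qed.

Lemma cder_cont f z D : cder f z D -> ccont f z.
Proof.
move=> /cder_carath[g [cg _ fg]].
rewrite (_ : f = fun w => f z + g w * (w - z)); last by apply/funext.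
apply: ccontD; first exact: ccont_cst.
apply: ccontM => //; apply: ccontB; [exact: ccont_id|exact: ccont_cst].
Qed.

Lemma cder_unique f z D D' : cder f z D -> cder f z D' -> D = D'.
Proof.
move=> h h'; apply: contrapT => /eqP; rewrite -subr_eq0 => DD.
have c0 : 0 < cmod (D - D') by rewrite cmod_gt0.
have e0 : 0 < cmod (D - D') / 4 by lra.
have [d d0 hd] := h _ e0; have [d' d'0 hd'] := h' _ e0.
pose r : R := Num.min d d' / 2.
have r0 : 0 < r by rewrite divr_gt0 // lt_min d0.
have m0 : 0 < Num.min d d' by rewrite lt_min d0.
have rr : r < Num.min d d' by rewrite /r; lra.
move: rr; rewrite lt_min => /andP[rd rd'].
have E : cmod (z + r%:C%C - z) = r.
  by rewrite addrAC subrr add0r cmod_real gtr0_norm.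
have := hd (z + r%:C%C); rewrite E => /(_ rd) k.
have := hd' (z + r%:C%C); rewrite E => /(_ rd') k'.
set a := f _ - f z in k k'.
have := cmodD (a - D' * (z + r%:C%C - z)) (- (a - D * (z + r%:C%C - z))).
rewrite cmodN (_ : a - _ - _ = (D - D') * (z + r%:C%C - z)); last by ring.
rewrite cmodM E => k3.
have : cmod (D - D') * r <= cmod (D - D') / 2 * r by lra.
by rewrite ler_pM2r //; lra.
Qed.

Lemma cder_ext f g z D r : 0 < r -> (forall w, cmod (w - z) < r -> f w = g w) ->
  cder f z D -> cder g z D.
Proof.
move=> r0 fg cf e /cf[d d0 hd]; exists (Num.min d r); first by rewrite lt_min d0.
move=> w; rewrite lt_min => /andP[/hd h1 h2].
by rewrite -!fg // subrr cmod0.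
Qed.

Lemma cder_id z : cder id z 1.
Proof. by apply/cder_carath; exists (fun=> 1); split => [||w]; [exact: ccont_cst| |ring]. Qed.

Lemma cder_cst c z : cder (fun=> c) z 0.
Proof. by apply/cder_carath; exists (fun=> 0); split => [||w]; [exact: ccont_cst| |ring]. Qed.

Lemma cderD f g z D E : cder f z D -> cder g z E -> cder (fun w => f w + g w) z (D + E).
Proof.
move=> /cder_carath[a [ca <- ha]] /cder_carath[b [cb <- hb]]; apply/cder_carath.
exists (fun w => a w + b w); split=> // [|w]; first exact: ccontD.
by rewrite ha hb; ring.
Qed.

Lemma cderM f g z D E : cder f z D -> cder g z E ->
  cder (fun w => f w * g w) z (D * g z + f z * E).
Proof.
move=> df dg; have cg := cder_cont _ _ _ dg.
move: df dg => /cder_carath[a [ca <- ha]] /cder_carath[b [cb <- hb]]; apply/cder_carath.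
exists (fun w => a w * g w + f z * b w); split=> // [|w].
  by apply: ccontD; apply: ccontM => //; exact: ccont_cst.
by rewrite (ha w) (hb w); ring.
Qed.

Lemma cderZ c f z D : cder f z D -> cder (fun w => c * f w) z (c * D).
Proof.
move=> df; have := cderM _ _ _ _ _ (cder_cst c z) df.
by rewrite mul0r add0r.
Qed.

Lemma cderN f z D : cder f z D -> cder (fun w => - f w) z (- D).
Proof.
move=> /(cderZ (-1)); rewrite mulN1r.
by apply: cder_ext ltr01 _ => w _; rewrite mulN1r.
Qed.

Lemma cderB f g z D E : cder f z D -> cder g z E -> cder (fun w => f w - g w) z (D - E).
Proof. by move=> df /cderN; exact: cderD. Qed.

Lemma cderV f z D : f z != 0 -> cder f z D -> cder (fun w => (f w)^-1) z (- D / f z ^+ 2).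
Proof.
move=> fz df; have cf := cder_cont _ _ _ df.
have [|d d0 hd] := cf (cmod (f z)); first by rewrite cmod_gt0.
have nz w : cmod (w - z) < d -> f w != 0.
  move=> /hd; apply: contraTneq => ->; by rewrite sub0r cmodN ltxx.
move/cder_carath: df => [a [ca <- ha]]; apply/cder_carath.
(* The slope identity is required at every w, including zeros of f: the closed formula is used near
   z, the raw quotient elsewhere. *)
exists (fun w => if cmod (w - z) < d then - a w / (f w * f z)
   else ((f w)^-1 - (f z)^-1) / (w - z)); split.
- apply: (ccont_ext (fun w => - a w / (f w * f z)) _ z d) => // [w ->//|].
  apply: ccontM.
    by rewrite (_ : (fun _ => _) = (fun w => 0 - a w)); [apply: ccontB => //;
      exact: ccont_cst|apply/funext => w; rewrite sub0r].
  apply: ccontV; first by rewrite mulf_neq0.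
  by apply: ccontM => //; exact: ccont_cst.
- by rewrite subrr cmod0 d0 expr2.
- move=> w; case: ifPn => [/nz fw|].
    have E : a w * (w - z) = f w - f z by rewrite (ha w); ring.
    rewrite mulrAC mulNr E; field.
    by rewrite fw fz.
  have [->|wz] := eqVneq w z; first by rewrite subrr cmod0 d0.
  by move=> _; rewrite divfK ?subr_eq0 //; ring.
Qed.

Lemma cder_comp f g z D E : cder f z D -> cder g (f z) E ->
  cder (fun w => g (f w)) z (E * D).
Proof.
move=> df dg; have cf := cder_cont _ _ _ df.
move: df dg => /cder_carath[a [ca <- ha]] /cder_carath[b [cb <- hb]]; apply/cder_carath.
exists (fun w => b (f w) * a w); split=> // [|w].
  by apply: ccontM => //; apply: (ccont_comp f b).
have fE : f w - f z = a w * (w - z) by rewrite (ha w); ring.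
by rewrite (hb (f w)) fE; ring.
Qed.

Definition hol (U : set C) (f : Cx -> Cx) := forall z, U z -> exists D, cder f z D.

Definition cderf (f : Cx -> Cx) (z : Cx) : Cx := xget 0 [set D | cder f z D].

Lemma cderfP f z : (exists D, cder f z D) -> cder f z (cderf f z).
Proof. by move=> [D dD]; exact: (xgetPex 0 (ex_intro (fun D => cder f z D) D dD)). Qed.

Lemma cderfE f z D : cder f z D -> cderf f z = D.
Proof. by move=> h; apply: cder_unique (h); apply: cderfP; exists D. Qed.

Lemma slope_error (a b D h : Cx) : h != 0 -> a - b - D * h = - (D - h^-1 * (a - b)) * h.
Proof. by move=> h0; field. Qed.

Lemma derivable_cder (f : C -> C) z : derivable f z 1 <-> exists D, cder f z D.
Proof.
split.
  move=> df; have /cvg_ex[/= D hD] : cvg ((fun h : C => h^-1 *: (f (h *: (1:C) + z) - f z)) @ (0:C)^') := df.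
  exists D => e e0; have e0' : 0 < (e%:C%C : C) by rewrite ltcR.
  move/cvgrPdist_lt: hD => /(_ _ e0').
  rewrite near_withinE => /nbhs_discP[d d0 h].
  exists d => // w wz; have [->|nwz] := eqVneq w z; first by rewrite !subrr mulr0 subrr cmod0 mulr0.
  have wz0 : w - z != 0 by rewrite subr_eq0.
  have := h (w - z : C); rewrite /disc /= subr0 => /(_ wz wz0).
  rewrite cmod_norm ltcR => k.
  rewrite (slope_error (f w) (f z) D (w - z) wz0).
  rewrite cmodM cmodN; apply: ler_wpM2r; first exact: cmod_ge0.
  apply: ltW; apply: le_lt_trans k; rewrite le_eqVlt; apply/orP; left; apply/eqP; congr cmod.
  congr (D - _ * (f _ - _)).
  by rewrite -[_%:A]/((w - z) * 1) mulr1 subrK.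
move=> [D dD]; apply/cvg_ex; exists (D : C).
apply/cvgrPdist_lt => e' /gt0_realP[e e0 ->].
have [|d d0 h] := dD (e / 2); first by lra.
rewrite near_withinE; apply/nbhs_discP; exists d => // w; rewrite /disc /= subr0 => wd w0.
have := h (z + w); rewrite addrAC subrr add0r => /(_ wd) k.
rewrite cmod_norm ltcR.
have w0' : 0 < cmod w by rewrite cmod_gt0.
rewrite (_ : w *: (1:C) + z = z + w); last by rewrite -[w *: _]/(w * 1) mulr1 addrC.
move: k; rewrite (slope_error (f (z + w)) (f z) D w w0) cmodM cmodN ler_pM2r // => k.
apply: le_lt_trans k _; lra.
Qed.

Lemma holomorphic_hol U f : holomorphic_on U f <-> hol U f.
Proof. by split => h z /h /derivable_cder. Qed.

Lemma hol_sub U V f : U `<=` V -> hol V f -> hol U f.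
Proof. by move=> UV h z /UV /h. Qed.

Lemma hol_cont U f z : hol U f -> U z -> ccont f z.
Proof. by move=> h /h[D /cder_cont]. Qed.

Lemma holD U f g : hol U f -> hol U g -> hol U (fun z => f z + g z).
Proof. by move=> hf hg z Uz; have [D dD] := hf z Uz; have [E dE] := hg z Uz; exists (D + E);
  exact: cderD. Qed.

Lemma holB U f g : hol U f -> hol U g -> hol U (fun z => f z - g z).
Proof. by move=> hf hg z Uz; have [D dD] := hf z Uz; have [E dE] := hg z Uz; exists (D - E);
  exact: cderB. Qed.

Lemma holM U f g : hol U f -> hol U g -> hol U (fun z => f z * g z).
Proof. by move=> hf hg z Uz; have [D dD] := hf z Uz; have [E dE] := hg z Uz; eexists; exact: cderM dD dE. Qed.

Lemma hol_cst U c : hol U (fun=> c).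
Proof. by move=> z _; exists 0; exact: cder_cst. Qed.

Lemma hol_id U : hol U id.
Proof. by move=> z _; exists 1; exact: cder_id. Qed.

Lemma holV U f : hol U f -> (forall z, U z -> f z != 0) -> hol U (fun z => (f z)^-1).
Proof. by move=> hf f0 z Uz; have [D dD] := hf z Uz; eexists; apply: cderV dD; exact: f0. Qed.

Lemma hol_comp U V f g : hol U f -> hol V g -> (forall z, U z -> V (f z)) -> hol U (fun z => g (f z)).
Proof.
move=> hf hg fUV z Uz; have [D dD] := hf z Uz; have [E dE] := hg _ (fUV z Uz).
by eexists; exact: cder_comp dD dE.
Qed.

Lemma hol_cauchy U a : (forall z, U z -> z != a) -> hol U (fun z => (z - a)^-1).
Proof.
move=> Ua; apply: holV; first by apply: holB; [exact: hol_id|exact: hol_cst].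
by move=> z /Ua; rewrite subr_eq0.
Qed.

Lemma open_preim U f (V : set C) : open U -> hol U f -> open V -> open (U `&` f @^-1` V).
Proof.
move=> oU hf oV; apply/open_discP => z [Uz Vz].
have [r r0 hr] := proj1 (open_discP _) oU z Uz.
have [s s0 hs] := proj1 (open_discP _) oV _ Vz.
have [d d0 hd] := hol_cont _ _ _ hf Uz s s0.
exists (Num.min r d); first by rewrite lt_min r0.
by move=> w; rewrite /disc /= lt_min => /andP[? ?]; split; [exact: hr|apply: hs; exact: hd].
Qed.

Lemma hol_image_compact K U f : compact K -> K `<=` U -> hol U f -> compact (f @` K : set C).
Proof.
move=> cK KU hf; apply: continuous_compact => //.
apply: continuous_in_subspaceT => z /set_mem Kz.
by apply/ccontP; apply: hol_cont hf _; exact: KU.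
Qed.

(** * A compact exhaustion of open sets *)

(** The plane is a continuous image of [R * R], where a closed box is compact as a product of
    segments. *)
Lemma compact_HB (K : set C) m : closed K -> (forall z, K z -> cmod z <= m) -> compact K.
Proof.
move=> cK Km.
pose h (p : R * R) : C := (p.1)%:C%C + 'i%C * (p.2)%:C%C.
have ch : continuous h.
  move=> p; apply/(@cvgrPdist_lt Cx C) => e' /gt0_realP[e e0 ->].
  have e20 : 0 < e / 2 by lra.
  exists (ball p.1 (e / 2), ball p.2 (e / 2)); first by split; exact: nbhsx_ballx.
  move=> q [/= q1 q2]; rewrite cmod_norm ltcR.
  have {}q1 : `|p.1 - q.1| < e / 2 := q1.
  have {}q2 : `|p.2 - q.2| < e / 2 := q2.
  rewrite (_ : h p - h q = (p.1 - q.1)%:C%C + 'i%C * (p.2 - q.2)%:C%C :> Cx); last first.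
    by rewrite /h !rmorphB /=; ring.
  apply: le_lt_trans (cmodD _ _) _; rewrite cmodM cmod_i mul1r !cmod_real.
  by lra.
apply: (@subclosed_compact _ K (h @` (`[- m, m] `*` `[- m, m]))) => //.
  apply: continuous_compact; first exact: continuous_subspaceT.
  by apply: compact_setX; exact: segment_compact.
move=> z /Km zm; exists (Re z, Im z); last by rewrite /h -ReImE.
by split; rewrite /= in_itv /= -ler_norml; apply: le_trans _ zm; [exact: normRe|exact: normIm].
Qed.

Lemma closed_discP (K : set C) :
  (forall z, ~ K z -> exists2 r : R, 0 < r & forall w, disc z r w -> ~ K w) -> closed K.
Proof.
move=> h; rewrite -openC -[K]setCK; apply/open_discP => z.
rewrite !setCK => nKz; have [r r0 hr] := h z nKz; by exists r.
Qed.

(** The distance condition is multiplied out: it is vacuous when G is the whole plane, and for n = 0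
    it makes the set empty otherwise. *)
Definition exh (G : set C) (n : nat) : set C :=
  [set z : C | cmod z <= n%:R /\ forall b, ~ G b -> 1 <= n%:R * cmod (z - b)].

Lemma exh_compact G n : compact (exh G n).
Proof.
apply: (@compact_HB _ n%:R); last by move=> z [].
apply: closed_discP => z /not_andP[/negP|/existsNP[b /not_implyP[nGb /negP]]].
  rewrite -ltNge => nz; exists (cmod z - n%:R); first by rewrite subr_gt0.
  move=> w; rewrite /disc /= => wz [wn _].
  by have := cmod_leB z w; rewrite (cmodB z); lra.
rewrite -ltNge => zb; have n0 : (0 : R) <= n%:R by rewrite ler0n.
(* Dividing by n + 1 rather than n covers n = 0. *)
exists ((1 - n%:R * cmod (z - b)) / n.+1%:R).
  by rewrite divr_gt0 ?ltr0n // subr_gt0.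
move=> w; rewrite /disc /= ltr_pdivlMr ?ltr0n // => wz [_ /(_ b nGb)].
have := cmod_tri z w b; have := cmod_ge0 (w - z).
by move: wz; rewrite -natr1; nra.
Qed.

Lemma exh_sub G n : exh G n `<=` G.
Proof.
move=> z [_ h]; apply: contrapT => /h; rewrite subrr cmod0 mulr0 => ?; lra.
Qed.

Lemma exhP G n z : ~ exh G n z ->
  n%:R < cmod z \/ exists2 b, ~ G b & n%:R * cmod (z - b) < 1.
Proof.
move=> /not_andP[/negP|/existsNP[b /not_implyP[nGb /negP]]]; rewrite -ltNge; first by left.
by right; exists b.
Qed.

Lemma exh_absorb (G K : set C) : open G -> compact K -> K `<=` G ->
  exists n : nat, exists2 r : R, 0 < r & forall z w, K z -> cmod (w - z) <= r -> exh G n w.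
Proof.
move=> oG cK KG; have [r r0 hr] := compact_disc_sub K G cK oG KG.
have [m hm] := compact_bounded K cK.
(* The bound m + r keeps the enlarged set in the disc of radius n; the bound 2/r makes the remaining
   distance r/2 to the complement of G at least 1/n. *)
pose n := (Num.trunc (Num.max (m + r) (2 / r))).+1.
have nE : Num.max (m + r) (2 / r) < n%:R by rewrite /n truncnS_gt.
move: nE; rewrite gt_max => /andP[n1 n2].
exists n; exists (r / 2); first by lra.
move=> z w Kz wz; split.
  have := hm z Kz; have := cmod_leB w z; lra.
move=> b nGb; have n20 : 0 < n%:R :> R by apply: lt_trans n2; rewrite divr_gt0.
have rb : r / 2 <= cmod (w - b).
  rewrite leNgt; apply/negP => wb; apply: nGb; apply: (hr z) => //.
  by rewrite /disc /=; have := cmod_tri w b z; rewrite (cmodB b w); lra.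
move: n2; rewrite ltr_pdivrMr // => n2; nra.
Qed.

(** Inside X, the points satisfying P are cut out by a union of discs of radius r, and so are the
    others; connectedness leaves only one of the two. *)
Lemma connected_ind (X : set C) (P : C -> Prop) (r : R) : connected X -> 0 < r ->
  (forall x y, X x -> X y -> cmod (x - y) < r -> P x -> P y) ->
  (exists2 x, X x & P x) -> forall x, X x -> P x.
Proof.
move=> cX r0 step [x0 Xx0 Px0] x Xx.
have BX : X `&` P = X.
  apply: cX; first by exists x0.
  - exists (\bigcup_(y in X `&` P) disc y r); first by apply: bigcup_open => *; exact: open_disc.
    apply/seteqP; split=> y [Xy] => [Py|[z [Xz Pz] zy]].
      by split => //; exists y => //; exact: disc_center.
    by split => //; apply: (step z) => //; rewrite cmodB.
  - exists (~` \bigcup_(y in X `&` ~` P) disc y r).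
      by rewrite closedC; apply: bigcup_open => *; exact: open_disc.
    apply/seteqP; split=> y [Xy] => [Py|hy].
      by split => // -[z [Xz nPz] zy]; apply: nPz; apply: (step y).
    split => //; apply: contrapT => nPy; apply: hy.
    by exists y => //; exact: disc_center.
by rewrite -BX in Xx; case: Xx.
Qed.

(** Simple connectedness acts only through this principle. A point off [exh G n] is far away or
    close to some b off G; the component of b in the complement of G is unbounded, so it contains a
    point of modulus > n, from which P travels to b in steps shorter than 1/(n+1) that stay off
    G. *)
Lemma simply_connected_ind (G : set C) (n : nat) (P : C -> Prop) : simply_connected G ->
  (forall a, n%:R < cmod a -> P a) ->
  (forall a b, ~ G b -> n%:R * cmod (a - b) < 1 -> P b -> P a) ->
  forall a, ~ exh G n a -> P a.
Proof.
move=> scG hbig hstep a /exhP[/hbig //|[b nGb ab]]; apply: (hstep a b nGb ab).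
have n0 : (0 : R) <= n%:R by rewrite ler0n.
apply: (@connected_ind (connected_component (~` G) b) P (n.+1%:R^-1)).
- exact: component_connected.
- by rewrite invr_gt0 ltr0n.
- move=> x y /connected_component_sub nGx _; rewrite -[X in _ < X]mul1r ltr_pdivlMr ?ltr0n // => xy.
  apply: hstep => //; rewrite cmodB; apply: le_lt_trans xy.
  by rewrite mulrC ler_wpM2l ?cmod_ge0 // ler_nat.
- apply: contrapT => h; apply: (scG b nGb); apply/bounded_setP; exists n%:R => z bz.
  by rewrite leNgt; apply/negP => /hbig Pz; apply: h; exists z.
- exact: connected_component_refl.
Qed.

(** * Integrals of complex-valued functions of a real variable *)

Local Notation RInt := (@RInt.RInt Hierarchy.R_CompleteNormedModule).
Local Notation ex_RInt := (@RInt.ex_RInt Hierarchy.R_NormedModule).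

Definition rcont (g : R -> Cx) (x : R) := forall e : R, 0 < e ->
  exists2 d : R, 0 < d & forall y, `|y - x| < d -> cmod (g y - g x) < e.

Definition cint (g : R -> Cx) (a b : R) : Cx :=
  (RInt (fun t => Re (g t)) a b)%:C%C +
  'i%C * (RInt (fun t => Im (g t)) a b)%:C%C.

#[global] Arguments cint : simpl never.

Definition cintegrable (g : R -> Cx) (a b : R) : Prop :=
  ex_RInt (fun t => Re (g t)) a b /\ ex_RInt (fun t => Im (g t)) a b.

Lemma ReB (x y : Cx) : Re (x - y) = Re x - Re y.
Proof. by case: x; case: y. Qed.

Lemma ImB (x y : Cx) : Im (x - y) = Im x - Im y.
Proof. by case: x; case: y. Qed.

Lemma RnormE (x : R) : Rbasic_fun.Rabs x = `|x|.
Proof. by []. Qed.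

Lemma RInt_cont_ex (g : R -> R) a b :
  (forall x, (a <= x <= b) || (b <= x <= a) -> forall e : R, 0 < e ->
     exists2 d : R, 0 < d & forall y, `|y - x| < d -> `|g y - g x| < e) ->
  ex_RInt g a b.
Proof.
move=> h; apply: (@RInt.ex_RInt_continuous Hierarchy.R_CompleteNormedModule) => x [/RleP h1 /RleP h2].
apply/Hierarchy.filterlim_locally => e.
have [||d d0 hd] := h x _ (RIneq.pos e).
- move: h1 h2; rewrite RminE RmaxE; case: (leP a b) => ab h1 h2; apply/orP; [left|right]; exact/andP.
- by apply/RltP; exact: RIneq.cond_pos.
exists (RIneq.mkposreal d (elimT RltP d0)) => y yx.
apply/RltP; rewrite /Hierarchy.minus; apply: hd.
exact/RltP.
Qed.

Lemma cex_cont g a b : (forall x, (a <= x <= b) || (b <= x <= a) -> rcont g x) -> cintegrable g a b.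
Proof.
move=> h; split; apply: RInt_cont_ex => x /h cg e /cg[d d0 hd]; exists d => // y /hd.
  by apply: le_lt_trans; rewrite -ReB normRe.
by apply: le_lt_trans; rewrite -ImB normIm.
Qed.

Lemma cex_le g a b : a <= b -> (forall x, a <= x <= b -> rcont g x) -> cintegrable g a b.
Proof.
move=> ab h; apply: cex_cont => x /orP[/h //|/andP[bx xa]].
by apply: h; rewrite (le_trans ab bx) (le_trans xa ab).
Qed.

Lemma cI_chasles g b a c : cintegrable g a b -> cintegrable g b c -> cint g a b + cint g b c = cint g a c.
Proof.
move=> [r1 i1] [r2 i2]; rewrite /cint.
rewrite -(@RInt.RInt_Chasles Hierarchy.R_CompleteNormedModule _ a b c r1 r2).
rewrite -(@RInt.RInt_Chasles Hierarchy.R_CompleteNormedModule _ a b c i1 i2).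
by rewrite /Hierarchy.plus /= !RplusE !rmorphD /=; ring.
Qed.

Lemma cI_swap g a b : cintegrable g a b -> cint g b a = - cint g a b.
Proof.
move=> [r1 i1]; rewrite /cint.
rewrite -(@RInt.opp_RInt_swap Hierarchy.R_CompleteNormedModule _ a b r1).
rewrite -(@RInt.opp_RInt_swap Hierarchy.R_CompleteNormedModule _ a b i1).
by rewrite /Hierarchy.opp /= !RoppE !rmorphN /=; ring.
Qed.

Lemma cex_swap g a b : cintegrable g a b -> cintegrable g b a.
Proof. by move=> [r1 i1]; split; exact: RInt.ex_RInt_swap. Qed.

Lemma is_RInt_comb (f g h : R -> R) (c d a b : R) :
  ex_RInt f a b -> ex_RInt g a b -> ex_RInt h a b ->
  @RInt.is_RInt Hierarchy.R_NormedModule (fun t => c * f t + d * g t + h t) a b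
    (c * RInt f a b + d * RInt g a b + RInt h a b).
Proof.
move=> /(@RInt.RInt_correct Hierarchy.R_CompleteNormedModule) hf.
move=> /(@RInt.RInt_correct Hierarchy.R_CompleteNormedModule) hg.
move=> /(@RInt.RInt_correct Hierarchy.R_CompleteNormedModule) hh.
exact: (@RInt.is_RInt_plus Hierarchy.R_NormedModule _ _ _ _ _ _
  (@RInt.is_RInt_plus Hierarchy.R_NormedModule _ _ _ _ _ _
    (@RInt.is_RInt_scal Hierarchy.R_NormedModule _ _ _ c _ hf)
    (@RInt.is_RInt_scal Hierarchy.R_NormedModule _ _ _ d _ hg)) hh).
Qed.

Lemma Re_lin c1 c2 (z w : Cx) : Re (Complex c1 c2 * z + w) =
  c1 * Re z + (- c2) * Im z + Re w.
Proof. by case: z => z1 z2; case: w => w1 w2 /=; rewrite mulNr. Qed.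

Lemma Im_lin c1 c2 (z w : Cx) : Im (Complex c1 c2 * z + w) =
  c1 * Im z + c2 * Re z + Im w.
Proof. by case: z => z1 z2; case: w => w1 w2. Qed.

Lemma cI_lin_ex c f g a b : cintegrable f a b -> cintegrable g a b ->
  cintegrable (fun t => c * f t + g t) a b /\
  cint (fun t => c * f t + g t) a b = c * cint f a b + cint g a b.
Proof.
case: c => c1 c2 [r1 i1] [r2 i2].
have hr := is_RInt_comb _ _ _ c1 (- c2) _ _ r1 i1 r2.
have hi := is_RInt_comb _ _ _ c1 c2 _ _ i1 r1 i2.
have er : (fun t => Re (Complex c1 c2 * f t + g t)) =
   (fun t => c1 * Re (f t) + (- c2) * Im (f t) + Re (g t)).
  by apply/funext => t; rewrite Re_lin.
have ei : (fun t => Im (Complex c1 c2 * f t + g t)) =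
   (fun t => c1 * Im (f t) + c2 * Re (f t) + Im (g t)).
  by apply/funext => t; rewrite Im_lin.
split; first by split;
  [exists (c1 * RInt (fun t => Re (f t)) a b + (- c2) * RInt (fun t => Im (f t)) a b + RInt (fun t
    => Re (g t)) a b); rewrite er|
   exists (c1 * RInt (fun t => Im (f t)) a b + c2 * RInt (fun t => Re (f t)) a b + RInt (fun t =>
     Im (g t)) a b); rewrite ei].
rewrite /cint er ei (@RInt.is_RInt_unique Hierarchy.R_CompleteNormedModule _ _ _ _ hr).
rewrite (@RInt.is_RInt_unique Hierarchy.R_CompleteNormedModule _ _ _ _ hi).
apply/eqP; rewrite eq_complex /= !(mul0r, mul1r, mulr0, addr0, add0r, subr0, sub0r, oppr0).
by apply/andP; split; apply/eqP; ring.
Qed.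

Lemma cex_lin c f g a b : cintegrable f a b -> cintegrable g a b -> cintegrable (fun t => c * f t + g t) a b.
Proof. by move=> hf hg; case: (cI_lin_ex c _ _ _ _ hf hg). Qed.

Lemma cI_lin c f g a b : cintegrable f a b -> cintegrable g a b ->
  cint (fun t => c * f t + g t) a b = c * cint f a b + cint g a b.
Proof. by move=> hf hg; case: (cI_lin_ex c _ _ _ _ hf hg). Qed.

Lemma cI_ext f g a b : (forall x, (a <= x <= b) || (b <= x <= a) -> f x = g x) -> cint f a b = cint g a b.
Proof.
move=> fg; rewrite /cint.
have {}fg x : Rdefinitions.Rlt (Rbasic_fun.Rmin a b) x /\ Rdefinitions.Rlt x (Rbasic_fun.Rmax a b)
  -> f x = g x.
  move=> [/RltP h1 /RltP h2]; apply: fg.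
  by move: h1 h2; rewrite RminE RmaxE; case: (leP a b) => ab h1 h2; apply/orP; [left|right]; rewrite !ltW.
rewrite (@RInt.RInt_ext Hierarchy.R_CompleteNormedModule (fun t => Re (f t)) (fun t => Re (g t)) a
  b); last by move=> t ht; rewrite /= fg.
by rewrite (@RInt.RInt_ext Hierarchy.R_CompleteNormedModule (fun t => Im (f t)) (fun t => Im (g t))
  a b); last by move=> t ht; rewrite /= fg.
Qed.

Lemma cex_const c a b : cintegrable (fun=> c) a b.
Proof. by split; exact: RInt.ex_RInt_const. Qed.

Lemma cI_const c a b : cint (fun=> c) a b = (b - a)%:C%C * c.
Proof.
rewrite /cint !(@RInt.RInt_const Hierarchy.R_CompleteNormedModule) [in RHS](ReImE c).
rewrite /Hierarchy.scal /= /Hierarchy.mult /= !RmultE !RminusE !rmorphM /=.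
by rewrite mulrDr; congr (_ + _); rewrite mulrCA.
Qed.

(** The factor 2 comes from bounding the real and imaginary parts separately; it accounts for the 4,
    16 and 32 in later estimates. *)
Lemma cI_bound g a b m : a <= b -> cintegrable g a b -> (forall x, a <= x <= b -> cmod (g x) <= m) ->
  cmod (cint g a b) <= 2 * m * (b - a).
Proof.
move=> ab [r1 i1] gm; apply: le_trans (cmodD _ _) _; rewrite cmodM cmod_i mul1r !cmod_real.
have h1 : `|RInt (fun t => Re (g t)) a b| <= (b - a) * m.
  rewrite -RnormE; apply/RleP; apply: RInt.abs_RInt_le_const => //; first exact/RleP.
  move=> t [/RleP h1 /RleP h2]; apply/RleP; rewrite RnormE; apply: le_trans (normRe _) _.
  by apply: gm; rewrite h1.
have h2 : `|RInt (fun t => Im (g t)) a b| <= (b - a) * m.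
  rewrite -RnormE; apply/RleP; apply: RInt.abs_RInt_le_const => //; first exact/RleP.
  move=> t [/RleP h1' /RleP h2]; apply/RleP; rewrite RnormE; apply: le_trans (normIm _) _.
  by apply: gm; rewrite h1'.
lra.
Qed.

Definition rder (G : R -> Cx) (x : R) (D : Cx) := forall e : R, 0 < e ->
  exists2 d : R, 0 < d & forall y, `|y - x| < d ->
    cmod (G y - G x - D * (y - x)%:C%C) <= e * `|y - x|.

Lemma RInt_FTC (G g : R -> R) a b : a <= b ->
  (forall x, a <= x <= b -> forall e : R, 0 < e ->
     exists2 d : R, 0 < d & forall y, `|y - x| < d -> `|g y - g x| < e) ->
  (forall x, a <= x <= b -> forall e : R, 0 < e ->
     exists2 d : R, 0 < d & forall y, `|y - x| < d -> `|G y - G x - g x * (y - x)| <= e * `|y - x|) ->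
  RInt g a b = G b - G a.
Proof.
move=> ab hg hG; apply: (@RInt.is_RInt_unique Hierarchy.R_CompleteNormedModule).
have bd x : Rdefinitions.Rle (Rbasic_fun.Rmin a b) x /\ Rdefinitions.Rle x (Rbasic_fun.Rmax a b) ->
  a <= x <= b.
  by move=> [/RleP h1 /RleP h2]; move: h1 h2; rewrite RminE RmaxE min_l // max_r // => -> ->.
apply: (@RInt_analysis.is_RInt_derive Hierarchy.R_CompleteNormedModule) => x /bd hx.
  apply/Derive.is_derive_Reals => e /RltP e0; have {}e0 : (0 : R) < e := e0.
  have [|d d0 hd] := hG x hx (e / 2); first by lra.
  exists (RIneq.mkposreal d (elimT RltP d0)) => h /eqP h0 /RltP.
  rewrite RnormE /= => hh; apply/RltP; rewrite RnormE.
  have := hd (x + h); rewrite addrAC subrr add0r => /(_ hh) k.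
  rewrite RdivE !RminusE RplusE.
  have hp : 0 < `|h| by rewrite normr_gt0.
  move: k; rewrite (_ : _ - _ - _ = ((G (x + h) - G x) / h - g x) * h); last by field.
  by rewrite normrM ler_pM2r //; lra.
apply/Hierarchy.filterlim_locally => e.
have [|d d0 hd] := hg x hx (RIneq.pos e).
  by apply/RltP; exact: RIneq.cond_pos.
exists (RIneq.mkposreal d (elimT RltP d0)) => y yx.
apply/RltP; rewrite /Hierarchy.minus; apply: hd.
exact/RltP.
Qed.

Lemma cI_FTC (G g : R -> Cx) a b : a <= b ->
  (forall x, a <= x <= b -> rcont g x) -> (forall x, a <= x <= b -> rder G x (g x)) ->
  cint g a b = G b - G a.
Proof.
move=> ab hg hG; rewrite /cint.
rewrite (RInt_FTC (fun t => Re (G t)) (fun t => Re (g t)) a b ab); first last.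
- move=> x /hG dG e /dG[d d0 hd]; exists d => // y /hd; apply: le_trans.
  rewrite (_ : _ - _ - _ = Re (G y - G x - g x * (y - x)%:C%C)) ?normRe //.
  by case: (G y) => ? ?; case: (G x) => ? ?; case: (g x) => ? ? /=; rewrite mulr0 subr0.
- move=> x /hg cg e /cg[d d0 hd]; exists d => // y /hd.
  by apply: le_lt_trans; rewrite -ReB normRe.
rewrite (RInt_FTC (fun t => Im (G t)) (fun t => Im (g t)) a b ab); first last.
- move=> x /hG dG e /dG[d d0 hd]; exists d => // y /hd; apply: le_trans.
  rewrite (_ : _ - _ - _ = Im (G y - G x - g x * (y - x)%:C%C)) ?normIm //.
  by case: (G y) => ? ?; case: (G x) => ? ?; case: (g x) => ? ? /=; rewrite mulr0 add0r.
- move=> x /hg cg e /cg[d d0 hd]; exists d => // y /hd.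
  by apply: le_lt_trans; rewrite -ImB normIm.
by rewrite -ReB -ImB -ReImE.
Qed.

(** * Goursat's theorem for rectangles *)

Definition hseg_int (f : Cx -> Cx) (y a b : R) : Cx := cint (fun t => f (Complex t y)) a b.
Definition vseg_int (f : Cx -> Cx) (x c d : R) : Cx := 'i%C * cint (fun t => f (Complex x t)) c d.
(** Sides are parametrised rightwards and upwards, so the counterclockwise boundary takes the top
    and left sides with a minus sign. *)
Definition rect_int (f : Cx -> Cx) (a b c d : R) : Cx :=
  hseg_int f c a b + vseg_int f b c d - hseg_int f d a b - vseg_int f a c d.

#[global] Arguments hseg_int : simpl never.
#[global] Arguments vseg_int : simpl never.
#[global] Arguments rect_int : simpl never.

Definition rect (a b c d : R) : set C :=
  [set z : C | (a <= Re z <= b) && (c <= Im z <= d)].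

Definition rect_frame (a b c d : R) : set C :=
  [set z : C | rect a b c d z /\ [\/ Re z = a, Re z = b, Im z = c | Im z = d]].

Lemma cmod_h (x t y : R) : cmod (Complex t y - Complex x y) = `|t - x|.
Proof. by rewrite (_ : _ - _ = (t - x)%:C%C) ?cmod_real //; congr Complex; rewrite subrr. Qed.

Lemma cmod_v (x s t : R) : cmod (Complex x t - Complex x s) = `|t - s|.
Proof.
rewrite (_ : _ - _ = 'i%C * (t - s)%:C%C); first by rewrite cmodM cmod_i mul1r cmod_real.
by apply/eqP; rewrite eq_complex /= !(mul0r, mul1r, mulr0) subrr subr0 add0r !eqxx.
Qed.

Lemma ccont_h f x y : ccont f (Complex x y) -> rcont (fun t => f (Complex t y)) x.
Proof. by move=> cf e /cf[d d0 hd]; exists d => // t tx; apply: hd; rewrite cmod_h. Qed.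

Lemma ccont_v f x y : ccont f (Complex x y) -> rcont (fun t => f (Complex x t)) y.
Proof. by move=> cf e /cf[d d0 hd]; exists d => // t tx; apply: hd; rewrite cmod_v. Qed.

Lemma cder_h f x y D : cder f (Complex x y) D -> rder (fun t => f (Complex t y)) x D.
Proof.
move=> df e /df[d d0 hd]; exists d => // t tx; have := hd (Complex t y); rewrite cmod_h => /(_ tx).
by rewrite (_ : Complex t y - _ = (t - x)%:C%C) //; congr Complex; rewrite subrr.
Qed.

Lemma cder_v f x y D : cder f (Complex x y) D -> rder (fun t => f (Complex x t)) y ('i%C * D).
Proof.
move=> df e /df[d d0 hd]; exists d => // t tx; have := hd (Complex x t); rewrite cmod_v => /(_ tx).
rewrite (_ : Complex x t - _ = 'i%C * (t - y)%:C%C); first by rewrite mulrA (mulrC D).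
by apply/eqP; rewrite eq_complex /= !(mul0r, mul1r, mulr0) subrr subr0 add0r !eqxx.
Qed.

Lemma hI_ex f y a b : a <= b -> (forall x, a <= x <= b -> ccont f (Complex x y)) ->
  cintegrable (fun t => f (Complex t y)) a b.
Proof. by move=> ab h; apply: cex_le => // x /h /ccont_h. Qed.

Lemma vI_ex f x c d : c <= d -> (forall y, c <= y <= d -> ccont f (Complex x y)) ->
  cintegrable (fun t => f (Complex x t)) c d.
Proof. by move=> ab h; apply: cex_le => // y /h /ccont_v. Qed.

Lemma hI_FTC F f y a b : a <= b -> (forall x, a <= x <= b -> ccont f (Complex x y)) ->
  (forall x, a <= x <= b -> cder F (Complex x y) (f (Complex x y))) ->
  hseg_int f y a b = F (Complex b y) - F (Complex a y).
Proof.
move=> ab cf dF; rewrite /hseg_int (cI_FTC (fun t => F (Complex t y))) // => x hx.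
  exact/ccont_h/cf.
exact/cder_h/dF.
Qed.

Lemma vI_FTC F f x c d : c <= d -> (forall y, c <= y <= d -> ccont f (Complex x y)) ->
  (forall y, c <= y <= d -> cder F (Complex x y) (f (Complex x y))) ->
  vseg_int f x c d = F (Complex x d) - F (Complex x c).
Proof.
move=> cd cf dF; rewrite /vseg_int.
have cf' : forall y, c <= y <= d -> rcont (fun t => 'i%C * f (Complex x t)) y.
  by move=> y /cf cfy; apply: (ccont_v (fun z => 'i%C * f z)); apply: ccontM => //; exact: ccont_cst.
rewrite -(cI_FTC (fun t => F (Complex x t)) (fun t => 'i%C * f (Complex x t))) //; last first.
  by move=> y hy; exact/cder_v/dF.
have h1 := vI_ex f x c d cd cf; have h2 := cex_const 0 c d.
rewrite -[LHS]addr0 -[X in _ + X](mulr0 ((d - c)%:C%C)) -cI_const -cI_lin //.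
by congr cint; apply/funext => t; rewrite addr0.
Qed.

Section frame.
Variables (a b c d : R).
Hypotheses (ab : a <= b) (cd : c <= d).

Lemma fr_bot x : a <= x <= b -> rect_frame a b c d (Complex x c).
Proof. by move=> hx; split; rewrite /rect /= ?hx ?lexx ?cd //; exact: Or43. Qed.
Lemma fr_top x : a <= x <= b -> rect_frame a b c d (Complex x d).
Proof. by move=> hx; split; rewrite /rect /= ?hx ?lexx ?cd //; exact: Or44. Qed.
Lemma fr_lef y : c <= y <= d -> rect_frame a b c d (Complex a y).
Proof. by move=> hx; split; rewrite /rect /= ?hx ?lexx ?ab //; exact: Or41. Qed.
Lemma fr_rig y : c <= y <= d -> rect_frame a b c d (Complex b y).
Proof. by move=> hx; split; rewrite /rect /= ?hx ?lexx ?ab //; exact: Or42. Qed.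

Lemma fr_ex (f : Cx -> Cx) : (forall z, rect_frame a b c d z -> ccont f z) ->
  [/\ cintegrable (fun t => f (Complex t c)) a b, cintegrable (fun t => f (Complex t d)) a b,
      cintegrable (fun t => f (Complex a t)) c d & cintegrable (fun t => f (Complex b t)) c d].
Proof.
move=> h; split.
- by apply: hI_ex => // x /fr_bot /h.
- by apply: hI_ex => // x /fr_top /h.
- by apply: vI_ex => // x /fr_lef /h.
- by apply: vI_ex => // x /fr_rig /h.
Qed.

Lemma rI_lin k f g : (forall z, rect_frame a b c d z -> ccont f z) ->
  (forall z, rect_frame a b c d z -> ccont g z) ->
  rect_int (fun z => k * f z + g z) a b c d = k * rect_int f a b c d + rect_int g a b c d.
Proof.
by move=> /fr_ex[? ? ? ?] /fr_ex[? ? ? ?]; rewrite /rect_int /hseg_int /vseg_int !cI_lin //; ring.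
Qed.

Lemma rI_ext f g : (forall z, rect_frame a b c d z -> f z = g z) -> rect_int f a b c d = rect_int g a b c d.
Proof.
move=> fg.
have sw (u v x : R) : u <= v -> (u <= x <= v) || (v <= x <= u) -> u <= x <= v.
  by move=> uv /orP[//|/andP[vx xu]]; rewrite (le_trans uv vx) (le_trans xu uv).
rewrite /rect_int /hseg_int /vseg_int; congr (_ + _ * _ - _ - _ * _); apply: cI_ext => x /sw hx; apply: fg.
- exact/fr_bot/hx.
- exact/fr_rig/hx.
- exact/fr_top/hx.
- exact/fr_lef/hx.
Qed.

Lemma rI_bound f m : (forall z, rect_frame a b c d z -> ccont f z) ->
  (forall z, rect_frame a b c d z -> cmod (f z) <= m) ->
  cmod (rect_int f a b c d) <= 4 * m * ((b - a) + (d - c)).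
Proof.
move=> /fr_ex[e1 e2 e3 e4] fm.
have := cI_bound _ _ _ _ ab e1 (fun x hx => fm _ (fr_bot x hx)).
have := cI_bound _ _ _ _ ab e2 (fun x hx => fm _ (fr_top x hx)).
have := cI_bound _ _ _ _ cd e3 (fun x hx => fm _ (fr_lef x hx)).
have := cI_bound _ _ _ _ cd e4 (fun x hx => fm _ (fr_rig x hx)).
rewrite /rect_int /hseg_int /vseg_int => h4 h3 h2 h1.
apply: le_trans (cmodD _ _) _; rewrite cmodN cmodM cmod_i mul1r.
have := cmodD (cint (fun t => f (Complex t c)) a b + 'i%C * cint (fun t => f (Complex b t)) c d)
  (- cint (fun t => f (Complex t d)) a b).
have := cmodD (cint (fun t => f (Complex t c)) a b) ('i%C * cint (fun t => f (Complex b t)) c d).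
rewrite cmodN cmodM cmod_i mul1r; lra.
Qed.

Lemma rI_FTC F f : (forall z, rect_frame a b c d z -> ccont f z) ->
  (forall z, rect_frame a b c d z -> cder F z (f z)) -> rect_int f a b c d = 0.
Proof.
move=> cf dF; rewrite /rect_int (hI_FTC F) ?(hI_FTC F f d) ?(vI_FTC F) ?(vI_FTC F f a) //; try ring.
all: move=> x hx; by [exact/cf/fr_bot|exact/dF/fr_bot|exact/cf/fr_top|exact/dF/fr_top|
  exact/cf/fr_lef|exact/dF/fr_lef|exact/cf/fr_rig|exact/dF/fr_rig].
Qed.

End frame.

Lemma rI_cutx f a m b c d : a <= m -> m <= b ->
  (forall x, a <= x <= b -> ccont f (Complex x c)) ->
  (forall x, a <= x <= b -> ccont f (Complex x d)) ->
  rect_int f a b c d = rect_int f a m c d + rect_int f m b c d.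
Proof.
move=> am mb h1 h2; rewrite /rect_int.
have E y : (forall x, a <= x <= b -> ccont f (Complex x y)) -> hseg_int f y a b = hseg_int f y a m
  + hseg_int f y m b.
  move=> h; rewrite /hseg_int cI_chasles //; apply: hI_ex => // x /andP[u v]; apply: h.
    by rewrite u (le_trans v).
  by rewrite v (le_trans am).
by rewrite (E c) // (E d) //; ring.
Qed.

Lemma rI_cuty f a b c m d : c <= m -> m <= d ->
  (forall y, c <= y <= d -> ccont f (Complex a y)) ->
  (forall y, c <= y <= d -> ccont f (Complex b y)) ->
  rect_int f a b c d = rect_int f a b c m + rect_int f a b m d.
Proof.
move=> am mb h1 h2; rewrite /rect_int.
have E x : (forall y, c <= y <= d -> ccont f (Complex x y)) -> vseg_int f x c d = vseg_int f x c m
  + vseg_int f x m d.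
  move=> h; rewrite /vseg_int -mulrDr cI_chasles //; apply: vI_ex => // y /andP[u v]; apply: h.
    by rewrite u (le_trans v).
  by rewrite v (le_trans am).
by rewrite (E a) // (E b) //; ring.
Qed.

Lemma pow2_small (A e : R) : 0 < e -> exists n : nat, A / 2 ^+ n < e.
Proof.
move=> e0; have [n h1] : exists n : nat, A / e < n%:R.
  by exists (Num.trunc (A / e)).+1; exact: truncnS_gt.
exists n.
have h2 : (n%:R : R) <= 2 ^+ n by rewrite -natrX ler_nat ltnW // ltn_expl.
have p2 : (0 : R) < 2 ^+ n by rewrite exprn_gt0 // ltr0n.
by rewrite ltr_pdivrMr // mulrC -ltr_pdivrMr //; apply: lt_le_trans h2.
Qed.

Lemma nested_intervals (u v : nat -> R) : (forall n, u n <= u n.+1) ->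
  (forall n, v n.+1 <= v n) -> (forall n, u n <= v n) ->
  exists X, forall n, u n <= X <= v n.
Proof.
move=> hu hv huv.
have mu n k : u n <= u (n + k)%N.
  by elim: k => [|k IH]; rewrite ?addn0 // addnS (le_trans IH).
have mv n k : v (n + k)%N <= v n.
  by elim: k => [|k IH]; rewrite ?addn0 // addnS (le_trans _ IH).
have uv n m : u n <= v m.
  apply: le_trans (mu n m) _; apply: le_trans (huv _) _; rewrite addnC; exact: mv.
pose S : set R := range u.
have hs : has_sup S by split; [exists (u 0%N); exists 0%N|exists (v 0%N) => _ [n _ <-]].
exists (sup S) => n; apply/andP; split.
  by apply: ub_le_sup; [case: hs|exists n].
by apply: ge_sup; [case: hs|move=> _ [m _ <-]].
Qed.

(** The primitive that removes the first-order Taylor part in [Goursat]. *)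
Lemma cder_aff (A B p z : Cx) : cder (fun z => A * z + B / 2 * ((z - p) * (z - p))) z (A + B * (z - p)).
Proof.
have h : cder (fun z => z - p) z 1.
  by have := cderB _ _ _ _ _ (cder_id z) (cder_cst p z); rewrite subr0.
have := cderD _ _ _ _ _ (cderZ A _ _ _ (cder_id z)) (cderZ (B / 2) _ _ _ (cderM _ _ _ _ _ h h)).
by rewrite (_ : A * 1 + _ = A + B * (z - p)) //; field.
Qed.

Lemma rect_frame_rect a b c d : rect_frame a b c d `<=` rect a b c d.
Proof. by move=> z []. Qed.

Lemma rect_sub a b c d a' b' c' d' : a <= a' -> b' <= b -> c <= c' -> d' <= d ->
  rect a' b' c' d' `<=` rect a b c d.
Proof.
move=> h1 h2 h3 h4 z /andP[/andP[g1 g2] /andP[g3 g4]]; apply/andP; split; apply/andP; split; lra.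
Qed.

Lemma rI_quarter f x y w h : 0 <= w -> 0 <= h ->
  (forall z, rect x (x + w + w) y (y + h + h) z -> ccont f z) ->
  rect_int f x (x + w + w) y (y + h + h) =
    rect_int f x (x + w) y (y + h) + rect_int f x (x + w) (y + h) (y + h + h) +
    (rect_int f (x + w) (x + w + w) y (y + h) + rect_int f (x + w) (x + w + w) (y + h) (y + h + h)).
Proof.
move=> w0 h0 cf.
have cf' (s t : R) : x <= s <= x + w + w -> y <= t <= y + h + h -> ccont f (Complex s t).
  by move=> hs ht; apply: cf; rewrite /rect /= hs ht.
have [x1 x2] : x <= x + w /\ x + w <= x + w + w by split; lra.
have [y1 y2] : y <= y + h /\ y + h <= y + h + h by split; lra.
rewrite (rI_cutx f x (x + w)) //; first last.
- by move=> t ht; apply: cf' => //; rewrite lexx andbT (le_trans y1).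
- by move=> t ht; apply: cf' => //; rewrite lexx (le_trans y1).
congr (_ + _); apply: rI_cuty => // t ht; apply: cf' => //.
- by rewrite lexx (le_trans x1).
- by rewrite x1 x2.
- by rewrite x1 x2.
- by rewrite lexx andbT (le_trans x1).
Qed.

Lemma Goursat f a b c d : a <= b -> c <= d ->
  (forall z, rect a b c d z -> exists D, cder f z D) -> rect_int f a b c d = 0.
Proof.
move=> ab cd hf; apply: contrapT => /eqP; rewrite -cmod_gt0;
  move: (erefl (cmod (rect_int f a b c d))); move: {2 3}(cmod _) => eta etaE eta0.
have [w wdef] : exists w, w = b - a by exists (b - a).
have [h hdef] : exists h, h = d - c by exists (d - c).
have w0 : 0 <= w by rewrite wdef subr_ge0.
have h0 : 0 <= h by rewrite hdef subr_ge0.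
have p2 n : (0 : R) < 2 ^+ n by rewrite exprn_gt0 // ltr0n.
have cf z : rect a b c d z -> ccont f z by move=> /hf[D /cder_cont].
pose q n (p : R * R) := rect_int f p.1 (p.1 + w / 2 ^+ n) p.2 (p.2 + h / 2 ^+ n).
(* A rectangle of generation n is recorded by its lower left corner p; it must carry at least the
   share 1/4^n of the modulus of the initial integral. [Nx] says that the next rectangle is
   contained in the present one. *)
pose Inv n (p : R * R) := [/\ a <= p.1, p.1 + w / 2 ^+ n <= b, c <= p.2, p.2 + h / 2 ^+ n <= d
  & eta / 4 ^+ n <= cmod (q n p)].
pose Nx n (p p' : R * R) := [/\ p.1 <= p'.1, p'.1 + w / 2 ^+ n.+1 <= p.1 + w / 2 ^+ n,
  p.2 <= p'.2 & p'.2 + h / 2 ^+ n.+1 <= p.2 + h / 2 ^+ n].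
have step n p : Inv n p -> exists p', Inv n.+1 p' /\ Nx n p p'.
  case: p => x y [/= i1 i2 i3 i4 i5].
  have [w' w'E] : exists w', w' = w / 2 ^+ n.+1 by exists (w / 2 ^+ n.+1).
  have [h' h'E] : exists h', h' = h / 2 ^+ n.+1 by exists (h / 2 ^+ n.+1).
  have wE : w / 2 ^+ n = w' + w' by rewrite w'E exprS; field; rewrite gt_eqF.
  have hE : h / 2 ^+ n = h' + h' by rewrite h'E exprS; field; rewrite gt_eqF.
  have w'0 : 0 <= w' by rewrite w'E divr_ge0 // ltW.
  have h'0 : 0 <= h' by rewrite h'E divr_ge0 // ltW.
  rewrite wE in i2; rewrite hE in i4.
  have qE : q n (x, y) = q n.+1 (x, y) + q n.+1 (x, y + h') + (q n.+1 (x + w', y) + q n.+1 (x + w', y + h')).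
    rewrite /q /= -w'E -h'E wE hE (addrA x) (addrA y) rI_quarter //.
    by move=> z hz; apply: cf; apply: rect_sub hz => //; rewrite -addrA.
  have [p' hp'] : exists p', [/\ p' = (x, y) \/ p' = (x, y + h') \/ p' = (x + w', y) \/ p' = (x + w', y + h')
       & eta / 4 ^+ n.+1 <= cmod (q n.+1 p')].
    apply: contrapT => hn.
    have k p' : p' = (x, y) \/ p' = (x, y + h') \/ p' = (x + w', y) \/ p' = (x + w', y + h') ->
        cmod (q n.+1 p') < eta / 4 ^+ n.+1.
      by move=> hp'; rewrite ltNge; apply/negP => hq; apply: hn; exists p'.
    have := i5 : eta / 4 ^+ n <= cmod (q n (x, y)); rewrite qE.
    have e4 : eta / 4 ^+ n = 4 * (eta / 4 ^+ n.+1).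
      by rewrite exprS; field; rewrite expf_neq0.
    have := k (x, y) (or_introl erefl).
    have := k (x, y + h') (or_intror (or_introl erefl)).
    have := k (x + w', y) (or_intror (or_intror (or_introl erefl))).
    have := k (x + w', y + h') (or_intror (or_intror (or_intror erefl))).
    have := cmodD (q n.+1 (x, y) + q n.+1 (x, y + h')) (q n.+1 (x + w', y) + q n.+1 (x + w', y + h')).
    have := cmodD (q n.+1 (x, y)) (q n.+1 (x, y + h')).
    have := cmodD (q n.+1 (x + w', y)) (q n.+1 (x + w', y + h')).
    rewrite e4; lra.
  exists p'; rewrite /Inv /Nx -w'E -h'E wE hE.
  by case: hp' => + k; move=> [E|[E|[E|E]]]; rewrite E in k *; split; split => //=;
    clear -i1 i2 i3 i4 w'0 h'0; lra.
have /choice[nx hnx] : forall np : nat * (R * R), exists p', Inv np.1 np.2 ->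
    Inv np.1.+1 p' /\ Nx np.1 np.2 p'.
  move=> [n p]; have [/step[p' ?]|nI] := pselect (Inv n p); first by exists p'.
  by exists p.
pose s := fix s n := if n is m.+1 then nx (m, s m) else (a, c).
have square_int n : Inv n (s n).
  elim: n => [|n IH]; last by have [] := hnx (n, s n) IH.
  have wa : a + w = b by rewrite wdef; ring.
  have hc : c + h = d by rewrite hdef; ring.
  by rewrite /Inv /q /= !expr0 !divr1 wa hc !lexx etaE.
have sN n : Nx n (s n) (s n.+1) by have [] := hnx (n, s n) (square_int n).
have [|||X hX] := nested_intervals (fun n => (s n).1) (fun n => (s n).1 + w / 2 ^+ n).
- by move=> n; case: (sN n).
- by move=> n; case: (sN n).
- by move=> n; rewrite lerDl divr_ge0 // ltW.
have [|||Y hY] := nested_intervals (fun n => (s n).2) (fun n => (s n).2 + h / 2 ^+ n).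
- by move=> n; case: (sN n).
- by move=> n; case: (sN n).
- by move=> n; rewrite lerDl divr_ge0 // ltW.
have Rp : rect a b c d (Complex X Y).
  move: (hX 0%N) (hY 0%N); rewrite /= !expr0 !divr1 wdef hdef => /andP[? ?] /andP[? ?].
  by apply/andP; split; apply/andP; split => /=; lra.
have [D dD] := hf _ Rp.
(* The error estimate will give eta <= 4 e (w+h)^2, which this e contradicts; the 1 in the
   denominator keeps this true for a degenerate rectangle. *)
have [e edef] : exists e, e = eta / (8 * (w + h) ^+ 2 + 1) by eexists.
have wh0 : 0 <= (w + h) ^+ 2 by rewrite sqr_ge0.
have e0 : 0 < e by rewrite edef divr_gt0 //; lra.
have [del del0 hdel] := dD e e0.
have [n hn] := pow2_small (w + h) del del0.
have [/= i1 i2 i3 i4 i5] := square_int n.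
case E0 : (s n) => [x y]; have [x0 y0] : (s n).1 = x /\ (s n).2 = y by rewrite E0.
rewrite x0 in i1 i2; rewrite y0 in i3 i4.
have w'0 : 0 <= w / 2 ^+ n by rewrite divr_ge0 // ltW.
have h'0 : 0 <= h / 2 ^+ n by rewrite divr_ge0 // ltW.
have xx : x <= x + w / 2 ^+ n by lra.
have yy : y <= y + h / 2 ^+ n by lra.
have frRc z : rect_frame x (x + w / 2 ^+ n) y (y + h / 2 ^+ n) z -> rect a b c d z.
  by move=> /rect_frame_rect; apply: rect_sub.
set p := Complex X Y in Rp dD hdel.
pose E z := f z - (f p + D * (z - p)).
have caff z : ccont (fun z => f p + D * (z - p)) z.
  apply: ccontD; first exact: ccont_cst.
  by apply: ccontM; [exact: ccont_cst|apply: ccontB; [exact: ccont_id|exact: ccont_cst]].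
have qE : q n (s n) = rect_int E x (x + w / 2 ^+ n) y (y + h / 2 ^+ n).
  rewrite /q x0 y0 (_ : f = fun z => 1 * E z + (f p + D * (z - p))); last first.
    by apply/funext => z; rewrite /E; ring.
  rewrite rI_lin //; last first.
    by move=> z /frRc /cf cfz; apply: ccontB.
  rewrite [X in _ + X](_ : _ = 0) ?addr0 ?mul1r //.
  by apply: (rI_FTC _ _ _ _ xx yy (fun z => f p * z + D / 2 * ((z - p) * (z - p)))) => // z _;
    exact: cder_aff.
have bE : cmod (q n (s n)) <= 4 * (e * ((w + h) / 2 ^+ n)) * ((x + w / 2 ^+ n - x) + (y + h / 2 ^+ n - y)).
  rewrite qE; apply: rI_bound => //.
    by move=> z /frRc /cf cfz; apply: ccontB.
  move=> z /rect_frame_rect /andP[/andP[z1 z2] /andP[z3 z4]].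
  have zp : cmod (z - p) <= (w + h) / 2 ^+ n.
    apply: le_trans (cmod_ReIm _) _; rewrite ReB ImB /p /= mulrDl.
    move: (hX n) (hY n); rewrite x0 y0 => /andP[u1 u2] /andP[u3 u4].
    by apply: lerD; rewrite ler_norml; apply/andP; split; clear -u1 u2 u3 u4 z1 z2 z3 z4; lra.
  rewrite /E opprD addrA; apply: le_trans (hdel _ _) _; first exact: le_lt_trans zp hn.
  by rewrite ler_pM2l.
move: (le_trans i5 bE); rewrite (addrC x) addrK (addrC y) addrK -mulrDl.
have -> : (4 : R) ^+ n = 2 ^+ n * 2 ^+ n by rewrite -exprMn -natrM.
rewrite ler_pdivrMr ?mulr_gt0 //.
have -> : 4 * (e * ((w + h) / 2 ^+ n)) * ((w + h) / 2 ^+ n) * (2 ^+ n * 2 ^+ n) = 4 * e * (w + h) ^+ 2.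
  by field; rewrite gt_eqF.
have -> : eta = e * (8 * (w + h) ^+ 2 + 1) by rewrite edef divfK // gt_eqF //; lra.
nra.
Qed.

(** * Cauchy kernels *)

Definition conton (S : set C) (f : Cx -> Cx) := forall z, S z -> ccont f z.

(* Abstracts what is used of an integral over an edge or a frame [S]. *)
Definition intfun (L : (Cx -> Cx) -> Cx) (S : set C) (P : R) : Prop :=
  [/\ 0 <= P, forall k f g, conton S f -> conton S g ->
        L (fun z => k * f z + g z) = k * L f + L g
    & forall f m, conton S f -> (forall z, S z -> cmod (f z) <= m) -> cmod (L f) <= P * m].

Lemma conton_cst S c : conton S (fun=> c).
Proof. by move=> z _; exact: ccont_cst. Qed.
Lemma contonB S f g : conton S f -> conton S g -> conton S (fun z => f z - g z).
Proof. by move=> hf hg z Sz; apply: ccontB; [exact: hf|exact: hg]. Qed.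
Lemma contonM S f g : conton S f -> conton S g -> conton S (fun z => f z * g z).
Proof. by move=> hf hg z Sz; apply: ccontM; [exact: hf|exact: hg]. Qed.
Lemma contonV S f : conton S f -> (forall z, S z -> f z != 0) -> conton S (fun z => (f z)^-1).
Proof. by move=> hf f0 z Sz; apply: ccontV; [exact: f0|exact: hf]. Qed.
Lemma hol_conton U S f : hol U f -> S `<=` U -> conton S f.
Proof. by move=> hf SU z /SU; exact: hol_cont. Qed.
Lemma conton_cauchy S a : (forall z, S z -> z != a) -> conton S (fun z => (z - a)^-1).
Proof. by move=> h; apply: (@hol_conton S) => //; exact: hol_cauchy. Qed.

Section intfun.
Variables (L : (Cx -> Cx) -> Cx) (S : set C) (P : R).
Hypothesis hL : intfun L S P.

Lemma intfunB f g : conton S f -> conton S g -> L (fun z => f z - g z) = L f - L g.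
Proof.
move=> cf cg; have [_ lin _] := hL.
rewrite (_ : (fun z => f z - g z) = (fun z => -1 * g z + f z)); last by apply/funext => z; ring.
by rewrite lin //; ring.
Qed.

Lemma intfunZ k f : conton S f -> L (fun z => k * f z) = k * L f.
Proof.
move=> cf; have [_ lin _] := hL.
have h0 : L (fun=> 0) = 0.
  have := lin 1 (fun=> 0) (fun=> 0) (conton_cst _ 0) (conton_cst _ 0).
  rewrite (_ : (fun _ => _) = (fun=> 0)); last by apply/funext => z; ring.
  by rewrite mul1r => /eqP; rewrite -subr_eq subrr eq_sym => /eqP.
rewrite (_ : (fun z => k * f z) = (fun z => k * f z + 0)); last by apply/funext => z; ring.
by rewrite lin // ?h0 ?addr0 //; exact: conton_cst.
Qed.

Lemma intfun_ext f g : conton S f -> conton S g -> (forall z, S z -> f z = g z) -> L f = L g.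
Proof.
move=> cf cg fg; have [P0 _ bd] := hL; apply/eqP; rewrite -subr_eq0 -intfunB // -cmod_eq0.
rewrite eq_le cmod_ge0 andbT -(mulr0 P); apply: bd; first exact: contonB.
by move=> z /fg ->; rewrite subrr cmod0.
Qed.

(** Integrates 1/(u-w) - 1/(u-w0) - (w-w0)/(u-w0)^2 = (w-w0)^2 / ((u-w0)^2 (u-w)) at u = phi z. For
    w within del/2 of w0 the last factor is at most 2/del, whence the constant 2 m / del^3. *)
Lemma intfun_kernel (h phi : Cx -> Cx) (w0 : Cx) (del m : R) :
  conton S h -> conton S phi -> 0 < del -> (forall z, S z -> del <= cmod (phi z - w0)) ->
  0 <= m -> (forall z, S z -> cmod (h z) <= m) ->
  let T w := L (fun z => h z / (phi z - w)) in
  exists D, cmod D <= P * (m / del ^+ 2) /\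
   forall w, cmod (w - w0) <= del / 2 ->
    cmod (T w - T w0 - D * (w - w0)) <= P * (2 * m / del ^+ 3) * cmod (w - w0) ^+ 2.
Proof.
move=> ch cphi d0 hd m0 hm T; have [P0 lin bd] := hL.
have far w z : cmod (w - w0) <= del / 2 -> S z -> del / 2 <= cmod (phi z - w).
  move=> ww /hd; have := cmod_tri w (phi z) w0; lra.
have nz w z : cmod (w - w0) <= del / 2 -> S z -> phi z - w != 0.
  by move=> ww Sz; rewrite -cmod_gt0; apply: lt_le_trans (far _ _ ww Sz); lra.
have w00 : cmod (w0 - w0) <= del / 2 by rewrite subrr cmod0; lra.
have cS w : conton S (fun z => phi z - w) by apply: contonB => //; exact: conton_cst.
have cV w : cmod (w - w0) <= del / 2 -> conton S (fun z => (phi z - w)^-1).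
  by move=> ww; apply: contonV => // z; exact: nz.
have cV2 : conton S (fun z => h z * ((phi z - w0)^-1 * (phi z - w0)^-1)).
  by do 2 (apply: contonM => //); exact: cV.
exists (L (fun z => h z * ((phi z - w0)^-1 * (phi z - w0)^-1))); split.
  apply: bd => // z Sz; rewrite !cmodM cmodV.
  have k := hd z Sz; apply: ler_pM (hm _ Sz) _; rewrite ?cmod_ge0 ?mulr_ge0 ?invr_ge0 ?cmod_ge0 //.
  have i1 : (cmod (phi z - w0))^-1 <= del^-1.
    by rewrite lef_pV2 ?posrE //; apply: lt_le_trans k.
  by rewrite expr2 invfM; apply: ler_pM; rewrite ?invr_ge0 ?cmod_ge0.
move=> w ww; rewrite /T.
have cT v : cmod (v - w0) <= del / 2 -> conton S (fun z => h z / (phi z - v)).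
  by move=> vv; apply: contonM => //; exact: cV.
rewrite -intfunB; [|exact: cT|exact: cT].
rewrite mulrC -intfunZ // -intfunB; [|by apply: contonB; exact: cT|by apply: contonM => //;
  exact: conton_cst].
set q := fun z : Cx => h z * ((w - w0) * (w - w0)) * ((phi z - w0)^-1 * (phi z - w0)^-1 * (phi z - w)^-1).
have cq : conton S q.
  apply: contonM; first by apply: contonM => //; exact: conton_cst.
  by apply: contonM; [apply: contonM; exact: cV|exact: cV].
rewrite (intfun_ext _ q) //; last first.
- by move=> z Sz; rewrite /q; field; rewrite !nz.
- apply: contonB; first by apply: contonB; exact: cT.
  by apply: contonM => //; exact: conton_cst.
rewrite -mulrA; apply: bd => // z Sz; rewrite /q !cmodM !cmodV -!mulrA.
rewrite (_ : 2 * (m * _) = m * (cmod (w - w0) * (cmod (w - w0) * (del^-1 * (del^-1 * (2 /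
  del)))))); last first.
  by field; rewrite gt_eqF.
have k := hd z Sz; have k2 := far w z ww Sz.
have i1 : (cmod (phi z - w0))^-1 <= del^-1.
  by rewrite lef_pV2 ?posrE //; apply: lt_le_trans k.
have i2 : (cmod (phi z - w))^-1 <= 2 / del.
  rewrite -[leRHS]invrK invf_div lef_pV2 ?posrE ?divr_gt0 //.
  by apply: lt_le_trans k2; rewrite divr_gt0.
have g x : 0 <= (cmod x)^-1 by rewrite invr_ge0 cmod_ge0.
by do ![apply: ler_pM => //; rewrite ?mulr_ge0 ?cmod_ge0 ?g //|exact: hm].
Qed.

End intfun.

Lemma quad_cder f z D (r B : R) : 0 < r -> 0 <= B ->
  (forall w, cmod (w - z) <= r -> cmod (f w - f z - D * (w - z)) <= B * cmod (w - z) ^+ 2) ->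
  cder f z D.
Proof.
move=> r0 B0 h e e0; exists (Num.min r (e / (B + 1))).
  by rewrite lt_min r0 divr_gt0 //; lra.
move=> w; rewrite lt_min => /andP[w1 w2]; apply: le_trans (h _ (ltW w1)) _.
rewrite expr2 mulrA ler_wpM2r ?cmod_ge0 //.
move: w2; rewrite ltr_pdivlMr; last by lra.
have := cmod_ge0 (w - z); nra.
Qed.

Lemma intfun_kernel_cder L S P (h phi : Cx -> Cx) (w0 : Cx) (del m : R) : intfun L S P ->
  conton S h -> conton S phi -> 0 < del -> (forall z, S z -> del <= cmod (phi z - w0)) ->
  (forall z, S z -> cmod (h z) <= m) ->
  exists D, cder (fun w => L (fun z => h z / (phi z - w))) w0 D.
Proof.
move=> hL ch cphi d0 hd hm.
(* If S is empty the bound m may be negative. *)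
have m1 : 0 <= Num.max m 0 by rewrite le_max lexx orbT.
have hm' z : S z -> cmod (h z) <= Num.max m 0 by move=> /hm k; rewrite le_max k.
have [D [_ hD]] := intfun_kernel _ _ _ hL h phi w0 del _ ch cphi d0 hd m1 hm'.
exists D; apply: quad_cder hD; first by lra.
have [P0 _ _] := hL.
apply: mulr_ge0 => //; apply: divr_ge0; last by apply: exprn_ge0; exact: ltW.
by apply: mulr_ge0.
Qed.

Lemma intfun_rI a b c d : a <= b -> c <= d ->
  intfun (fun f => rect_int f a b c d) (rect_frame a b c d) (4 * ((b - a) + (d - c))).
Proof.
move=> ab cd; split; first by lra.
- by move=> k f g cf cg; exact: rI_lin.
- by move=> f m cf fm; rewrite mulrAC; exact: rI_bound.
Qed.

Definition hseg y a b : set C := [set z : C | Im z = y /\ a <= Re z <= b].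
Definition vseg x c d : set C := [set z : C | Re z = x /\ c <= Im z <= d].

Lemma hsegP y a b x : a <= x <= b -> hseg y a b (Complex x y).
Proof. by []. Qed.
Lemma vsegP x c d y : c <= y <= d -> vseg x c d (Complex x y).
Proof. by []. Qed.

Lemma intfun_hI y a b : a <= b -> intfun (fun f => hseg_int f y a b) (hseg y a b) (2 * (b - a)).
Proof.
move=> ab; split; first by lra.
- move=> k f g cf cg; rewrite /hseg_int cI_lin //.
    by apply: hI_ex => // x /(hsegP y) /cf.
  by apply: hI_ex => // x /(hsegP y) /cg.
- move=> f m cf fm; rewrite mulrAC; apply: cI_bound => //.
    by apply: hI_ex => // x /(hsegP y) /cf.
  by move=> x /(hsegP y) /fm.
Qed.

Lemma intfun_vI x c d : c <= d -> intfun (fun f => vseg_int f x c d) (vseg x c d) (2 * (d - c)).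
Proof.
move=> ab; split; first by lra.
- move=> k f g cf cg; rewrite /vseg_int cI_lin; first by ring.
    by apply: vI_ex => // y /(vsegP x) /cf.
  by apply: vI_ex => // y /(vsegP x) /cg.
- move=> f m cf fm; rewrite mulrAC /vseg_int cmodM cmod_i mul1r; apply: cI_bound => //.
    by apply: vI_ex => // y /(vsegP x) /cf.
  by move=> y /(vsegP x) /fm.
Qed.

Definition square (z : Cx) (r : R) : set C := rect (Re z - r) (Re z + r) (Im z - r) (Im z + r).
Definition sqframe (z : Cx) (r : R) : set C := rect_frame (Re z - r) (Re z + r) (Im z - r) (Im z + r).
Definition square_int (f : Cx -> Cx) (z : Cx) (r : R) : Cx :=
  rect_int f (Re z - r) (Re z + r) (Im z - r) (Im z + r).

Lemma squareP z r w : square z r w <-> `|Re (w - z)| <= r /\ `|Im (w - z)| <= r.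
Proof.
rewrite /square /rect /= ReB ImB !ler_norml; split=> [/andP[/andP[? ?] /andP[? ?]]|[/andP[? ?] /andP[? ?]]].
  by split; apply/andP; split; lra.
by apply/andP; split; apply/andP; split; lra.
Qed.

Lemma square_cmod z r w : square z r w -> cmod (w - z) <= 2 * r.
Proof. by move=> /squareP[? ?]; apply: le_trans (cmod_ReIm _) _; lra. Qed.

Lemma sqframe_square z r : sqframe z r `<=` square z r.
Proof. exact: rect_frame_rect. Qed.

Lemma sqframe_cmod z r w : 0 <= r -> sqframe z r w -> r <= cmod (w - z).
Proof.
move=> r0 [_ h].
have hR : Re w - Re z = r \/ Re w - Re z = - r \/ Im w - Im z = r \/ Im w - Im z = - r.
  by case: h => ->; [right; left|left|right; right; right|right; right; left]; lra.
case: hR => [h'|[h'|[h'|h']]].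
- by apply: le_trans (normRe _); rewrite ReB h' ger0_norm.
- by apply: le_trans (normRe _); rewrite ReB h' normrN ger0_norm.
- by apply: le_trans (normIm _); rewrite ImB h' ger0_norm.
- by apply: le_trans (normIm _); rewrite ImB h' normrN ger0_norm.
Qed.

Lemma intfun_sI z r : 0 <= r -> intfun (fun f => square_int f z r) (sqframe z r) (16 * r).
Proof.
move=> r0; have := @intfun_rI (Re z - r) (Re z + r) (Im z - r) (Im z + r).
rewrite (_ : 4 * _ = 16 * r); last by ring.
by apply; lra.
Qed.

(* This is 2 i pi; only [tau != 0] matters. *)
Definition tau : Cx := 'i%C * (8 * Ratan.atan 1)%:C%C.

Lemma tau_neq0 : tau != 0.
Proof.
have at0 : 0 < Ratan.atan 1.
  rewrite -[X in X < _]Ratan.atan_0; apply/RltP; apply: Ratan.atan_increasing.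
  by apply/RltP; exact: ltr01.
by rewrite -cmod_gt0 /tau cmodM cmod_i mul1r cmod_real normr_gt0 gt_eqF //; lra.
Qed.

Lemma rder_atan (x r t : R) : 0 < r ->
  rder (fun t => (Ratan.atan ((t - x) / r))%:C%C) t (r / ((t - x) ^+ 2 + r ^+ 2))%:C%C.
Proof.
move=> r0 e e0.
have e0' : 0 < e * r by rewrite mulr_gt0.
have := Ratan.derivable_pt_lim_atan ((t - x) / r).
rewrite /Ranalysis1.derivable_pt_lim => /(_ _ (elimT RltP e0'))[d hd].
have dp : 0 < RIneq.pos d by apply/RltP; exact: RIneq.cond_pos.
exists (RIneq.pos d * r); first by rewrite mulr_gt0.
move=> y yt; have [->|ny] := eqVneq y t.
  by rewrite !subrr rmorph0 mulr0 subrr cmod0 normr0 mulr0.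
have h0 : (y - t) / r <> 0 by apply/eqP; rewrite mulf_neq0 ?subr_eq0 // invr_eq0 gt_eqF.
have hlt : Rdefinitions.Rlt (Rbasic_fun.Rabs ((y - t) / r)) (RIneq.pos d).
  by apply/RltP; rewrite RnormE normrM normfV (gtr0_norm r0) ltr_pdivrMr.
have /RltP := hd _ h0 hlt.
rewrite RnormE RdivE !RminusE RplusE (_ : (t - x) / r + (y - t) / r = (y - x) / r); last by ring.
rewrite RinvE RpowE => k.
have {}k : `|(Ratan.atan ((y - x) / r) - Ratan.atan ((t - x) / r)) / ((y - t) / r) -
   (1 + ((t - x) / r) ^+ 2)^-1| < e * r := k.
have hp : 0 < `|(y - t) / r| by rewrite normr_gt0; exact/eqP.
have den : 0 < (t - x) ^+ 2 + r ^+ 2 by have := sqr_ge0 (t - x); have := mulr_gt0 r0 r0; rewrite -expr2; lra.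
rewrite -!rmorphB -rmorphM -rmorphB cmod_real.
rewrite (_ : _ - _ - _ = ((Ratan.atan ((y - x) / r) - Ratan.atan ((t - x) / r)) / ((y - t) / r) -
   (1 + ((t - x) / r) ^+ 2)^-1) * ((y - t) / r)); last first.
  field; rewrite gt_eqF //= subr_eq0 ny /= gt_eqF //.
  by rewrite (_ : r * r + _ = (t - x) ^+ 2 + r ^+ 2) //; ring.
rewrite normrM; apply: le_trans (ler_wpM2r (ltW hp) (ltW k)) _.
by rewrite normrM normfV (gtr0_norm r0) -mulrA (mulrCA r) divff ?mulr1 // gt_eqF.
Qed.

(** * Cauchy's formula *)

(** Cut along the vertical sides of the square, then cut the middle strip along the horizontal ones:
    the four outer pieces avoid z and contribute 0 by [Goursat]. *)
Lemma rect_int_shrink f z r a b c d : 0 < r -> a <= Re z - r -> Re z + r <= b ->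
  c <= Im z - r -> Im z + r <= d ->
  (forall w, rect a b c d w -> w != z -> exists D, cder f w D) ->
  rect_int f a b c d = square_int f z r.
Proof.
move=> r0 ha hb hc hd hf.
have cf (s t : R) : a <= s <= b -> c <= t <= d -> s != Re z \/ t != Im z -> ccont f (Complex s t).
  move=> hs ht h; have [||D /cder_cont //] := hf (Complex s t); first by rewrite /rect /= hs.
  by case: h; apply: contraNneq => <-.
have G a' b' c' d' : a' <= b' -> c' <= d' -> a <= a' -> b' <= b -> c <= c' -> d' <= d ->
    (forall w, rect a' b' c' d' w -> w != z) -> rect_int f a' b' c' d' = 0.
  move=> h1 h2 h3 h4 h5 h6 nz; apply: Goursat => // w hw; apply: hf; last exact: nz.
  by apply: rect_sub hw.
rewrite (rI_cutx f a (Re z - r)); [|lra|lra| |]; first last.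
- by move=> t ht; apply: cf => //; [apply/andP; split; lra|right; rewrite gt_eqF //; lra].
- by move=> t ht; apply: cf => //; [apply/andP; split; lra|right; rewrite lt_eqF //; lra].
rewrite (rI_cutx f (Re z - r) (Re z + r)); [|lra|lra| |]; first last.
- by move=> t ht; apply: cf => //; [move: ht => /andP[? ?]; apply/andP; split; lra|apply/andP;
  split; lra|right; rewrite gt_eqF //; lra].
- by move=> t ht; apply: cf => //; [move: ht => /andP[? ?]; apply/andP; split; lra|apply/andP;
  split; lra|right; rewrite lt_eqF //; lra].
have -> : rect_int f a (Re z - r) c d = 0.
  apply: G; [lra|lra|lra|lra|lra|lra|].
  by move=> w /andP[/andP[? ?] _]; apply/eqP => wz; subst w; lra.
have -> : rect_int f (Re z + r) b c d = 0.
  apply: G; [lra|lra|lra|lra|lra|lra|].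
  by move=> w /andP[/andP[? ?] _]; apply/eqP => wz; subst w; lra.
rewrite add0r addr0.
rewrite (rI_cuty f _ _ c (Im z - r)); [|lra|lra| |]; first last.
- by move=> t ht; apply: cf => //; [apply/andP; split; lra|left; rewrite gt_eqF //; lra].
- by move=> t ht; apply: cf => //; [apply/andP; split; lra|left; rewrite lt_eqF //; lra].
rewrite (rI_cuty f _ _ (Im z - r) (Im z + r)); [|lra|lra| |]; first last.
- by move=> t ht; apply: cf => //; [apply/andP; split; lra|move: ht => /andP[? ?]; apply/andP;
  split; lra|left; rewrite gt_eqF //; lra].
- by move=> t ht; apply: cf => //; [apply/andP; split; lra|move: ht => /andP[? ?]; apply/andP;
  split; lra|left; rewrite lt_eqF //; lra].
have -> : rect_int f (Re z - r) (Re z + r) c (Im z - r) = 0.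
  apply: G; [lra|lra|lra|lra|lra|lra|].
  by move=> w /andP[_ /andP[? ?]]; apply/eqP => wz; subst w; lra.
have -> : rect_int f (Re z - r) (Re z + r) (Im z + r) d = 0.
  apply: G; [lra|lra|lra|lra|lra|lra|].
  by move=> w /andP[_ /andP[? ?]]; apply/eqP => wz; subst w; lra.
by rewrite add0r addr0.
Qed.

Lemma rderZ k G x D : rder G x D -> rder (fun t => k * G t) x (k * D).
Proof.
move=> dG e e0; have k0 : 0 < cmod k + 1 by have := cmod_ge0 k; lra.
have [|d d0 hd] := dG (e / (cmod k + 1)); first by rewrite divr_gt0.
exists d => // y /hd h.
rewrite (_ : _ - _ - _ = k * (G y - G x - D * (y - x)%:C%C)); last by ring.
rewrite cmodM; apply: le_trans (ler_wpM2l (cmod_ge0 k) h) _.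
rewrite mulrA ler_wpM2r // mulrCA -[leRHS]mulr1 ler_wpM2l ?(ltW e0) //.
by rewrite ler_pdivrMr //; lra.
Qed.

(** The antiderivative atan((t-x)/r) runs from -atan 1 to atan 1. *)
Lemma cI_atan (k : Cx) (x r : R) : 0 < r ->
  cint (fun t => k * (r / ((t - x) ^+ 2 + r ^+ 2))%:C%C) (x - r) (x + r) =
  k * (2 * Ratan.atan 1)%:C%C.
Proof.
move=> r0; rewrite (cI_FTC (fun t => k * (Ratan.atan ((t - x) / r))%:C%C)).
- rewrite -mulrBr -rmorphB; congr (_ * _%:C%C).
  rewrite (addrC x r) addrK divff ?gt_eqF // (addrC x (- r)) addrK mulNr divff ?gt_eqF //.
  by rewrite (_ : Ratan.atan (-1) = - Ratan.atan 1) ?opprK; [ring|exact: Ratan.atan_opp].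
- lra.
(* Continuity of the integrand is obtained by extending it to a rational function of a complex
   variable and restricting to the real axis. *)
- move=> t _; pose f (z : Cx) : Cx := k * (r%:C%C * ((z - x%:C%C) * (z - x%:C%C) + (r ^+ 2)%:C%C)^-1).
  have E s : f (Complex s 0) = k * (r / ((s - x) ^+ 2 + r ^+ 2))%:C%C.
    by rewrite /f -[Complex s 0]/(s%:C%C) -rmorphB -rmorphM -rmorphD -fmorphV -rmorphM -expr2.
  rewrite (_ : (fun t => _) = (fun t => f (Complex t 0))); last by apply/funext => s; rewrite E.
  apply: ccont_h; rewrite /f; apply: ccontM; first exact: ccont_cst.
  apply: ccontM; first exact: ccont_cst.
  have cb z : ccont (fun z => z - x%:C%C) z by apply: ccontB; [exact: ccont_id|exact: ccont_cst].
  apply: ccontV; last by apply: ccontD; [exact: ccontM|exact: ccont_cst].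
  rewrite -[Complex t 0]/(t%:C%C) -rmorphB -rmorphM -rmorphD -expr2 fmorph_eq0 gt_eqF //.
  by have := sqr_ge0 (t - x); have := mulr_gt0 r0 r0; rewrite -expr2; lra.
- by move=> t _; apply: rderZ; exact: rder_atan.
Qed.

(** Opposite sides of a square are integrated together: their points, relative to the centre, are s
    - ir and s + ir up to a common factor. *)
Lemma inv_diff (s r : Cx) : s * s + r * r != 0 ->
  (s - 'i%C * r)^-1 - (s + 'i%C * r)^-1 = 2 * 'i%C * (r / (s ^+ 2 + r ^+ 2)).
Proof.
have ii : ('i%C : Cx) * 'i%C = -1 by rewrite -expr2 sqr_i.
have E : s * s + r * r = (s - 'i%C * r) * (s + 'i%C * r).
  rewrite (_ : _ * (s + _) = s * s - ('i%C * 'i%C) * (r * r)); last by ring.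
  by rewrite ii mulN1r opprK.
move=> h; have := h; rewrite E mulf_eq0 negb_or => /andP[h1 h2].
field.
by rewrite h1 h2.
Qed.

Lemma square_int_pole z r : 0 < r -> square_int (fun w => (w - z)^-1) z r = tau.
Proof.
case: z => x y r0; rewrite /square_int /rect_int /=.
have nz (s : R) : s%:C%C * s%:C%C + r%:C%C * r%:C%C != 0 :> Cx.
  rewrite -!rmorphM -rmorphD fmorph_eq0 gt_eqF //.
  by have := sqr_ge0 s; have := mulr_gt0 r0 r0; rewrite -expr2; lra.
have ii : ('i%C : Cx) * 'i%C = -1 by rewrite -expr2 sqr_i.
have CE (a b : R) : (Complex a b : Cx) = a%:C%C + 'i%C * b%:C%C by exact: ReImE.
have cinv (v : Cx) : v != Complex x y -> ccont (fun w => (w - Complex x y)^-1) v.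
  move=> vz; apply: ccontV; first by rewrite subr_eq0.
  by apply: ccontB; [exact: ccont_id|exact: ccont_cst].
have xr : x - r <= x + r by lra.
have yr : y - r <= y + r by lra.
have hH : hseg_int (fun w => (w - Complex x y)^-1) (y - r) (x - r) (x + r) -
          hseg_int (fun w => (w - Complex x y)^-1) (y + r) (x - r) (x + r) = 2 * 'i%C * (2 *
            Ratan.atan 1)%:C%C.
  rewrite -(cI_atan _ x r) // /hseg_int addrC -mulN1r -cI_lin //.
  - apply: cI_ext => t _; rewrite mulN1r addrC.
    rewrite (_ : Complex t (y - r) - Complex x y = (t - x)%:C%C - 'i%C * r%:C%C); last first.
      by rewrite (CE t (y - r)) (CE x y) !rmorphB /=; ring.
    rewrite (_ : Complex t (y + r) - Complex x y = (t - x)%:C%C + 'i%C * r%:C%C); last first.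
      by rewrite (CE t (y + r)) (CE x y) !rmorphB rmorphD /=; ring.
    by rewrite inv_diff // -!rmorphXn -rmorphD -fmorphV -rmorphM.
  - apply: (hI_ex (fun w => (w - Complex x y)^-1) (y + r)) => // t _; apply: cinv;
    rewrite eq_complex /= negb_and; apply/orP; right.
    by rewrite gt_eqF //; lra.
  - apply: (hI_ex (fun w => (w - Complex x y)^-1) (y - r)) => // t _; apply: cinv;
    rewrite eq_complex /= negb_and; apply/orP; right.
    by rewrite lt_eqF //; lra.
have hV : vseg_int (fun w => (w - Complex x y)^-1) (x + r) (y - r) (y + r) -
          vseg_int (fun w => (w - Complex x y)^-1) (x - r) (y - r) (y + r) = 2 * 'i%C * (2 *
            Ratan.atan 1)%:C%C.
  rewrite /vseg_int -mulrBr -[2 * 'i%C](mulrC) -[in RHS]mulrA; congr (_ * _).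
  rewrite -(cI_atan _ y r) // addrC -mulN1r -cI_lin //.
  - apply: cI_ext => t _; rewrite mulN1r addrC.
    have h := inv_diff _ _ (nz (t - y)).
    rewrite (_ : Complex (x + r) t - Complex x y = 'i%C * ((t - y)%:C%C - 'i%C * r%:C%C)); last first.
      rewrite mulrBr mulrA ii mulN1r opprK (CE (x + r) t) (CE x y) !rmorphB rmorphD /=; ring.
    rewrite (_ : Complex (x - r) t - Complex x y = 'i%C * ((t - y)%:C%C + 'i%C * r%:C%C)); last first.
      rewrite mulrDr mulrA ii mulN1r (CE (x - r) t) (CE x y) !rmorphB /=; ring.
    rewrite !invfM -mulrBr h -!rmorphXn -rmorphD -fmorphV -rmorphM.
    rewrite (mulrC 2) -mulrA mulKf // -cmod_gt0 cmod_i; exact: ltr01.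
  - apply: (vI_ex (fun w => (w - Complex x y)^-1) (x - r)) => // t _; apply: cinv;
    rewrite eq_complex /= negb_and; apply/orP; left.
    by rewrite lt_eqF //; lra.
  - apply: (vI_ex (fun w => (w - Complex x y)^-1) (x + r)) => // t _; apply: cinv;
    rewrite eq_complex /= negb_and; apply/orP; left.
    by rewrite gt_eqF //; lra.
(* Each pair of opposite sides contributes 4 i atan 1. *)
transitivity (2 * 'i%C * (2 * Ratan.atan 1)%:C%C + 2 * 'i%C * (2 * Ratan.atan 1)%:C%C : Cx).
  by rewrite -{1}hH -hV; ring.
rewrite /tau !rmorphM /=.
have h2 : ((2 : R)%:C%C : Cx) = 2 by exact: (rmorph_nat _ 2).
have h8 : ((8 : R)%:C%C : Cx) = 8 by exact: (rmorph_nat _ 8).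
by rewrite h2 h8; ring.
Qed.

(* Continuity suffices at the singular point z, which covers removable singularities. *)
Lemma Cauchy_formula f z a b c d : a < Re z -> Re z < b -> c < Im z -> Im z < d ->
  (forall w, rect a b c d w -> w != z -> exists D, cder f w D) -> ccont f z ->
  rect_int (fun w => f w / (w - z)) a b c d = tau * f z.
Proof.
move=> az zb cz zd hf cf.
apply/eqP; rewrite -subr_eq0 -cmod_eq0; apply/eqP.
apply/eqP; rewrite eq_le cmod_ge0 andbT; apply/ler_addgt0Pr => e e0; rewrite add0r.
(* The integral over the frame of half-side r has norm at most 16 r and the kernel is at most 1/r
   there, so an oscillation e/16 of f produces an error of at most e. *)
have [|d0 d00 hd] := cf (e / 16); first by lra.
have [r r0 [h1 h2 h3 h4 h5]] : exists2 r : R, 0 < r &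
   [/\ a <= Re z - r, Re z + r <= b, c <= Im z - r, Im z + r <= d & 2 * r < d0].
  pose m := Num.min (Num.min (Re z - a) (b - Re z)) (Num.min (Num.min (Im z - c) (d - Im z)) (d0 / 3)).
  have m0 : 0 < m by rewrite /m !lt_min !subr_gt0 az zb cz zd /= divr_gt0.
  exists m => //.
  have [? ? ? ? ?] : [/\ m <= Re z - a, m <= b - Re z, m <= Im z - c, m <= d - Im z & m <= d0 / 3].
    by rewrite /m; split; rewrite !ge_min lexx ?orbT.
  clearbody m; split; lra.
have hk w : w != z -> cder (fun w => (w - z)^-1) w (- 1 / (w - z) ^+ 2).
  move=> wz; apply: cderV; first by rewrite subr_eq0.
  by have := cderB _ _ _ _ _ (cder_id w) (cder_cst z w); rewrite subr0.
rewrite (rect_int_shrink _ z r) //; last first.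
  by move=> w hw wz; have [D dD] := hf w hw wz; eexists; apply: cderM dD (hk w wz).
have L := intfun_sI z r (ltW r0); have [_ lin bd] := L.
have frz w : sqframe z r w -> r <= cmod (w - z) by exact/sqframe_cmod/ltW.
have frn w : sqframe z r w -> w != z.
  by move=> /frz k; rewrite -subr_eq0 -cmod_gt0; apply: lt_le_trans k.
have cfr : conton (sqframe z r) f.
  move=> w hw; have [D /cder_cont //] : exists D, cder f w D.
  apply: hf; last exact: frn.
  by move: hw => /sqframe_square; apply: rect_sub.
have ck : conton (sqframe z r) (fun w => (w - z)^-1) by exact: conton_cauchy.
have cb : conton (sqframe z r) (fun w => (f w - f z) / (w - z)).
  by apply: contonM => //; apply: contonB => //; exact: conton_cst.
have -> : square_int (fun w => f w / (w - z)) z r =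
    f z * square_int (fun w => (w - z)^-1) z r + square_int (fun w => (f w - f z) / (w - z)) z r.
  rewrite -lin //; congr square_int; apply/funext => w; ring.
rewrite square_int_pole // [tau * _]mulrC addrAC subrr add0r.
apply: le_trans (bd _ (e / 16 / r) cb _) _.
  move=> w hw; have k := frz w hw; rewrite cmodM cmodV.
  apply: ler_pM; rewrite ?invr_ge0 ?cmod_ge0 //.
    by apply/ltW/hd; apply: le_lt_trans h5; apply: square_cmod; exact: sqframe_square.
  by rewrite lef_pV2 ?posrE //; apply: lt_le_trans k.
by rewrite (_ : 16 * r * _ = e) //; field; rewrite gt_eqF.
Qed.

Lemma Cauchy_formula_square f z r w : 0 < r -> cmod (w - z) < r ->
  (forall v, square z r v -> exists D, cder f v D) ->
  square_int (fun v => f v / (v - w)) z r = tau * f w.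
Proof.
move=> r0 wz hf; have := normRe (w - z); have := normIm (w - z); rewrite ReB ImB => h1 h2.
have {}h1 := le_lt_trans h1 wz; have {}h2 := le_lt_trans h2 wz.
move: h1 h2; rewrite !ltr_norml => /andP[? ?] /andP[? ?].
apply: Cauchy_formula; try lra.
  by move=> v hv _; exact: hf.
have [D /cder_cont //] : exists D, cder f w D.
by apply: hf; apply/andP; split; apply/andP; split; lra.
Qed.

(** * Cauchy estimates and Weierstrass' theorem *)

(** In [intfun_kernel] the frame functional has norm 16 r; times the constant 2 m / r^3 and divided
    by the modulus of [tau], this gives the coefficient 32 m / r^2 of the remainder. The derivative
    obeys the analogous bound with room to spare. *)
Definition cbound : R := 32 / cmod tau.

Lemma cbound_gt0 : 0 < cbound.
Proof. by rewrite divr_gt0 // cmod_gt0 tau_neq0. Qed.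

Lemma Cauchy_estimate f z r m : 0 < r -> 0 <= m ->
  (forall v, square z r v -> exists D, cder f v D) -> (forall v, square z r v -> cmod (f v) <= m) ->
  exists D, [/\ cder f z D, cmod D <= cbound * m / r &
    forall w, cmod (w - z) <= r / 2 ->
      cmod (f w - f z - D * (w - z)) <= cbound * m / r ^+ 2 * cmod (w - z) ^+ 2].
Proof.
move=> r0 m0 hf fm.
have cf : conton (sqframe z r) f.
  by move=> v /sqframe_square /hf[D /cder_cont].
have cid : conton (sqframe z r) id by move=> v _; exact: ccont_id.
have [D [D1 D2]] := intfun_kernel _ _ _ (intfun_sI z r (ltW r0)) f id z r m cf cid r0
  (fun v hv => sqframe_cmod _ _ _ (ltW r0) hv) m0 (fun v hv => fm v (sqframe_square _ _ _ hv)).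
have t0 : 0 < cmod tau by rewrite cmod_gt0 tau_neq0.
have quad w : cmod (w - z) <= r / 2 ->
      cmod (f w - f z - D / tau * (w - z)) <= cbound * m / r ^+ 2 * cmod (w - z) ^+ 2.
  move=> wz; have := D2 w wz; rewrite !Cauchy_formula_square //; first last.
  - by lra.
  - by rewrite subrr cmod0.
  rewrite (_ : tau * f w - _ - _ = tau * (f w - f z - D / tau * (w - z))); last first.
    by field; exact: tau_neq0.
  rewrite cmodM => h; rewrite -(ler_pM2l t0); apply: le_trans h _.
  rewrite le_eqVlt; apply/orP; left; apply/eqP; rewrite /cbound; field.
  by rewrite !gt_eqF.
exists (D / tau); split => //.
- apply: quad_cder quad; first by lra.
  apply: divr_ge0; last by apply: exprn_ge0; exact: ltW.
  by apply: mulr_ge0 => //; apply: ltW; exact: cbound_gt0.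
- rewrite cmodM cmodV ler_pdivrMr //; apply: le_trans D1 _.
  rewrite (_ : cbound * m / r * cmod tau = 32 * m / r); last by rewrite /cbound; field; rewrite !gt_eqF.
  rewrite (_ : 16 * r * (m / r ^+ 2) = 16 * m / r); last by field; rewrite gt_eqF.
  apply: ler_wpM2r; first by rewrite invr_ge0 ltW.
  lra.
Qed.

Lemma square_sub z w r s t : square z r w -> r + s <= t -> square w s `<=` square z t.
Proof.
move=> /squareP[h1 h2] rst v /squareP[h3 h4]; apply/squareP.
rewrite (_ : v - z = (v - w) + (w - z)); last by ring.
have e1 (a b : Cx) : Re (a + b) = Re a + Re b by case: a; case: b.
have e2 (a b : Cx) : Im (a + b) = Im a + Im b by case: a; case: b.
rewrite e1 e2; split; apply: le_trans (ler_normD _ _) _; lra.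
Qed.

Lemma disc_square z r : disc z r `<=` square z r.
Proof.
move=> w; rewrite /disc /= => wz; apply/squareP.
by split; [apply: le_trans (normRe _) _|apply: le_trans (normIm _) _]; exact: ltW.
Qed.

Lemma square_center z r : 0 <= r -> square z r z.
Proof. by move=> r0; apply/squareP; rewrite subrr /= normr0. Qed.

Lemma rect_compact a b c d : compact (rect a b c d).
Proof.
apply: (@compact_HB _ (`|a| + `|b| + `|c| + `|d|)); last first.
  move=> z /andP[/andP[? ?] /andP[? ?]]; apply: le_trans (cmod_ReIm _) _.
  suff : `|Re z| <= `|a| + `|b| /\ `|Im z| <= `|c| + `|d| by case; lra.
  have := ler_norm b; have := ler_norm d; have := ler_norm (- a); have := ler_norm (- c).
  rewrite !normrN; have := normr_ge0 a; have := normr_ge0 b; have := normr_ge0 c; have := normr_ge0 d.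
  by move=> *; rewrite !ler_norml; split; apply/andP; split; lra.
have hs (g : Cx -> R) (t : R) (A : set C) : (forall u v : Cx, `|g u - g v| <= cmod (u - v)) ->
   (forall w, A w -> g w <= t) -> forall z, t < g z -> exists2 r : R, 0 < r & forall w, disc z r w -> ~ A w.
  move=> gl gA z tz; exists (g z - t); first by rewrite subr_gt0.
  move=> w wz /gA gt; have := gl z w; rewrite cmodB => h.
  by have := ler_norm (g z - g w); move: wz; rewrite /disc /=; lra.
have lR (u v : Cx) : `|Re u - Re v| <= cmod (u - v) by rewrite -ReB normRe.
have lI (u v : Cx) : `|Im u - Im v| <= cmod (u - v) by rewrite -ImB normIm.
apply: closed_discP => z /negP; rewrite /rect /= !negb_and -!ltNge => /orP[/orP[h|h]|/orP[h|h]].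
- apply: (hs (fun w => - Re w) (- a)); last by lra.
    by move=> u v; rewrite -opprD normrN lR.
  by move=> w /andP[/andP[? ?] _]; lra.
- by apply: (hs (fun w => Re w) b) => // w /andP[/andP[? ?] _]; lra.
- apply: (hs (fun w => - Im w) (- c)); last by lra.
    by move=> u v; rewrite -opprD normrN lI.
  by move=> w /andP[_ /andP[? ?]]; lra.
- by apply: (hs (fun w => Im w) d) => // w /andP[_ /andP[? ?]]; lra.
Qed.

Lemma square_compact z r : compact (square z r).
Proof. exact: rect_compact. Qed.

(* Weierstrass' theorem, stated without sequences. *)
Lemma hol_unif_limit (U : set C) f : (forall z, U z -> exists2 r : R, 0 < r &
    forall e : R, 0 < e -> exists g, (forall w, square z r w -> exists D, cder g w D) /\
      forall w, square z r w -> cmod (g w - f w) <= e) ->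
  hol U f.
Proof.
move=> hU z /hU[r r0 happ].
pose s := r / 2; have s0 : 0 < s by rewrite /s; lra.
have rE : r = s + s by rewrite /s; lra.
clearbody s.
have cf w : square z s w -> ccont f w.
  move=> zw e e0; have [|g [hg fg]] := happ (e / 4); first by lra.
  have zw' : square z r w by apply: (square_sub z z s s) zw; [apply: square_center; exact: ltW|lra].
  have [D /cder_cont cg] := hg w zw'.
  have [|d d0 hd] := cg (e / 4); first by lra.
  exists (Num.min d s); first by rewrite lt_min d0.
  move=> v; rewrite lt_min => /andP[/hd v1 v2].
  have zv : square z r v by apply: (square_sub z w s s) (disc_square _ _ _ v2) => //; lra.
  have := fg v zv; have := fg w zw'.
  have := cmod_tri (g v) (f v) (f w); have := cmod_tri (g w) (g v) (f w).
  rewrite (cmodB (f v) (g v)); lra.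
have L := intfun_sI z s (ltW s0); have [_ _ bd] := L.
have cfr : conton (sqframe z s) f by move=> w /sqframe_square; exact: cf.
(* Cauchy's formula passes to the uniform limit, so f is a Cauchy integral near z and hence
   differentiable. *)
have E w : cmod (w - z) < s -> square_int (fun v => f v / (v - w)) z s = tau * f w.
  move=> ws; apply/eqP; rewrite -subr_eq0 -cmod_eq0 eq_le cmod_ge0 andbT.
  apply/ler_addgt0Pr => e e0; rewrite add0r.
  (* The two coefficients of the error in passing from g to f, plus 1. *)
  pose B := 16 * s / (s - cmod (w - z)) + cmod tau + 1.
  have sw : 0 < s - cmod (w - z) by rewrite subr_gt0.
  have B1 : 0 <= 16 * s / (s - cmod (w - z)) by rewrite divr_ge0 // ltW // mulr_gt0.
  have B0 : 0 < B by rewrite /B; have := cmod_ge0 tau; lra.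
  have [|g [hg fg]] := happ (e / B); first by rewrite divr_gt0.
  have sr : square z s `<=` square z r by apply: (square_sub z z 0); [exact: square_center|lra].
  have hgs v : square z s v -> exists D, cder g v D by move=> /sr /hg.
  have := Cauchy_formula_square g z s w s0 ws hgs => Eg.
  have farv v : sqframe z s v -> s - cmod (w - z) <= cmod (v - w).
    by move=> /(sqframe_cmod _ _ _ (ltW s0)); have := cmod_tri w v z; lra.
  have nv v : sqframe z s v -> v != w.
    by move=> /farv k; rewrite -subr_eq0 -cmod_gt0; apply: lt_le_trans k.
  have ck := conton_cauchy _ _ nv.
  have cg : conton (sqframe z s) g by move=> v /sqframe_square /hgs[D /cder_cont].
  rewrite (_ : square_int _ z s - tau * f w = - square_int (fun v => (g v - f v) / (v - w)) z s +
    tau * (g w - f w)); last first.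
    rewrite mulrBr -Eg (_ : (fun v => (g v - f v) / (v - w)) = (fun v => g v / (v - w) - f v / (v -
      w))); last first.
      by apply/funext => v; rewrite mulrBl.
    by rewrite (intfunB _ _ _ L) /=; [ring|exact: contonM|exact: contonM].
  apply: le_trans (cmodD _ _) _; rewrite cmodN cmodM.
  have k1 : cmod (g w - f w) <= e / B.
    by apply: fg; apply: sr; exact: disc_square.
  have k2 : cmod (square_int (fun v => (g v - f v) / (v - w)) z s) <= 16 * s * (e / B / (s - cmod (w - z))).
    apply: bd; first by apply: contonM => //; exact: contonB.
    move=> v hv; rewrite cmodM cmodV; apply: ler_pM; rewrite ?invr_ge0 ?cmod_ge0 //.
      by apply: fg; apply: sr; exact: sqframe_square.
    rewrite lef_pV2 ?posrE //; first exact: farv.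
    by apply: lt_le_trans (farv _ hv).
  apply: le_trans (lerD k2 (ler_wpM2l (cmod_ge0 tau) k1)) _.
  rewrite (_ : 16 * s * _ + _ = (e / B) * (B - 1)); last first.
    by move: (e / B) => q; rewrite /B; ring.
  have eB : e / B * B = e by rewrite divfK // gt_eqF.
  have : 0 < e / B by rewrite divr_gt0.
  by rewrite mulrBr eB mulr1; lra.
have cid : conton (sqframe z s) id by move=> v _; exact: ccont_id.
have [m _ hm] := compact_ccont_bounded _ _ (square_compact z s) cf.
have [|D dD] := intfun_kernel_cder _ _ _ f id z s m L cfr cid s0 _ (fun v hv => hm v
  (sqframe_square _ _ _ hv)).
  by move=> v; apply: sqframe_cmod; exact: ltW.
exists (tau^-1 * D); apply: (cder_ext (fun w => tau^-1 * square_int (fun v => f v / (v - w)) z s) _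
  _ _ s) => //.
  by move=> w /E ->; rewrite mulKf // tau_neq0.
exact: cderZ.
Qed.

(** The difference quotients with a fixed increment h are holomorphic, and the remainder in
    [Cauchy_estimate] makes their convergence to the derivative locally uniform. *)
Lemma hol_cderf (U : set C) f : open U -> hol U f -> hol U (cderf f).
Proof.
move=> oU hf; apply: hol_unif_limit => z Uz.
have [rho rho0 hrho] := proj1 (open_discP _) oU z Uz.
have [d d0 hd] := hol_cont _ _ _ hf Uz 1 ltr01.
have [r r0 [r1 r2]] : exists2 r : R, 0 < r & 12 * r <= rho /\ 12 * r <= d.
  exists (Num.min rho d / 12); first by rewrite divr_gt0 // lt_min rho0.
  by rewrite mulrC divfK //; split; rewrite ge_min lexx ?orbT.
have sU : square z (3 * r) `<=` U.
  by move=> w /square_cmod hw; apply: hrho; rewrite /disc /=; lra.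
have fm w : square z (3 * r) w -> cmod (f w) <= cmod (f z) + 1.
  move=> /square_cmod hw; have := hd w; have := cmod_leB (f w) (f z).
  by move=> h1 /(_ _)/ltW h2; have := h2 ltac:(lra); lra.
exists r => // e e0.
pose m := cmod (f z) + 1.
have m0 : 0 < m by rewrite /m; have := cmod_ge0 (f z); lra.
pose K := cbound * m / r ^+ 2.
have K0 : 0 < K by apply: divr_gt0; [apply: mulr_gt0 => //; exact: cbound_gt0|exact: exprn_gt0].
(* The first bound brings w + h into the range of the Cauchy estimate, the second makes the
   remainder, divided by h, at most e. *)
pose h := Num.min (r / 2) (e / K).
have h0 : 0 < h by rewrite lt_min; apply/andP; split; apply: divr_gt0.
have h1 : h <= r / 2 by rewrite /h ge_min lexx.
have h2 : h <= e / K by rewrite /h ge_min lexx orbT.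
have KE : K = cbound * m / r ^+ 2 by [].
clearbody h K.
have hh : cmod h%:C%C = h by rewrite cmod_real gtr0_norm.
have hn0 : (h%:C%C : Cx) != 0 by rewrite -cmod_gt0 hh.
exists (fun w => h%:C%C^-1 * (f (w + h%:C%C) - f w)); split=> w zw.
  have Uw : U w by apply: hrho; have := square_cmod _ _ _ zw; rewrite /disc /=; lra.
  have Uwh : U (w + h%:C%C).
    apply: hrho; have := square_cmod _ _ _ zw; rewrite /disc /=.
    by have := cmodD (w - z) h%:C%C; rewrite hh addrAC; lra.
  have [D dD] := hf w Uw; have [E dE] := hf _ Uwh.
  eexists; apply: cderZ; apply: (cderB _ _ _ _ _ _ dD).
  by apply: (cder_comp (fun w => w + h%:C%C) f) dE; apply: cderD (cder_id w) (cder_cst _ w).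
have sw : square w r `<=` square z (3 * r) by apply: (square_sub z w r r) => //; lra.
have [||D [dD _ /(_ (w + h%:C%C))]] := Cauchy_estimate f w r m r0 (ltW m0).
- by move=> v /sw /sU /hf.
- by move=> v /sw /fm.
rewrite (cderfE _ _ _ dD) addrAC subrr add0r hh -KE => /(_ h1) k.
rewrite (_ : _ - D = h%:C%C^-1 * (f (w + h%:C%C) - f w - D * h%:C%C)); last by field.
rewrite cmodM cmodV hh mulrC ler_pdivrMr //; apply: le_trans k _.
move: h2; rewrite ler_pdivlMr //; nra.
Qed.

(** * Primitives and the logarithm *)

(** Increments of a primitive are integrals whose endpoints come in either order. *)
Definition between (a b t : R) : bool := (a <= t <= b) || (b <= t <= a).

Lemma between_dist x x' t : between x x' t -> `|t - x| <= `|x' - x|.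
Proof.
have h1 := ler_norm (x' - x); have h2 := ler_norm (x - x'); rewrite distrC in h2.
by move=> /orP[] /andP[? ?]; rewrite ler_norml; apply/andP; split; lra.
Qed.

Lemma cI_bound_between g a b m : (forall t, between a b t -> rcont g t) ->
  (forall t, between a b t -> cmod (g t) <= m) -> cmod (cint g a b) <= 2 * m * `|b - a|.
Proof.
move=> cg gm; have [ab|/ltW ba] := leP a b.
  rewrite ger0_norm ?subr_ge0 //; apply: cI_bound => // [|t ht]; last by apply: gm; rewrite /between ht.
  by apply: cex_cont.
rewrite cI_swap; last by apply: cex_swap; apply: cex_cont.
rewrite cmodN distrC ger0_norm ?subr_ge0 //; apply: cI_bound => // [|t ht].
  by apply: cex_swap; apply: cex_cont.
by apply: gm; rewrite /between ht orbT.
Qed.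

Lemma Goursat_between f x x' c d : c <= d ->
  (forall s t, between x x' s -> c <= t <= d -> exists D, cder f (Complex s t) D) ->
  rect_int f x x' c d = 0.
Proof.
move=> cd hf; have [xx|/ltW xx] := leP x x'.
  apply: Goursat => // -[s t] /andP[/= hs ht]; apply: hf => //.
  by rewrite /between hs.
have ex y : c <= y <= d -> cintegrable (fun t => f (Complex t y)) x' x.
  move=> hy; apply: hI_ex => // s hs; have [|D /cder_cont //] := hf s y _ hy.
  by rewrite /between hs orbT.
have <- : - rect_int f x' x c d = 0.
  apply/eqP; rewrite oppr_eq0; apply/eqP; apply: Goursat => // -[s t] /andP[/= hs ht].
  by apply: hf => //; rewrite /between hs orbT.
rewrite /rect_int /hseg_int (cI_swap _ x' x) ?(cI_swap (fun t => f (Complex t d)) x' x); first by ring.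
- by apply: ex; rewrite lexx cd.
- by apply: ex; rewrite lexx cd.
Qed.

(** The primitive integrates from the corner (a, c) first along the bottom and then upwards, which
    is why the hypothesis includes the left and bottom sides. *)
Lemma rect_primitive f (a b c d : R) :
  (forall s t, a <= s < b -> c <= t < d -> exists D, cder f (Complex s t) D) ->
  exists F, forall s t, a < s < b -> c < t < d -> cder F (Complex s t) (f (Complex s t)).
Proof.
move=> hf.
have cf s t : a <= s < b -> c <= t < d -> ccont f (Complex s t).
  by move=> hs ht; have [D /cder_cont] := hf s t hs ht.
exists (fun z => hseg_int f c a (Re z) + vseg_int f (Re z) c (Im z)) => x y hx hy e e0.
have [/ltW xa xb] := andP hx; have [/ltW yc yd] := andP hy.
have hx1 : a <= x < b by rewrite xa.
have hy1 : c <= y < d by rewrite yc.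
have [|d1 d10 hd1] := cf x y hx1 hy1 (e / 4); first by lra.
pose del := Num.min (d1 / 2) (Num.min (Num.min (x - a) (b - x)) (Num.min (y - c) (d - y))).
have del0 : 0 < del.
  by case/andP: hx => ? ?; case/andP: hy => ? ?; rewrite /del !lt_min !subr_gt0 divr_gt0 //=;
    apply/andP; split; apply/andP.
have [e1 e2 e3 e4 e5] : [/\ del <= d1 / 2, del <= x - a, del <= b - x, del <= y - c & del <= d - y].
  by rewrite /del; split; rewrite !ge_min lexx ?orbT.
clearbody del; exists del => // -[x' y'] vz.
have hx' : `|x' - x| < del by apply: le_lt_trans vz; exact: (normRe (Complex (x' - x) (y' - y))).
have hy' : `|y' - y| < del by apply: le_lt_trans vz; exact: (normIm (Complex (x' - x) (y' - y))).
have nx : `|x' - x| <= cmod (Complex x' y' - Complex x y) by exact: (normRe (Complex (x' - x) (y' - y))).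
have ny : `|y' - y| <= cmod (Complex x' y' - Complex x y) by exact: (normIm (Complex (x' - x) (y' - y))).
move: (hx') (hy'); rewrite !ltr_norml => /andP[x1 x2] /andP[y1 y2].
have bx s : between x x' s -> a <= s < b.
  by move=> /orP[] /andP[s1 s2]; apply/andP; split; clear -s1 s2 e2 e3 x1 x2; lra.
have b_y t : between y y' t -> c <= t < d.
  by move=> /orP[] /andP[s1 s2]; apply/andP; split; clear -s1 s2 e4 e5 y1 y2; lra.
have hx2 : a <= x' < b by apply/andP; split; clear -e2 e3 x1 x2; lra.
(* This raises the horizontal part of the increment from height c to height y, leaving an integral
   over a short path from (x, y) to (x', y'). *)
have G : rect_int f x x' c y = 0.
  apply: Goursat_between => // s t /bx hs /andP[t1 t2]; apply: hf => //.
  by rewrite t1 (le_lt_trans t2).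
have C1 : hseg_int f c a x' = hseg_int f c a x + hseg_int f c x x'.
  rewrite /hseg_int cI_chasles //.
    apply: cex_cont => s hs; apply: ccont_h; apply: cf; last by rewrite lexx (le_lt_trans yc).
    by case/orP: hs => /andP[s1 s2]; apply/andP; split; clear -s1 s2 xa xb; lra.
  by apply: cex_cont => s /bx hs; apply: ccont_h; apply: cf => //; rewrite lexx (le_lt_trans yc).
have C2 : vseg_int f x' c y' = vseg_int f x' c y + vseg_int f x' y y'.
  rewrite /vseg_int -mulrDr cI_chasles //.
    apply: cex_cont => s hs; apply: ccont_v; apply: cf => //.
    by case/orP: hs => /andP[s1 s2]; apply/andP; split; clear -s1 s2 yc yd; lra.
  by apply: cex_cont => s /b_y hs; apply: ccont_v; exact: cf.
have cab s t : a <= s < b -> c <= t < d -> ccont (fun z => f z - f (Complex x y)) (Complex s t).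
  by move=> hs ht; apply: ccontB; [exact: cf|exact: ccont_cst].
have D1 : hseg_int f y x x' = cint (fun t => f (Complex t y) - f (Complex x y)) x x' + (x' -
  x)%:C%C * f (Complex x y).
  rewrite -cI_const -[X in X + _]mul1r -cI_lin; last exact: cex_const.
    by rewrite /hseg_int; congr cint; apply/funext => t; ring.
  by apply: cex_cont => s /bx hs; apply: (ccont_h (fun z => f z - f (Complex x y))); exact: cab.
have D2 : vseg_int f x' y y' = 'i%C * (cint (fun t => f (Complex x' t) - f (Complex x y)) y y' +
  (y' - y)%:C%C * f (Complex x y)).
  rewrite -cI_const -[X in X + _]mul1r -cI_lin; last exact: cex_const.
    by rewrite /vseg_int; congr (_ * cint _ _ _); apply/funext => t; ring.
  apply: cex_cont => s /b_y hs; apply: (ccont_v (fun z => f z - f (Complex x y))); exact: cab.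
have vE : Complex x' y' - Complex x y = (x' - x)%:C%C + 'i%C * (y' - y)%:C%C :> Cx by exact: ReImE.
move: G; rewrite /rect_int /= C1 C2 => /eqP; rewrite subr_eq0 => /eqP G.
have -> : hseg_int f c a x + hseg_int f c x x' + (vseg_int f x' c y + vseg_int f x' y y') -
  (hseg_int f c a x + vseg_int f x c y) -
    f (Complex x y) * (Complex x' y' - Complex x y) =
    cint (fun t => f (Complex t y) - f (Complex x y)) x x' +
    'i%C * cint (fun t => f (Complex x' t) - f (Complex x y)) y y'.
  by rewrite -G D1 D2 vE; ring.
apply: le_trans (cmodD _ _) _; rewrite cmodM cmod_i mul1r.
have b1 : cmod (cint (fun t => f (Complex t y) - f (Complex x y)) x x') <= 2 * (e / 4) * `|x' - x|.
  apply: cI_bound_between.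
    by move=> s /bx hs; apply: (ccont_h (fun z => f z - f (Complex x y))); exact: cab.
  move=> t ht; apply/ltW/hd1; rewrite cmod_h.
  apply: le_lt_trans (_ : `|x' - x| < _); last by lra.
  exact: between_dist.
have b2 : cmod (cint (fun t => f (Complex x' t) - f (Complex x y)) y y') <= 2 * (e / 4) * `|y' - y|.
  apply: cI_bound_between.
    move=> s /b_y hs; apply: (ccont_v (fun z => f z - f (Complex x y))); exact: cab.
  move=> t ht; apply/ltW/hd1; apply: le_lt_trans (cmod_tri (Complex x' y) _ _) _.
  rewrite cmod_h cmod_v.
  have := between_dist _ _ _ ht; lra.
have : 2 * (e / 4) * `|x' - x| <= e / 2 * cmod (Complex x' y' - Complex x y).
  by rewrite (_ : 2 * (e / 4) = e / 2) ?ler_pM2l ?divr_gt0 //; clear; lra.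
have : 2 * (e / 4) * `|y' - y| <= e / 2 * cmod (Complex x' y' - Complex x y).
  by rewrite (_ : 2 * (e / 4) = e / 2) ?ler_pM2l ?divr_gt0 //; clear; lra.
lra.
Qed.

(* [Log u] is a branch of log (1 - u). *)
Lemma log_ex : exists Log : Cx -> Cx, forall u, cmod u < 1 -> cder Log u (- (1 - u)^-1).
Proof.
have [|F hF] := rect_primitive (fun u => - (1 - u)^-1) (-1) 1 (-1) 1.
  move=> s t hs ht.
  have n1 : (1 - Complex s t : Cx) != 0.
    rewrite -cmod_gt0; apply: lt_le_trans (normRe _); rewrite ReB /= normr_gt0 subr_eq0.
    by rewrite gt_eqF //; case/andP: hs.
  eexists; exact: (cderN _ _ _ (cderV (fun w => 1 - w) _ _ n1 (cderB _ _ _ _ _ (cder_cst 1 _) (cder_id _)))).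
exists F => -[s t] u1; apply: hF.
  by rewrite -ltr_norml; apply: le_lt_trans u1; exact: (normRe (Complex s t)).
by rewrite -ltr_norml; apply: le_lt_trans u1; exact: (normIm (Complex s t)).
Qed.

(** * Inverses of injective holomorphic maps *)

Section inverse.
Variables (U : set C) (phi : Cx -> Cx).
Hypotheses (oU : open U) (hphi : hol U phi)
  (inj : forall z w, U z -> U w -> phi z = phi w -> z = w).

Let dphi := cderf phi.

(** On a disc of critical points the fundamental theorem would make phi equal at the two ends of a
    horizontal segment. *)
Lemma inj_noncritical z r : 0 < r -> disc z r `<=` U ->
  exists2 w, disc z r w & dphi w != 0.
Proof.
move=> r0 dU; apply: contrapT => h.
have crit w : disc z r w -> dphi w = 0.
  by move=> zw; apply: contrapT => /eqP dw; apply: h; exists w.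
case: z => x y in dU crit h *; pose s := r / 2.
have s0 : 0 < s by rewrite /s; lra.
have sr : s < r by rewrite /s; lra.
clearbody s.
have inD t : x <= t <= x + s -> disc (Complex x y) r (Complex t y).
  by move=> /andP[? ?]; rewrite /disc /= cmod_h ltr_norml; apply/andP; split; lra.
have E : hseg_int (fun=> 0) y x (x + s) = phi (Complex (x + s) y) - phi (Complex x y).
  apply: hI_FTC; first by lra.
    by move=> t _; exact: ccont_cst.
  move=> t /inD ht; rewrite -(crit _ ht); apply: cderfP; exact/hphi/dU.
have Z : hseg_int (fun=> 0) y x (x + s) = 0 by rewrite /hseg_int cI_const mulr0.
move: E; rewrite Z => /eqP; rewrite eq_sym subr_eq0 => /eqP /inj.
have xs0 : x <= x <= x + s by apply/andP; split; lra.
have xs1 : x <= x + s <= x + s by apply/andP; split; lra.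
by move=> /(_ (dU _ (inD _ xs1)) (dU _ (inD _ xs0))) [] /eqP; rewrite gt_eqF //; lra.
Qed.

Lemma sqframe_compact z r : compact (sqframe z r).
Proof.
rewrite (_ : sqframe z r = square z r `&` ([set w : C | Re w <= Re z - r] `|` [set w : C | Re
  z + r <= Re w]
   `|` [set w : C | Im w <= Im z - r] `|` [set w : C | Im z + r <= Im w])); last first.
  apply/seteqP; split=> w.
    move=> [h1 h2]; split=> //; case: h2 => h2; [left; left; left|left; left; right|left;
      right|right] => /=; rewrite h2 //.
  move=> [h1 h2]; split=> //; case/andP: h1 => /andP[? ?] /andP[? ?].
  case: h2 => [[[|]|]|] /= ?; [apply: Or41|apply: Or42|apply: Or43|apply: Or44]; lra.
have half (g : Cx -> R) (t : R) : (forall u v : Cx, `|g u - g v| <= cmod (u - v)) ->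
    closed [set w : C | g w <= t].
  move=> gl; apply: closed_discP => w /negP; rewrite -ltNge => gw.
  exists (g w - t); first by rewrite subr_gt0.
  move=> v; rewrite /disc /= => vw gv; have := gl w v; rewrite cmodB.
  by have := ler_norm (g w - g v); lra.
have lR (u v : Cx) : `|Re u - Re v| <= cmod (u - v) by rewrite -ReB normRe.
have lI (u v : Cx) : `|Im u - Im v| <= cmod (u - v) by rewrite -ImB normIm.
have lR' (u v : Cx) : `|- Re u - - Re v| <= cmod (u - v) by rewrite -opprD normrN.
have lI' (u v : Cx) : `|- Im u - - Im v| <= cmod (u - v) by rewrite -opprD normrN.
apply: (@subclosed_compact _ _ (square z r)); [|exact: square_compact|by move=> w []].
apply: closedI; first by apply: compact_closed; [exact: norm_hausdorff|exact: square_compact].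
apply: closedU; first apply: closedU; first apply: closedU.
- exact: (half (fun w => Re w)).
- rewrite (_ : [set w : C | _] = [set w : C | - Re w <= - (Re z + r)]); first exact: (half (fun w => - Re w)).
  by apply/seteqP; split=> w /=; lra.
- exact: (half (fun w => Im w)).
- rewrite (_ : [set w : C | _] = [set w : C | - Im w <= - (Im z + r)]); first exact: (half (fun w => - Im w)).
  by apply/seteqP; split=> w /=; lra.
Qed.

Variables (p : Cx) (r : R) (h : Cx -> Cx).
Hypotheses (r0 : 0 < r) (pU : square p r `<=` U) (hh : hol U h).

(* [T w] is [tau * h z] if [w = phi z] and 0 if w is not attained: the case h = 1 shows that phi is open
   and the case h = id that its inverse is holomorphic. *)
Let T w := square_int (fun v => h v * dphi v / (phi v - w)) p r.

Lemma inner_disc z : square p r z -> ~ sqframe p r z ->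
  exists2 s : R, 0 < s & forall w, disc z s w -> square p r w /\ ~ sqframe p r w.
Proof.
move=> /andP[/andP[z1 z2] /andP[z3 z4]] nf.
have [i1 i2 i3 i4] : [/\ Re p - r < Re z, Re z < Re p + r, Im p - r < Im z & Im z < Im p + r].
  by rewrite !lt_neqAle z1 z2 z3 z4 !andbT; split; apply/eqP => E; apply: nf; split;
   [apply/andP; split; apply/andP|apply: Or41|apply/andP; split; apply/andP|apply: Or42
   |apply/andP; split; apply/andP|apply: Or43|apply/andP; split; apply/andP|apply: Or44].
pose s := Num.min (Num.min (Re z - (Re p - r)) (Re p + r - Re z)) (Num.min (Im z - (Im p - r)) (Im
  p + r - Im z)).
have s0 : 0 < s by rewrite /s !lt_min !subr_gt0 i1 i2 i3 i4.
have [e1 e2 e3 e4] : [/\ s <= Re z - (Re p - r), s <= Re p + r - Re z, s <= Im z - (Im p - r) & s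
  <= Im p + r - Im z].
  by rewrite /s; split; rewrite !ge_min lexx ?orbT.
clearbody s; exists s => // w wz.
have := le_lt_trans (normRe _) wz; have := le_lt_trans (normIm _) wz.
rewrite ReB ImB !ltr_norml => /andP[? ?] /andP[? ?].
split; first by apply/andP; split; apply/andP; split; lra.
by move=> [_] [] ?; lra.
Qed.

Lemma conton_dphi S : S `<=` U -> conton S dphi.
Proof. by move=> SU; apply: (@hol_conton U) => //; exact: hol_cderf. Qed.

Lemma inv_int_out w : ~ (phi @` square p r) w -> T w = 0.
Proof.
have r1 := r0; move=> nw; apply: Goursat; [lra|lra|move=> v hv].
have Uv := pU v hv.
have [D dD] := hh v Uv; have [E dE] := hol_cderf U phi oU hphi v Uv; have [F dF] := hphi v Uv.
have nz : phi v - w != 0 by rewrite subr_eq0; apply/eqP => vw; apply: nw; exists v.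
by eexists; apply: cderM (cderM _ _ _ _ _ dD dE) (cderV (fun v => phi v - w) _ _ nz (cderB _ _ _ _
  _ dF (cder_cst w v))).
Qed.

(** With g the Carathéodory slope of phi at z, the integrand is k(v)/(v-z) for k = h phi' / g. Since
    g z is the nonzero derivative, k is continuous at z with k z = h z, and Cauchy's formula asks no
    more there. *)
Lemma inv_int_noncritical z : square p r z -> ~ sqframe p r z -> dphi z != 0 -> T (phi z) = tau * h z.
Proof.
have r1 := r0; move=> pz nz dz; have Uz := pU z pz.
have dphiz : cder phi z (dphi z) by apply: cderfP; exact: hphi.
have /cder_carath[g [cg gz phig]] := dphiz.
pose k v := h v * dphi v / g v.
have hd : hol U dphi by exact: hol_cderf.
have ck : ccont k z.
  apply: ccontM; last by apply: ccontV; rewrite ?gz.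
  by apply: ccontM; [exact: hol_cont hh Uz|exact: hol_cont hd Uz].
have kE v : v != z -> k v / (v - z) = h v * dphi v / (phi v - phi z).
  move=> vz; rewrite /k (phig v) addrAC subrr add0r invfM -!mulrA.
  by congr (_ * (_ * _)); rewrite mulrC.
have -> : h z = k z by rewrite /k gz mulfK.
rewrite -(Cauchy_formula k z (Re p - r) (Re p + r) (Im p - r) (Im p + r)) //.
- apply: rI_ext; [lra|lra|move=> v hv].
  by rewrite kE //; apply/eqP => vz; apply: nz; rewrite -vz.
1-4: move: pz => /andP[/andP[z1 z2] /andP[z3 z4]]; rewrite lt_neqAle ?z1 ?z2 ?z3 ?z4 andbT;
  apply/eqP => E; apply: nz; split.
all: try by apply/andP; split; apply/andP.
- exact: Or41.
- exact: Or42.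
- exact: Or43.
- exact: Or44.
move=> v pv vz; have Uv := pU v pv.
have [|d d0 dv] := proj1 (open_discP _) (open_disc v (cmod (v - z))) v.
  by apply: disc_center; rewrite cmod_gt0 subr_eq0.
have nzv : phi v - phi z != 0 by rewrite subr_eq0; apply: contraNneq vz => /inj ->.
have [D dD] := hh v Uv; have [E dE] := hd v Uv; have [F dF] := hphi v Uv.
(* The slope g is only known to be continuous at z. Off z it is (phi v - phi z)/(v - z), nonzero by
   injectivity, and in this form k is visibly differentiable. *)
eexists; apply: (cder_ext (fun v => h v * dphi v * ((v - z) / (phi v - phi z))) _ _ _ d d0).
  move=> w /dv wv; have wz : w != z.
    by apply: contraTneq wv => ->; rewrite /disc /= cmodB ltxx.
  have wz0 : w - z != 0 by rewrite subr_eq0.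
  rewrite /k; congr (_ * _); rewrite (phig w) addrAC subrr add0r invfM mulrCA divff // mulr1 //.
apply: cderM (cderM _ _ _ _ _ dD dE) (cderM _ _ _ _ _ (cderB _ _ _ _ _ (cder_id v) (cder_cst z v))
  (cderV (fun v => phi v - phi z) _ _ nzv (cderB _ _ _ _ _ dF (cder_cst _ v)))).
Qed.

Lemma inv_int_cder w : (forall v, sqframe p r v -> phi v != w) -> exists D, cder T w D.
Proof.
move=> nw.
have fU : sqframe p r `<=` U by move=> v /sqframe_square /pU.
have ch : conton (sqframe p r) h by exact: hol_conton hh fU.
have cd : conton (sqframe p r) dphi by exact: conton_dphi.
have cp : conton (sqframe p r) phi by exact: hol_conton hphi fU.
have cpw : conton (sqframe p r) (fun v => phi v - w) by apply: contonB => //; exact: conton_cst.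
have [|del del0 hdel] := compact_ccont_lower _ _ (sqframe_compact p r) cpw.
  by move=> v /nw; rewrite subr_eq0.
have [m m0 hm] := compact_ccont_bounded _ _ (sqframe_compact p r) (contonM _ _ _ ch cd).
apply: (intfun_kernel_cder _ _ _ (fun v => h v * dphi v) phi w del m (intfun_sI p r (ltW r0))) => //.
exact: contonM.
Qed.

(* Critical points are limits of noncritical ones, so there is no need to prove that there are none. *)
Lemma inv_int_in z : square p r z -> ~ sqframe p r z -> T (phi z) = tau * h z.
Proof.
move=> pz nz; apply: contrapT => /eqP; rewrite -subr_eq0 => ne.
have Uz := pU z pz.
have off v : sqframe p r v -> phi v != phi z.
  move=> fv; apply/eqP => /inj vz; apply: nz; rewrite -vz //.
  by apply: pU; exact: sqframe_square.
have [D /cder_cont cT] := inv_int_cder _ off.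
have cc : ccont (fun v => T (phi v) - tau * h v) z.
  apply: ccontB; first by apply: ccont_comp => //; exact: hol_cont hphi Uz.
  by apply: ccontM; [exact: ccont_cst|exact: hol_cont hh Uz].
have [|d d0 hd] := cc (cmod (T (phi z) - tau * h z)); first by rewrite cmod_gt0.
have [s s0 hs] := inner_disc z pz nz.
have m0 : 0 < Num.min d s by rewrite lt_min d0.
have [|w zw dw] := inj_noncritical z (Num.min d s) m0.
  by move=> w; rewrite /disc /= lt_min => /andP[_ /hs[/pU]].
move: zw; rewrite /disc /= lt_min => /andP[/hd + /hs[w1 w2]].
by rewrite inv_int_noncritical // subrr sub0r cmodN ltxx.
Qed.

End inverse.

Lemma injective_hol_inverse (U : set C) (phi : Cx -> Cx) : open U -> hol U phi ->
  (forall z w, U z -> U w -> phi z = phi w -> z = w) ->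
  open (phi @` U : set C) /\
  exists psi : Cx -> Cx, (forall z, U z -> psi (phi z) = z) /\ hol (phi @` U) psi.
Proof.
move=> oU hphi inj.
pose psi (w : Cx) : Cx := xget 0 [set z | U z /\ phi z = w].
have psiK z : U z -> psi (phi z) = z.
  move=> Uz; have [] := xgetPex 0 (ex_intro (fun y => U y /\ phi y = phi z) z (conj Uz erefl)).
  by move=> h1 h2; exact: inj.
have key p : U p -> exists2 s : R, 0 < s & (forall w, disc (phi p) s w -> exists2 z, U z & phi z = w)
    /\ exists D, cder psi (phi p) D.
  move=> Up; have [rho rho0 hrho] := proj1 (open_discP _) oU p Up.
  pose r := rho / 4; have r0 : 0 < r by rewrite /r; lra.
  have pU : square p r `<=` U.
    by move=> w /square_cmod hw; apply: hrho; rewrite /disc /=; move: hw; rewrite /r; lra.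
  clearbody r.
  have pin : square p r p by apply: square_center; exact: ltW.
  have pfr : ~ sqframe p r p by move=> /(sqframe_cmod _ _ _ (ltW r0)); rewrite subrr cmod0; lra.
  have fU v : sqframe p r v -> U v by move=> /sqframe_square /pU.
  have off v : sqframe p r v -> phi v != phi p.
    by move=> fv; apply/eqP => e; apply: pfr; rewrite -{2}(inj _ _ (fU _ fv) Up e).
  pose T h w := square_int (fun v => h v * cderf phi v / (phi v - w)) p r.
  have h1 : hol U (fun=> 1) by exact: hol_cst.
  have [D1 dD1] := inv_int_cder U phi oU hphi p r (fun=> 1) r0 pU h1 (phi p) off.
  have [D2 dD2] := inv_int_cder U phi oU hphi p r id r0 pU (hol_id U) (phi p) off.
  have T1p : T (fun=> 1) (phi p) = tau.
    by rewrite /T (inv_int_in U phi oU hphi inj p r (fun=> 1)) // mulr1.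
  (* The integral with h = 1 equals [tau] at [phi p] and 0 at values not attained on the square; by
     continuity all values near [phi p] are attained. *)
  have [|s s0 hs] := cder_cont _ _ _ dD1 (cmod tau); first by rewrite cmod_gt0 tau_neq0.
  have inT w : disc (phi p) s w -> exists2 z, square p r z & phi z = w.
    move=> /hs; apply: contraPP => nw; apply/negP.
    rewrite -/(T _ w) -/(T _ (phi p)) T1p /T (inv_int_out U phi oU hphi p r (fun=> 1)) //.
    by rewrite sub0r cmodN ltxx.
  exists s => //; split.
    by move=> w /inT[z /pU Uz zw]; exists z.
  have cpw : conton (sqframe p r) (fun v => phi v - phi p).
    by apply: contonB; [exact: hol_conton hphi fU|exact: conton_cst].
  (* [del] bounds from below the distance of [phi p] to the image of the frame: a preimage of a
     closer value is not on the frame, and the integral with h = id recovers it. *)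
  have [|del del0 hdel] := compact_ccont_lower _ _ (sqframe_compact p r) cpw.
    by move=> v /off; rewrite subr_eq0.
  exists (tau^-1 * D2).
  apply: (cder_ext (fun w => tau^-1 * T id w) _ _ _ (Num.min s del)); last exact: cderZ.
    by rewrite lt_min s0.
  move=> w; rewrite lt_min => /andP[/inT[z pz <-] wdel].
  have nf : ~ sqframe p r z by move=> /hdel; move: wdel; lra.
  have Uz := pU z pz; rewrite psiK // /T (inv_int_in U phi oU hphi inj p r id r0 pU (hol_id U)) //.
  by rewrite mulKf // tau_neq0.
apply: conj; last first.
  exists psi; apply: conj => // w [p Up <-].
  by have [s s0 [_ ?]] := key p Up.
apply/open_discP => w [p Up <-]; have [s s0 [hs _]] := key p Up.
by exists s => // v /hs[z Uz zv]; exists z.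
Qed.

(** * Grids *)

(* Summation by parts: only the indices where chi switches contribute. *)
Lemma telescope_switch (T : nat) (chi : nat -> bool) (D : nat -> Cx) :
  chi 0%N = false -> (forall l, chi l != chi l.+1 -> D l.+1 = 0) ->
  \sum_(l < T) (if chi l then D l - D l.+1 else 0) = - (if chi T then D T else 0).
Proof.
move=> c0 cD; elim: T => [|T IH]; first by rewrite big_ord0 c0 oppr0.
rewrite big_ord_recr /= IH; have := cD T.
by case: (chi T); case: (chi T.+1) => /= h; [|rewrite h //|rewrite h //|]; ring.
Qed.

Definition cell_boundary (H V : nat -> nat -> Cx) (k l : nat) : Cx :=
  H k l + V k.+1 l - H k l.+1 - V k l.

(** An edge between two cells with the same mark cancels or does not occur. Edge values may
    therefore be altered at will, provided they agree where the mark changes. This is used to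
    replace integrals by differences of a primitive, and to discard edges that meet a compact
    set. *)
Lemma grid_sum (T : nat) (chi : nat -> nat -> bool) (H V H' V' : nat -> nat -> Cx) :
  (forall k l, [|| k == 0, l == 0, T <= k | T <= l]%N -> chi k l = false) ->
  (forall k l, chi k l != chi k l.+1 -> H k l.+1 = H' k l.+1) ->
  (forall k l, chi k l != chi k.+1 l -> V k.+1 l = V' k.+1 l) ->
  \sum_(k < T) \sum_(l < T) (if chi k l then cell_boundary H V k l else 0) =
  \sum_(k < T) \sum_(l < T) (if chi k l then cell_boundary H' V' k l else 0).
Proof.
move=> c0 hH hV; apply/eqP; rewrite -subr_eq0 -sumrB; apply/eqP.
under eq_bigr => k _ do rewrite -sumrB.
(* Horizontal edges telescope in l for fixed k, vertical ones in k for fixed l. *)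
transitivity (\sum_(k < T) \sum_(l < T) (if chi k l then (H k l - H' k l) - (H k l.+1 - H' k l.+1) else 0)
  - \sum_(k < T) \sum_(l < T) (if chi k l then (V k l - V' k l) - (V k.+1 l - V' k.+1 l) else 0)).
  rewrite -sumrB; apply: eq_bigr => k _; rewrite -sumrB; apply: eq_bigr => l _.
  by case: (chi k l); rewrite /cell_boundary /=; ring.
rewrite [X in _ - X]exchange_big /=.
rewrite [X in X - _]big1 ?[X in _ - X]big1 ?subrr // => [l _|k _].
  rewrite (@telescope_switch T (fun k => chi k l) (fun k => V k l - V' k l)).
  - by rewrite c0 ?leqnn ?orbT // oppr0.
  - by rewrite c0.
  - by move=> k /hV ->; rewrite subrr.
rewrite (@telescope_switch T (chi k) (fun l => H k l - H' k l)).
- by rewrite c0 ?leqnn ?orbT // oppr0.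
- by rewrite c0 ?orbT.
- by move=> l /hH ->; rewrite subrr.
Qed.

Lemma sum2_single (T k0 l0 : nat) (F : nat -> nat -> Cx) : (k0 < T)%N -> (l0 < T)%N ->
  (forall k l, (k, l) != (k0, l0) -> F k l = 0) ->
  \sum_(k < T) \sum_(l < T) F k l = F k0 l0.
Proof.
move=> hk hl F0; rewrite (bigD1 (Ordinal hk)) //= (bigD1 (Ordinal hl)) //=.
rewrite big1 => [|l ll]; last by apply: F0; rewrite xpair_eqE negb_and; apply/orP; right.
rewrite big1 ?addr0 // => k kk; apply: big1 => l _.
by apply: F0; rewrite xpair_eqE negb_and; apply/orP; left.
Qed.

Section grid.
Variables (x0 y0 s : R) (T : nat) (A : set C).
Hypotheses (s0 : 0 < s)
  (hA : forall z, A z -> x0 + s < Re z < x0 + T%:R * s /\ y0 + s < Im z < y0 + T%:R * s).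

Definition gx (k : nat) : R := x0 + k%:R * s.
Definition gy (k : nat) : R := y0 + k%:R * s.
Definition gQ (k l : nat) : set C := rect (gx k) (gx k.+1) (gy l) (gy l.+1).
Definition gchi (k l : nat) : bool := `[< exists2 z, A z & gQ k l z >].
Definition gH (f : Cx -> Cx) (k l : nat) : Cx := hseg_int f (gy l) (gx k) (gx k.+1).
Definition gV (f : Cx -> Cx) (k l : nat) : Cx := vseg_int f (gx k) (gy l) (gy l.+1).

Lemma gxS k : gx k.+1 = gx k + s.
Proof. by rewrite /gx -natr1; ring. Qed.
Lemma gyS k : gy k.+1 = gy k + s.
Proof. by rewrite /gy -natr1; ring. Qed.
Lemma gx_le k : gx k <= gx k.+1.
Proof. by have h := s0; rewrite gxS; lra. Qed.
Lemma gy_le k : gy k <= gy k.+1.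
Proof. by have h := s0; rewrite gyS; lra. Qed.
Lemma gx_mono k l : (k <= l)%N -> gx k <= gx l.
Proof. by move=> kl; rewrite /gx lerD2l ler_wpM2r ?ler_nat // ltW. Qed.
Lemma gy_mono k l : (k <= l)%N -> gy k <= gy l.
Proof. by move=> kl; rewrite /gy lerD2l ler_wpM2r ?ler_nat // ltW. Qed.

Lemma gbdE f k l : cell_boundary (gH f) (gV f) k l = rect_int f (gx k) (gx k.+1) (gy l) (gy l.+1).
Proof. by []. Qed.

Lemma gchi_border k l : [|| k == 0, l == 0, T <= k | T <= l]%N -> gchi k l = false.
Proof.
move=> h; apply/asboolP => -[z /hA[/andP[z1 z2] /andP[z3 z4]] /andP[/andP[q1 q2] /andP[q3 q4]]].
case/or4P: h => [/eqP e|/eqP e|h|h].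
- by move: q2; rewrite e gxS /gx mul0r addr0; lra.
- by move: q4; rewrite e gyS /gy mul0r addr0; lra.
- by have := gx_mono _ _ h; rewrite {1}/gx; lra.
- by have := gy_mono _ _ h; rewrite {1}/gy; lra.
Qed.

Lemma gchi_lt k l : gchi k l -> (k < T)%N /\ (l < T)%N.
Proof.
move=> h; split; rewrite ltnNge; apply/negP => h'; move: h; rewrite gchi_border //.
  by rewrite h' !orbT.
by rewrite h' !orbT.
Qed.

Lemma gQ_cmod k l z w : gQ k l z -> gQ k l w -> cmod (w - z) <= 2 * s.
Proof.
move=> /andP[/andP[q1 q2] /andP[q3 q4]] /andP[/andP[q5 q6] /andP[q7 q8]].
move: q2 q6 q4 q8; rewrite gxS gyS => *.
apply: le_trans (cmod_ReIm _) _; rewrite ReB ImB.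
suff : `|Re w - Re z| <= s /\ `|Im w - Im z| <= s by case; lra.
by rewrite !ler_norml; split; apply/andP; split; lra.
Qed.

Lemma gQ_sub (W : set C) r : (forall z, A z -> disc z r `<=` W) -> 2 * s < r ->
  forall k l, gchi k l -> gQ k l `<=` W.
Proof.
move=> hW sr k l /asboolP[z Az Qz] w Qw; apply: (hW z Az).
by rewrite /disc /=; have := gQ_cmod _ _ _ _ Qz Qw; lra.
Qed.

Definition hedge (k l : nat) : set C := hseg (gy l) (gx k) (gx k.+1).
Definition vedge (k l : nat) : set C := vseg (gx k) (gy l) (gy l.+1).

(** Cells are closed, so a point of A on an edge marks the cells on both sides. An edge where the
    mark changes thus misses A, though it lies in a marked cell. *)
Lemma hedge_switch k l : gchi k l != gchi k l.+1 ->
  (forall z, hedge k l.+1 z -> ~ A z) /\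
  exists l', gchi k l' /\ hedge k l.+1 `<=` gQ k l'.
Proof.
have e1 : hedge k l.+1 `<=` gQ k l.
  by move=> z [z1 /andP[z2 z3]]; apply/andP; split; apply/andP; split; rewrite ?z1 // ?gy_le.
have e2 : hedge k l.+1 `<=` gQ k l.+1.
  by move=> z [z1 /andP[z2 z3]]; apply/andP; split; apply/andP; split; rewrite ?z1 // ?gy_le.
move=> h; split.
  move=> z hz Az; move: h; suff [-> ->] : gchi k l /\ gchi k l.+1 by [].
  by split; apply/asboolP; exists z => //; [exact: e1|exact: e2].
case E : (gchi k l) h => h; first by exists l; rewrite E.
by exists l.+1; split => //; move: h; case: gchi.
Qed.

Lemma vedge_switch k l : gchi k l != gchi k.+1 l ->
  (forall z, vedge k.+1 l z -> ~ A z) /\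
  exists k', gchi k' l /\ vedge k.+1 l `<=` gQ k' l.
Proof.
have e1 : vedge k.+1 l `<=` gQ k l.
  by move=> z [z1 /andP[z2 z3]]; apply/andP; split; apply/andP; split; rewrite ?z1 // ?gx_le.
have e2 : vedge k.+1 l `<=` gQ k.+1 l.
  by move=> z [z1 /andP[z2 z3]]; apply/andP; split; apply/andP; split; rewrite ?z1 // ?gx_le.
move=> h; split.
  move=> z hz Az; move: h; suff [-> ->] : gchi k l /\ gchi k.+1 l by [].
  by split; apply/asboolP; exists z => //; [exact: e1|exact: e2].
case E : (gchi k l) h => h; first by exists k; rewrite E.
by exists k.+1; split => //; move: h; case: gchi.
Qed.

Lemma gQ_interior k l k' l' z : gx k < Re z < gx k.+1 -> gy l < Im z < gy l.+1 ->
  gQ k' l' z -> (k', l') = (k, l).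
Proof.
move=> /andP[z1 z2] /andP[z3 z4] /andP[/andP[q1 q2] /andP[q3 q4]].
congr pair; apply/eqP; rewrite eqn_leq; apply/andP; split; rewrite leqNgt; apply/negP => h.
- by have := gx_mono _ _ h; lra.
- by have := gx_mono _ _ h; lra.
- by have := gy_mono _ _ h; lra.
- by have := gy_mono _ _ h; lra.
Qed.

Lemma grid_single f k0 l0 : gchi k0 l0 ->
  (forall k l z, gchi k l -> (k, l) != (k0, l0) -> gQ k l z -> exists D, cder f z D) ->
  \sum_(k < T) \sum_(l < T) (if gchi k l then cell_boundary (gH f) (gV f) k l else 0) =
  rect_int f (gx k0) (gx k0.+1) (gy l0) (gy l0.+1).
Proof.
move=> c0 hf; have [k0T l0T] := gchi_lt _ _ c0.
rewrite (@sum2_single T k0 l0 (fun k l => if gchi k l then cell_boundary (gH f) (gV f) k l else 0)) //.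
  by rewrite c0 gbdE.
move=> k l kl; case: ifP => // ckl; rewrite gbdE; apply: Goursat; rewrite ?gx_le ?gy_le //.
by move=> z; exact: hf.
Qed.

End grid.

(** The grid is anchored at [a], the centre of the cell (N, N), so that a pole at [a] is off all
    edges; n is large enough for A to keep away from the outermost cells. *)
Lemma grid_exists (A : set C) (m s : R) (a : Cx) : 0 < s -> (forall z, A z -> cmod z <= m) ->
  exists x0 y0 : R, exists T N : nat,
   [/\ forall z, A z -> x0 + s < Re z < x0 + T%:R * s /\ y0 + s < Im z < y0 + T%:R * s,
       (N < T)%N, Re a = x0 + N%:R * s + s / 2 & Im a = y0 + N%:R * s + s / 2].
Proof.
move=> s0 Am; have [n hn] : exists n : nat, (m + cmod a + 2 * s) / s < n%:R.
  by exists (Num.trunc ((m + cmod a + 2 * s) / s)).+1; exact: truncnS_gt.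
rewrite ltr_pdivrMr // in hn.
exists (Re a - s / 2 - n%:R * s), (Im a - s / 2 - n%:R * s), (n + n).+2, n; split;
  [|by rewrite ltnS leqW // leq_addr|by ring|by ring].
move=> z /Am zm; have := normRe z; have := normIm z; have := normRe a; have := normIm a.
rewrite !ler_norml => /andP[? ?] /andP[? ?] /andP[? ?] /andP[? ?].
have -> : (n + n).+2%:R = n%:R + n%:R + 2 :> R by rewrite -addn2 !natrD.
by rewrite !mulrDl; split; apply/andP; split; lra.
Qed.

(* If 1/(z-a) - kappa had a primitive near the boundary of V, then the integral of its derivative
   along a grid contour of V around a would be both 0 and 2 i pi. *)
Lemma no_log_around (V M W : set C) (m : R) (a : Cx) (kappa lam : Cx -> Cx) :
  open V -> (forall z, V z -> cmod z <= m) ->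
  (forall z, ~ V z -> ~ M z -> exists2 r : R, 0 < r & forall w, disc z r w -> ~ V w) ->
  V a -> hol V kappa -> open W -> M `<=` W -> ~ W a ->
  (forall z, W z -> cder lam z ((z - a)^-1 - kappa z)) -> False.
Proof.
move=> oV Vm bV Va hk oW MW nWa hlam.
(* Q is closed although V is open, because the boundary points of V lie in M and hence in the open
   set W. *)
pose Q := V `&` ~` W.
have cQ : compact Q.
  apply: (@compact_HB _ m); last by move=> z [/Vm].
  apply: closed_discP => z /not_andP[nVz|/contrapT Wz]; last first.
    by have [r r0 hr] := proj1 (open_discP _) oW z Wz; exists r => // w /hr Ww [].
  have [/MW Wz|nMz] := pselect (M z).
    by have [r r0 hr] := proj1 (open_discP _) oW z Wz; exists r => // w /hr Ww [].
  by have [r r0 hr] := bV z nVz nMz; exists r => // w /hr nVw [].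
have QV : Q `<=` V by move=> z [].
have [r r0 hr] := compact_disc_sub Q V cQ oV QV.
pose s := r / 3; have s0 : 0 < s by rewrite /s; lra.
have sr : 2 * s < r by rewrite /s; lra.
clearbody s.
have [x0 [y0 [T [N [hA NT aR aI]]]]] := grid_exists Q m s a s0 (fun z Qz => Vm z (QV z Qz)).
have chiV := gQ_sub x0 y0 s Q V r hr sr.
set chi := gchi x0 y0 s Q in chiV.
have gxN : gx x0 s N = Re a - s / 2 by rewrite /gx aR; ring.
have gyN : gy y0 s N = Im a - s / 2 by rewrite /gy aI; ring.
have gxN1 : gx x0 s N.+1 = Re a + s / 2 by rewrite gxS gxN; lra.
have gyN1 : gy y0 s N.+1 = Im a + s / 2 by rewrite gyS gyN; lra.
have aN : gQ x0 y0 s N N a by rewrite /gQ /rect /= gxN gyN gxN1 gyN1; apply/andP; split;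
  apply/andP; split; lra.
have cN : chi N N by apply/asboolP; exists a.
pose f z := (z - a)^-1 - kappa z.
have hf k l z : chi k l -> gQ x0 y0 s k l z -> z != a -> exists D, cder f z D.
  move=> ckl qz za; have [D dD] := hk z (chiV k l ckl z qz).
  have za0 : z - a != 0 by rewrite subr_eq0.
  eexists; apply: cderB dD; apply: (cderV (fun w => w - a) _ _ za0).
  exact: cderB (cder_id z) (cder_cst a z).
(* Marked cells lie in V, where f is holomorphic except at a; only the cell around a contributes. *)
have S1 : \sum_(k < T) \sum_(l < T) (if chi k l then cell_boundary (gH x0 y0 s f) (gV x0 y0 s f) k
  l else 0) = tau.
  rewrite (grid_single x0 y0 s T Q s0 hA f N N cN); last first.
    move=> k l z ckl kl qz; apply: (hf k l) => //.
    apply: contraNneq kl => za; rewrite za in qz; apply/eqP.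
    apply: (gQ_interior x0 y0 s s0 N N k l a) => //; rewrite ?gxN ?gxN1 ?gyN ?gyN1; apply/andP; split; lra.
  rewrite gxN gyN gxN1 gyN1 -/(square_int f a (s / 2)).
  have s20 : 0 < s / 2 by lra.
  have sqV : square a (s / 2) `<=` V.
    by move=> z; rewrite /square -gxN -gyN -gxN1 -gyN1; exact: chiV cN z.
  have ck : conton (sqframe a (s / 2)) kappa by move=> z /sqframe_square /sqV; exact: hol_cont.
  rewrite (intfunB _ _ _ (intfun_sI a (s / 2) (ltW s20))) //; last first.
    apply: conton_cauchy => z /(sqframe_cmod _ _ _ (ltW s20)) hz.
    by rewrite -subr_eq0 -cmod_gt0; apply: lt_le_trans hz.
  rewrite square_int_pole // [X in _ - X](_ : _ = 0) ?subr0 //.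
  by apply: Goursat; [lra|lra|move=> z /sqV /hk].
have lamQ k l z : chi k l -> gQ x0 y0 s k l z -> ~ Q z -> ccont f z /\ cder lam z (f z).
  move=> ckl qz nQz; have Wz : W z.
    by apply: contrapT => nWz; apply: nQz; split => //; exact: chiV ckl z qz.
  have za : z != a by apply/eqP => za; apply: nWa; rewrite -za.
  split; last exact: hlam.
  by have [D /cder_cont] := hf k l z ckl qz za.
pose H' (k l : nat) := lam (Complex (gx x0 s k.+1) (gy y0 s l)) - lam (Complex (gx x0 s k) (gy y0 s l)).
pose V' (k l : nat) := lam (Complex (gx x0 s k) (gy y0 s l.+1)) - lam (Complex (gx x0 s k) (gy y0 s l)).
(* Edges where the mark changes lie in V and miss Q, so they lie in W, where f is the derivative of
   [lam]. After replacing integrals by differences of [lam], the boundary sum of every single cell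
   is 0. *)
have S2 := grid_sum T chi (gH x0 y0 s f) (gV x0 y0 s f) H' V' (gchi_border x0 y0 s T Q s0 hA).
have : tau = 0; last by apply/eqP; exact: tau_neq0.
rewrite -S1 S2.
- apply: big1 => k _; apply: big1 => l _; case: ifP => // _.
  by rewrite /cell_boundary /H' /V'; ring.
- move=> k l /(hedge_switch x0 y0 s Q s0 k l)[nQ [l' [ckl sub]]].
  have E x : gx x0 s k <= x <= gx x0 s k.+1 -> hedge x0 y0 s k l.+1 (Complex x (gy y0 s l.+1)) by
    move=> hx; split.
  rewrite /gH (hI_FTC lam) ?gx_le // => x /E hx.
    by have [] := lamQ k l' _ ckl (sub _ hx) (nQ _ hx).
  by have [] := lamQ k l' _ ckl (sub _ hx) (nQ _ hx).
- move=> k l /(vedge_switch x0 y0 s Q s0 k l)[nQ [k' [ckl sub]]].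
  have E y : gy y0 s l <= y <= gy y0 s l.+1 -> vedge x0 y0 s k.+1 l (Complex (gx x0 s k.+1) y) by
    move=> hx; split.
  rewrite /gV (vI_FTC lam) ?gy_le // => y /E hy.
    by have [] := lamQ k' l _ ckl (sub _ hy) (nQ _ hy).
  by have [] := lamQ k' l _ ckl (sub _ hy) (nQ _ hy).
Qed.

(** * Runge's theorem *)

Definition appr (P : (Cx -> Cx) -> Prop) (A : set C) (g : Cx -> Cx) :=
  forall e : R, 0 < e -> exists2 q, P q & forall z, A z -> cmod (q z - g z) <= e.

(** A unital algebra of functions. The two instances are the polynomials and the functions
    holomorphic on Omega. *)
Definition lin_closed (P : (Cx -> Cx) -> Prop) :=
  [/\ forall c, P (fun=> c), forall f g, P f -> P g -> P (fun z => f z + g z)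
    & forall f g, P f -> P g -> P (fun z => f z * g z)].

Section appr.
Variables (P : (Cx -> Cx) -> Prop) (A : set C).
Hypothesis lP : lin_closed P.

Lemma appr_in f : P f -> appr P A f.
Proof. by move=> Pf e e0; exists f => // z _; rewrite subrr cmod0 ltW. Qed.

Lemma appr_cst c : appr P A (fun=> c).
Proof. by apply: appr_in; case: lP. Qed.

Lemma appr_ext f g : (forall z, A z -> f z = g z) -> appr P A f -> appr P A g.
Proof. by move=> fg hf e /hf[q Pq hq]; exists q => // z Az; rewrite -fg // hq. Qed.

Lemma appr_lim g : (forall e : R, 0 < e -> exists2 q, appr P A q &
   forall z, A z -> cmod (q z - g z) <= e) -> appr P A g.
Proof.
move=> h e e0; have e20 : 0 < e / 2 by lra.
have [q /(_ _ e20)[p Pp hp] hq] := h _ e20.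
exists p => // z Az; have := cmod_tri (q z) (p z) (g z); have := hp z Az; have := hq z Az; lra.
Qed.

Lemma apprD f g : appr P A f -> appr P A g -> appr P A (fun z => f z + g z).
Proof.
move=> hf hg e e0; have e20 : 0 < e / 2 by lra.
have [p Pp hp] := hf _ e20; have [q Pq hq] := hg _ e20; have [_ PD _] := lP.
exists (fun z => p z + q z); first exact: PD.
move=> z Az; rewrite (_ : _ - _ = (p z - f z) + (q z - g z)); last by ring.
have := cmodD (p z - f z) (q z - g z); have := hp z Az; have := hq z Az; lra.
Qed.

Lemma apprM f g (m n : R) : (forall z, A z -> cmod (f z) <= m) -> (forall z, A z -> cmod (g z) <= n) ->
  appr P A f -> appr P A g -> appr P A (fun z => f z * g z).
Proof.
move=> fm gn hf hg e e0; have [_ _ PM] := lP.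
have m1 : 0 < `|m| + 1 by have := normr_ge0 m; lra.
have n1 : 0 < `|n| + 1 by have := normr_ge0 n; lra.
pose d := Num.min 1 (e / (`|m| + 1 + (`|n| + 1))).
have mn : 0 < `|m| + 1 + (`|n| + 1) by lra.
have d0 : 0 < d by rewrite lt_min ltr01 divr_gt0.
have d1 : d <= 1 by rewrite /d ge_min lexx.
have d2 : d * (`|m| + 1 + (`|n| + 1)) <= e by rewrite -ler_pdivlMr // /d ge_min lexx orbT.
clearbody d.
have [p Pp hp] := hf _ d0; have [q Pq hq] := hg _ d0.
exists (fun z => p z * q z); first exact: PM.
move=> z Az; rewrite (_ : _ - _ = (p z - f z) * q z + f z * (q z - g z)); last by ring.
apply: le_trans (cmodD _ _) _; rewrite !cmodM.
have h1 := hp z Az; have h2 := hq z Az; have h3 := fm z Az; have h4 := gn z Az.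
have q1 : cmod (q z) <= `|n| + 1.
  by have := cmod_leB (q z) (g z); have := ler_norm n; lra.
have f1 : cmod (f z) <= `|m| + 1 by have := ler_norm m; lra.
have := ler_pM (cmod_ge0 _) (cmod_ge0 _) h1 q1.
have := ler_pM (cmod_ge0 _) (cmod_ge0 _) f1 h2; nra.
Qed.

Lemma apprZ c f : appr P A f -> appr P A (fun z => c * f z).
Proof.
move=> hf e e0; have [P1 _ PM] := lP; have c0 := cmod_ge0 c.
have [|p Pp hp] := hf (e / (cmod c + 1)); first by rewrite divr_gt0 //; lra.
exists (fun z => c * p z); first exact: PM.
move=> z /hp h; rewrite -mulrBr cmodM.
apply: le_trans (ler_wpM2l c0 h) _; rewrite mulrA ler_pdivrMr; last by lra.
by nra.
Qed.

Lemma apprB f g : appr P A f -> appr P A g -> appr P A (fun z => f z - g z).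
Proof.
move=> hf /(apprZ (-1)) hg; have := apprD _ _ hf hg.
by apply: appr_ext => z _; rewrite mulN1r.
Qed.

Lemma appr_sum (T : nat) (F : nat -> Cx -> Cx) : (forall k, appr P A (F k)) ->
  appr P A (fun z => \sum_(k < T) F k z).
Proof.
move=> hF; elim: T => [|T IH].
  by apply: appr_ext (appr_cst 0) => z _; rewrite big_ord0.
by apply: appr_ext (apprD _ _ IH (hF T)) => z _; rewrite big_ord_recr.
Qed.

(** Uniform continuity is transferred from the degenerate rectangle [a, b] x {0} of the plane. *)
Lemma rcont_unif (g : R -> Cx) (a b : R) : (forall t, a <= t <= b -> rcont g t) ->
  forall e : R, 0 < e -> exists2 d : R, 0 < d &
    forall t u, a <= t <= b -> `|u - t| < d -> cmod (g u - g t) < e.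
Proof.
move=> cg e e0.
have [|d d0 hd] := compact_ucont (rect a b 0 0) (fun z => g (Re z)) (rect_compact a b 0 0) _ e e0.
  move=> z /andP[hz _] e' /(cg _ hz)[d d0 hd]; exists d => // w wz; apply: hd.
  by rewrite -ReB; apply: le_lt_trans wz; exact: normRe.
exists d => // t u ht ut; apply: (hd (Complex t 0) (Complex u 0)); last by rewrite cmod_h.
by rewrite /rect /= ht !lexx.
Qed.

Lemma rcontE (g : R -> Cx) t : rcont g t <-> ccont (fun z => g (Re z)) (Complex t 0).
Proof.
split=> cg e /cg[d d0 hd]; exists d => // w wt.
  by apply: hd; apply: le_lt_trans wt; rewrite -[t]/(Re (Complex t 0)) -ReB; exact: normRe.
by apply: (hd (Complex w 0)); rewrite cmod_h.
Qed.

(** Riemann sums of the integral are combinations of the kernels 1/(gam t - z), and they converge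
    uniformly in z because z stays at distance at least d from the path. *)
Lemma appr_cI (g gam : R -> Cx) (a b d : R) : a <= b -> 0 < d ->
  (forall t, a <= t <= b -> rcont g t) -> (forall t, a <= t <= b -> rcont gam t) ->
  (forall t z, a <= t <= b -> A z -> d <= cmod (gam t - z)) ->
  (forall t, a <= t <= b -> appr P A (fun z => (gam t - z)^-1)) ->
  appr P A (fun z => cint (fun t => g t / (gam t - z)) a b).
Proof.
move=> ab d0 cg cgam far hP; apply: appr_lim => e e0.
have [m m0 gm] : exists2 m : R, 0 < m & forall t, a <= t <= b -> cmod (g t) <= m.
  have [|m m0 hm] := compact_ccont_bounded (rect a b 0 0) (fun z => g (Re z)) (rect_compact a b 0 0).
    move=> z /andP[hz _] e' /(cg _ hz)[r r0 hd]; exists r => // w wz; apply: hd.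
    by rewrite -ReB; apply: le_lt_trans wz; exact: normRe.
  by exists m => // t ht; apply: (hm (Complex t 0)); rewrite /rect /= ht !lexx.
pose e1 := e / (2 * (b - a + 1)).
have ba : 0 < 2 * (b - a + 1) by lra.
have e10 : 0 < e1 by rewrite divr_gt0.
have e1E : e1 * (2 * (b - a + 1)) = e by rewrite divfK // gt_eqF.
clearbody e1.
(* The variations of g and of gam each change g/(gam - z) by at most e1/2, given the bounds m for g
   and 1/d for the kernel. *)
have [r1 r10 hr1] := rcont_unif g a b cg (e1 * d / 2) ltac:(by rewrite divr_gt0 // mulr_gt0).
have [r2 r20 hr2] := rcont_unif gam a b cgam (e1 * d ^+ 2 / (2 * m))
  ltac:(by rewrite divr_gt0 ?mulr_gt0 // exprn_gt0).
pose f z t := g t / (gam t - z).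
have nz z t : A z -> a <= t <= b -> gam t - z != 0.
  by move=> Az ht; rewrite -cmod_gt0; apply: lt_le_trans (far t z ht Az).
have kc z t : A z -> a <= t <= b -> rcont (f z) t.
  move=> Az ht; apply/rcontE; apply: ccontM; first exact/rcontE/cg.
  apply: ccontV; first exact: nz.
  by apply: ccontB; [exact/rcontE/cgam|exact: ccont_cst].
pose rho := Num.min r1 r2 / 2.
have rho0 : 0 < rho by rewrite divr_gt0 // lt_min r10.
have rho1 : rho < r1.
  by apply: (@lt_le_trans _ _ (Num.min r1 r2)); [rewrite /rho;
    have : 0 < Num.min r1 r2 by [rewrite lt_min r10]; move: (Num.min r1 r2) => x ?; lra|rewrite ge_min lexx].
have rho2 : rho < r2.
  by apply: (@lt_le_trans _ _ (Num.min r1 r2)); [rewrite /rho;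
    have : 0 < Num.min r1 r2 by [rewrite lt_min r10]; move: (Num.min r1 r2) => x ?;
      lra|rewrite ge_min lexx orbT].
clearbody rho.
have osc z t u : A z -> a <= t <= b -> a <= u <= b -> `|u - t| <= rho -> cmod (f z u - f z t) <= e1.
  move=> Az ht hu ut; have nt := nz z t Az ht; have nu := nz z u Az hu.
  rewrite (_ : _ - _ = (g u - g t) * (gam u - z)^-1 + g t * (- (gam u - gam t)) * ((gam u - z)^-1 *
    (gam t - z)^-1)); last first.
    by rewrite /f; field; rewrite nt nu.
  apply: le_trans (cmodD _ _) _; rewrite !cmodM !cmodV cmodN.
  have iu : (cmod (gam u - z))^-1 <= d^-1 by rewrite lef_pV2 ?posrE ?cmod_gt0 //; exact: far.
  have it : (cmod (gam t - z))^-1 <= d^-1 by rewrite lef_pV2 ?posrE ?cmod_gt0 //; exact: far.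
  have h1 := ltW (hr1 t u ht (le_lt_trans ut rho1)).
  have h2 := ltW (hr2 t u ht (le_lt_trans ut rho2)).
  have g0 x : 0 <= (cmod x)^-1 by rewrite invr_ge0 cmod_ge0.
  have k1 := ler_pM (cmod_ge0 _) (g0 _) h1 iu.
  have k2 := ler_pM (mulr_ge0 (cmod_ge0 _) (cmod_ge0 _)) (mulr_ge0 (g0 _) (g0 _))
    (ler_pM (cmod_ge0 _) (cmod_ge0 _) (gm t ht) h2) (ler_pM (g0 _) (g0 _) iu it).
  apply: le_trans (lerD k1 k2) _; rewrite le_eqVlt; apply/orP; left; apply/eqP; field.
  by rewrite !gt_eqF.
have exf z x y : A z -> a <= x -> x <= y -> y <= b -> cintegrable (f z) x y.
  move=> Az ax xy yb; apply: cex_le => // t /andP[xt ty]; apply: kc => //.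
  by apply/andP; split; lra.
have chunk x y : a <= x -> x <= y -> y <= b -> y - x <= rho ->
   exists2 q, appr P A q & forall z, A z -> cmod (q z - cint (f z) x y) <= 2 * e1 * (y - x).
  move=> ax xy yb yx; have hx : a <= x <= b by apply/andP; split; lra.
  exists (fun z => ((y - x)%:C%C * g x) * (gam x - z)^-1); first by apply: apprZ; exact: hP.
  move=> z Az; rewrite cmodB (_ : _ - _ = cint (fun t => f z t - f z x) x y).
    have cx : cintegrable (fun t => f z t - f z x) x y.
      have := cex_lin 1 (f z) (fun=> - f z x) x y (exf z x y Az ax xy yb) (cex_const _ _ _).
      by rewrite (_ : (fun t => 1 * f z t + - f z x) = (fun t => f z t - f z x)) //;
        apply/funext => t; rewrite mul1r.
    apply: cI_bound => // t /andP[xt ty]; apply: osc => //; first by apply/andP; split; lra.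
    by rewrite ler_norml; apply/andP; split; lra.
  have := cI_lin 1 (f z) (fun=> - f z x) x y (exf z x y Az ax xy yb) (cex_const _ _ _).
  rewrite (_ : (fun t => 1 * f z t + - f z x) = (fun t => f z t - f z x));
    last by apply/funext => t; rewrite mul1r.
  by move=> ->; rewrite cI_const /f; ring.
(* Induction on the number of pieces of length at most [rho]; the error is proportional to the
   length and hence adds up. *)
have main n x y : a <= x -> x <= y -> y <= b -> y - x <= n%:R * rho ->
   exists2 q, appr P A q & forall z, A z -> cmod (q z - cint (f z) x y) <= 2 * e1 * (y - x).
  elim: n x y => [|n IH] x y ax xy yb.
    by rewrite mul0r => yx; apply: chunk => //; lra.
  rewrite -natr1 mulrDl mul1r => yx; have [sm|bg] := leP (y - x) rho; first exact: chunk.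
  have [||||q1 a1 h1] := chunk x (x + rho); [lra|lra|lra|lra|].
  have [||||q2 a2 h2] := IH (x + rho) y; [lra|lra|lra|lra|].
  exists (fun z => q1 z + q2 z); first exact: apprD.
  move=> z Az; rewrite -(cI_chasles (f z) (x + rho) x y); last 2 first.
  - by apply: exf => //; lra.
  - by apply: exf => //; lra.
  rewrite (_ : _ - _ = (q1 z - cint (f z) x (x + rho)) + (q2 z - cint (f z) (x + rho) y)); last by ring.
  apply: le_trans (cmodD _ _) _; have := h1 z Az; have := h2 z Az; lra.
have [n hn] : exists n : nat, (b - a) / rho < n%:R.
  by exists (Num.trunc ((b - a) / rho)).+1; exact: truncnS_gt.
have [||||q aq hq] := main n a b => //.
  by rewrite -ler_pdivrMr // ltW.
exists q => // z /hq h; apply: le_trans h _; nra.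
Qed.

End appr.

Lemma ccont_sum (T : nat) (F : nat -> Cx -> Cx) z : (forall k, ccont (F k) z) ->
  ccont (fun w => \sum_(k < T) F k w) z.
Proof.
move=> cF; elim: T => [|T IH].
  rewrite (_ : (fun _ => _) = (fun=> 0)); first exact: ccont_cst.
  by apply/funext => w; rewrite big_ord0.
rewrite (_ : (fun _ => _) = (fun w => \sum_(k < T) F k w + F T w)); first exact: ccontD.
by apply/funext => w; rewrite big_ord_recr.
Qed.

Lemma compact_dist (K A : set C) : compact K -> compact A -> (forall z, K z -> ~ A z) ->
  exists2 d : R, 0 < d & forall z w, K z -> A w -> d <= cmod (z - w).
Proof.
move=> cK cA KA; have oA : open (~` A).
  by rewrite openC; apply: compact_closed => //; exact: norm_hausdorff.
have [d d0 hd] := compact_disc_sub K _ cK oA KA.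
exists d => // z w Kz Aw; rewrite leNgt; apply/negP => zw; apply: (hd z Kz w) Aw.
by rewrite /disc /= cmodB.
Qed.

Lemma hseg_compact y a b : compact (hseg y a b).
Proof.
rewrite (_ : hseg y a b = rect a b y y); first exact: rect_compact.
apply/seteqP; split=> z; first by move=> [h1 h2]; rewrite /rect /= h2 h1 lexx.
by move=> /andP[h1 /andP[h2 h3]]; split=> //; apply/eqP; rewrite eq_le h2 h3.
Qed.

Lemma vseg_compact x c d : compact (vseg x c d).
Proof.
rewrite (_ : vseg x c d = rect x x c d); first exact: rect_compact.
apply/seteqP; split=> z; first by move=> [h1 h2]; rewrite /rect /= h2 h1 lexx.
by move=> /andP[/andP[h2 h3] h1]; split=> //; apply/eqP; rewrite eq_le h2 h3.
Qed.

Lemma intfun_Cauchy_cont L S p f A z : intfun L S p -> compact S -> conton S f ->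
  compact A -> (forall v, S v -> ~ A v) -> A z -> ccont (fun w => L (fun v => f v / (v - w))) z.
Proof.
move=> hL cS cf cA SA Az; have [d d0 hd] := compact_dist S A cS cA SA.
have [m _ hm] := compact_ccont_bounded S f cS cf.
have [|D /cder_cont //] := intfun_kernel_cder L S p f id z d m hL cf _ d0 (fun v Sv => hd v z Sv Az) hm.
by move=> v _; exact: ccont_id.
Qed.

(** Cauchy's formula on a fine grid writes f as a sum of Cauchy integrals over edges that miss A;
    each is approximable by Riemann sums of kernels with poles off A. *)
Lemma Runge (P : (Cx -> Cx) -> Prop) (A W : set C) f : lin_closed P -> compact A -> open W -> A `<=` W ->
  hol W f -> (forall v, ~ A v -> appr P A (fun z => (z - v)^-1)) -> appr P A f.
Proof.
move=> lP cA oW AW hf hpole.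
have hpole' v : ~ A v -> appr P A (fun z => (v - z)^-1).
  move=> nAv; apply: appr_ext (apprZ P A lP (-1) _ (hpole v nAv)) => z _.
  by rewrite mulN1r -invrN opprB.
have [r r0 hr] := compact_disc_sub A W cA oW AW.
have [m hm] := compact_bounded A cA.
pose s := r / 3; have s0 : 0 < s by rewrite /s; lra.
have sr : 2 * s < r by rewrite /s; lra.
clearbody s.
have [x0 [y0 [T [N [hA _ _ _]]]]] := grid_exists A m s 0 s0 hm.
have chiW := gQ_sub x0 y0 s A W r hr sr.
set chi := gchi x0 y0 s A in chiW.
(* Only edges in W that miss A are kept, the others count as 0, so that F is continuous and
   approximable on all of A. Edges where the mark changes are among those kept, so by [grid_sum] the
   total does not change. *)
pose goodh k l := `[< forall w, hedge x0 y0 s k l w -> ~ A w /\ W w >].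
pose goodv k l := `[< forall w, vedge x0 y0 s k l w -> ~ A w /\ W w >].
pose kern z v := f v / (v - z).
pose H' z k l := if goodh k l then gH x0 y0 s (kern z) k l else 0.
pose V' z k l := if goodv k l then gV x0 y0 s (kern z) k l else 0.
pose F z := \sum_(k < T) \sum_(l < T) (if chi k l then cell_boundary (H' z) (V' z) k l else 0).
have F1 z k0 l0 : chi k0 l0 -> gx x0 s k0 < Re z < gx x0 s k0.+1 ->
    gy y0 s l0 < Im z < gy y0 s l0.+1 -> F z = tau * f z.
  move=> c0 zx zy; rewrite /F.
  rewrite -(grid_sum T chi (gH x0 y0 s (kern z)) (gV x0 y0 s (kern z)) _ _ (gchi_border x0 y0 s T A s0 hA)).
  - rewrite (grid_single x0 y0 s T A s0 hA (kern z) k0 l0 c0); last first.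
      move=> k l v ckl kl qv.
      have vz : v - z != 0.
        rewrite subr_eq0; apply: contraNneq kl => vz; apply/eqP; rewrite vz in qv.
        exact: (gQ_interior x0 y0 s s0 _ _ _ _ z).
      have [D dD] := hf v (chiW k l ckl v qv).
      eexists; apply: cderM dD (cderV (fun v => v - z) _ _ vz (cderB _ _ _ _ _ (cder_id v) (cder_cst z v))).
    case/andP: zx => ? ?; case/andP: zy => ? ?.
    have Qz : gQ x0 y0 s k0 l0 z by apply/andP; split; apply/andP; split; exact: ltW.
    apply: Cauchy_formula => // [w qw _|]; first by apply: hf; exact: chiW qw.
    by apply: hol_cont hf _; exact: chiW Qz.
  - move=> k l /(hedge_switch x0 y0 s A s0 k l)[nA [l' [ckl sub]]].
    rewrite /H' /goodh asboolT // => w hw; split; first exact: nA.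
    by apply: chiW ckl _ _; exact: sub.
  - move=> k l /(vedge_switch x0 y0 s A s0 k l)[nA [k' [ckl sub]]].
    rewrite /V' /goodv asboolT // => w hw; split; first exact: nA.
    by apply: chiW ckl _ _; exact: sub.
have cF z : A z -> ccont F z.
  move=> Az.
  have cH k l : ccont (fun z => H' z k l) z.
    rewrite /H' /goodh; case: (asboolP (forall w, hedge x0 y0 s k l w -> ~ A w /\ W w)) =>
      [good|_]; last exact: ccont_cst.
    apply: (intfun_Cauchy_cont _ _ _ _ A z (intfun_hI _ _ _ (gx_le x0 s s0 k)) (hseg_compact _ _ _)) => //.
      by apply: (hol_conton W) => // v /good[].
    by move=> v /good[].
  have cV k l : ccont (fun z => V' z k l) z.
    rewrite /V' /goodv; case: (asboolP (forall w, vedge x0 y0 s k l w -> ~ A w /\ W w)) =>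
      [good|_]; last exact: ccont_cst.
    apply: (intfun_Cauchy_cont _ _ _ _ A z (intfun_vI _ _ _ (gy_le y0 s s0 l)) (vseg_compact _ _ _)) => //.
      by apply: (hol_conton W) => // v /good[].
    by move=> v /good[].
  rewrite /F; apply: (ccont_sum T (fun k w => \sum_(l < T) (if chi k l then cell_boundary (H' w)
    (V' w) k l else 0))) => k.
  apply: (ccont_sum T (fun l w => (if chi k l then cell_boundary (H' w) (V' w) k l else 0))) => l.
  case: (chi k l); last exact: ccont_cst.
  by rewrite /cell_boundary; apply: ccontB => //; apply: ccontB => //; exact: ccontD.
have idx (u0 u : R) : u0 + s < u -> exists k : nat, u0 + k%:R * s <= u < u0 + k.+1%:R * s.
  move=> hu; exists (Num.trunc ((u - u0) / s)).
  have h0 : 0 <= (u - u0) / s by rewrite divr_ge0 //; lra.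
  have /andP[h1 h2] := truncn_itv h0.
  move: h1 h2; rewrite ler_pdivlMr // ltr_pdivrMr // => h1 h2.
  by apply/andP; split; lra.
(* [F1] needs z in the interior of a marked cell. A point of A on a grid line is reached by
   continuity, moving from it towards the centre of a cell that contains it. *)
have F2 z : A z -> F z = tau * f z.
  move=> Az; apply: contrapT => /eqP; rewrite -subr_eq0 => ne.
  have cc : ccont (fun v => F v - tau * f v) z.
    apply: ccontB; first exact: cF.
    by apply: ccontM; [exact: ccont_cst|apply: hol_cont hf _; exact: AW].
  have [|d d0 hd] := cc (cmod (F z - tau * f z)); first by rewrite cmod_gt0.
  have [/andP[zx zx'] /andP[zy zy']] := hA z Az.
  have [k /andP[kx kx']] := idx _ _ zx; have [l /andP[ly ly']] := idx _ _ zy.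
  have kS : x0 + k.+1%:R * s = x0 + k%:R * s + s by rewrite -natr1; ring.
  have lS : y0 + l.+1%:R * s = y0 + l%:R * s + s by rewrite -natr1; ring.
  have ckl : chi k l.
    by apply/asboolP; exists z => //; apply/andP; split; apply/andP; split => //; exact: ltW.
  (* In each coordinate the centre is within s of z, so moving by the fraction t changes z by at
     most 2 s t. *)
  have [t t0 [t1 t2]] : exists2 t : R, 0 < t & t <= 1 /\ t * (2 * s) < d.
    exists (Num.min 1 (d / (3 * s))); first by rewrite lt_min ltr01 divr_gt0 // mulr_gt0.
    split; first by rewrite ge_min lexx.
    have : Num.min 1 (d / (3 * s)) <= d / (3 * s) by rewrite ge_min lexx orbT.
    move: (Num.min _ _) => q; rewrite ler_pdivlMr ?mulr_gt0 // => hq; nra.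
  pose u := x0 + k%:R * s; pose v := y0 + l%:R * s.
  pose w := Complex (Re z + t * (u + s / 2 - Re z)) (Im z + t * (v + s / 2 - Im z)).
  rewrite kS -/u in kx'; rewrite lS -/v in ly'; rewrite -/u in kx; rewrite -/v in ly.
  have kS' : gx x0 s k.+1 = u + s := kS; have lS' : gy y0 s l.+1 = v + s := lS.
  have k0' : gx x0 s k = u by []. have l0' : gy y0 s l = v by [].
  have Ew : F w = tau * f w.
    apply: (F1 w k l ckl); rewrite ?kS' ?lS' ?k0' ?l0'; clearbody u v; rewrite /w /=; apply/andP; split; nra.
  have wz : cmod (w - z) < d.
    apply: le_lt_trans t2; apply: le_trans (cmod_ReIm _) _; rewrite ReB ImB /w /=.
    rewrite [Re z + _]addrC addrK [Im z + _]addrC addrK !normrM (gtr0_norm t0) -mulrDr ler_wpM2l ?(ltW t0) //.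
    suff : `|u + s / 2 - Re z| <= s /\ `|v + s / 2 - Im z| <= s by case; lra.
    by clearbody u v; rewrite !ler_norml; split; apply/andP; split; lra.
  by have := hd w wz; rewrite Ew subrr sub0r cmodN ltxx.
have aF : appr P A F.
  have aH k l : appr P A (fun z => H' z k l).
    rewrite /H' /goodh; case: (asboolP (forall w, hedge x0 y0 s k l w -> ~ A w /\ W w)) =>
      [good|_]; last exact: appr_cst.
    have [|d d0 hd] := compact_dist (hedge x0 y0 s k l) A (hseg_compact _ _ _) cA.
      by move=> w /good[].
    have E t : gx x0 s k <= t <= gx x0 s k.+1 -> hedge x0 y0 s k l (Complex t (gy y0 s l)) by
      move=> ht; split.
    apply: (appr_cI P A lP (fun t => f (Complex t (gy y0 s l))) (fun t => Complex t (gy y0 s l)) _ _ d) => //.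
    - exact: gx_le.
    - by move=> t /E /good[_ Wt]; apply: ccont_h; exact: hol_cont hf Wt.
    - by move=> t _; apply: (ccont_h id); exact: ccont_id.
    - by move=> t z /E ht Az; apply: hd.
    - by move=> t /E /good[nA _]; exact: hpole'.
  have aV k l : appr P A (fun z => V' z k l).
    rewrite /V' /goodv; case: (asboolP (forall w, vedge x0 y0 s k l w -> ~ A w /\ W w)) =>
      [good|_]; last exact: appr_cst.
    have [|d d0 hd] := compact_dist (vedge x0 y0 s k l) A (vseg_compact _ _ _) cA.
      by move=> w /good[].
    have E t : gy y0 s l <= t <= gy y0 s l.+1 -> vedge x0 y0 s k l (Complex (gx x0 s k) t) by
      move=> ht; split.
    apply: apprZ => //.
    apply: (appr_cI P A lP (fun t => f (Complex (gx x0 s k) t)) (fun t => Complex (gx x0 s k) t) _ _ d) => //.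
    - exact: gy_le.
    - by move=> t /E /good[_ Wt]; apply: ccont_v; exact: hol_cont hf Wt.
    - by move=> t _; apply: (ccont_v id); exact: ccont_id.
    - by move=> t z /E ht Az; apply: hd.
    - by move=> t /E /good[nA _]; exact: hpole'.
  apply: (appr_sum P A lP T (fun k w => \sum_(l < T) (if chi k l then cell_boundary (H' w) (V' w) k
    l else 0))) => k.
  apply: (appr_sum P A lP T (fun l w => (if chi k l then cell_boundary (H' w) (V' w) k l else 0))) => l.
  case: (chi k l); last exact: appr_cst.
  by rewrite /cell_boundary; apply: apprB => //; apply: apprB => //; exact: apprD.
apply: appr_ext (apprZ P A lP tau^-1 _ aF) => z /F2 ->.
by rewrite mulKf // tau_neq0.
Qed.

(** * Pole pushing and logarithms *)

Lemma expr_small (rho e : R) : 0 <= rho -> rho < 1 -> 0 < e -> exists N : nat, rho ^+ N < e.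
Proof.
move=> r0 r1 e0.
have [|N hN] := Rfunctions.pow_lt_1_zero rho _ e (elimT RltP e0).
  by apply/RltP; rewrite RnormE ger0_norm.
exists N; have /RltP := hN N (le_n N).
by rewrite RnormE RpowE ger0_norm // exprn_ge0.
Qed.

(** Partial sums of the geometric series with ratio q stay in the algebra and converge uniformly on
    A. *)
Lemma appr_geom P A g q (m rho : R) : lin_closed P -> rho < 1 ->
  (forall z, A z -> cmod (g z) <= m) -> (forall z, A z -> cmod (q z) <= rho) ->
  appr P A g -> appr P A q -> appr P A (fun z => g z / (1 - q z)).
Proof.
move=> lP r1 gm qr ag aq.
(* A point of A is what forces [rho] and m to be nonnegative. *)
have [[z0 Az0]|nA] := pselect (exists z, A z); last first.
  move=> e e0; exists (fun=> 0); first by case: lP.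
  by move=> z Az; case: nA; exists z.
have r0 : 0 <= rho by apply: le_trans (qr z0 Az0); exact: cmod_ge0.
have m0 : 0 <= m by apply: le_trans (gm z0 Az0); exact: cmod_ge0.
have qk k z : A z -> cmod (q z ^+ k) <= rho ^+ k.
  by move=> Az; rewrite cmodX lerXn2r ?nnegrE ?cmod_ge0 // qr.
have qk1 k z : A z -> cmod (q z ^+ k) <= 1.
  by move=> Az; apply: le_trans (qk k z Az) _; apply: exprn_ile1 => //; exact: ltW.
have aqk k : appr P A (fun z => q z ^+ k).
  elim: k => [|k IH]; first by apply: appr_ext (appr_cst P A lP 1).
  by apply: appr_ext (apprM P A lP _ _ rho 1 qr (qk1 k) aq IH) => z _; rewrite exprS.
have as_ N : appr P A (fun z => \sum_(k < N) g z * q z ^+ k).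
  by apply: (appr_sum P A lP N (fun k z => g z * q z ^+ k)) => k; apply: apprM gm (qk1 k) ag (aqk k).
have geo N z : A z -> (1 - q z) * \sum_(k < N) g z * q z ^+ k = g z * (1 - q z ^+ N).
  move=> Az; elim: N => [|N IH]; first by rewrite big_ord0 expr0 subrr !mulr0.
  by rewrite big_ord_recr /= mulrDr IH exprS; ring.
have n1 z : A z -> 1 - rho <= cmod (1 - q z).
  by move=> Az; have := cmod_leB 1 (q z); rewrite cmod1; have := qr z Az; lra.
apply: (appr_lim P A) => e e0.
have [N hN] := expr_small rho (e * (1 - rho) / (m + 1)) r0 r1 ltac:(by rewrite divr_gt0 ?mulr_gt0 //; lra).
exists (fun z => \sum_(k < N) g z * q z ^+ k) => // z Az.
have c0 : 0 < cmod (1 - q z) by apply: lt_le_trans (n1 z Az); lra.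
have nz : 1 - q z != 0 by rewrite -cmod_gt0.
rewrite -(ler_pM2l c0) -cmodM mulrBr (geo N z Az) (_ : (1 - q z) * (g z / (1 - q z)) = g z); last by field.
rewrite mulrBr mulr1 addrAC subrr add0r cmodN cmodM.
apply: le_trans (ler_pM (cmod_ge0 _) (cmod_ge0 _) (gm z Az) (qk N z Az)) _.
have h1 := n1 z Az; have rN : 0 <= rho ^+ N by rewrite exprn_ge0.
move: hN; rewrite ltr_pdivlMr; last by lra.
move=> hN; apply: (@le_trans _ _ (e * (1 - rho))); nra.
Qed.

(** Geometric expansion of 1/(z-a) = -a^-1 / (1 - z/a). *)
Lemma appr_pole_far P A (a : Cx) (m : R) : lin_closed P -> P id ->
  (forall z, A z -> cmod z <= m) -> m < cmod a -> appr P A (fun z => (z - a)^-1).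
Proof.
move=> lP Pid Am ma.
have [[z0 Az0]|nA] := pselect (exists z, A z); last first.
  move=> e e0; exists (fun=> 0); first by case: lP.
  by move=> z Az; case: nA; exists z.
have m0 : 0 <= m by apply: le_trans (Am z0 Az0); exact: cmod_ge0.
have a0 : a != 0 by rewrite -cmod_gt0; apply: le_lt_trans ma.
have ca : 0 < cmod a by rewrite cmod_gt0.
have aq : appr P A (fun z => a^-1 * z) by apply: apprZ => //; exact: appr_in.
have := appr_geom P A (fun=> - a^-1) (fun z => a^-1 * z) (cmod (- a^-1)) (m / cmod a) lP.
rewrite ltr_pdivrMr // mul1r => /(_ ma (fun z _ => lexx _) _ (appr_cst P A lP _) aq) h.
apply: appr_ext (h _) => [z Az|z Az].
  have za : z - a != 0.
    rewrite subr_eq0; apply/eqP => za; have := Am z Az; rewrite za; lra.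
  by field; rewrite za a0 -opprB oppr_eq0 za.
by rewrite cmodM cmodV mulrC ler_wpM2r ?invr_ge0 ?cmod_ge0 // Am.
Qed.

(** Geometric expansion of 1/(z-a) = (z-b)^-1 / (1 - (a-b)/(z-b)). *)
Lemma appr_pole_step P A (a b : Cx) (m rho : R) : lin_closed P -> rho < 1 ->
  (forall z, A z -> z != b) -> (forall z, A z -> cmod (z - b)^-1 <= m) ->
  (forall z, A z -> cmod (a - b) <= rho * cmod (z - b)) ->
  appr P A (fun z => (z - b)^-1) -> appr P A (fun z => (z - a)^-1).
Proof.
move=> lP r1 zb zm zr ab.
have qr z : A z -> cmod ((a - b) * (z - b)^-1) <= rho.
  move=> Az; rewrite cmodM cmodV ler_pdivrMr ?zr //.
  by rewrite cmod_gt0 subr_eq0 zb.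
have h := appr_geom P A _ _ m rho lP r1 zm qr ab (apprZ P A lP (a - b) _ ab).
apply: appr_ext h => z Az.
have zb0 : z - b != 0 by rewrite subr_eq0 zb.
have q1 : cmod ((a - b) * (z - b)^-1) < 1 by apply: le_lt_trans (qr z Az) r1.
have za0 : z - a != 0.
  rewrite subr_eq0; apply/eqP => za; move: q1; rewrite -za mulfV // cmod1; lra.
rewrite -invfM; congr (_^-1); field; exact: zb0.
Qed.

Definition polyf (f : Cx -> Cx) : Prop := exists p : {poly Cx}, forall z, f z = p.[z].

Lemma polyf_lin : lin_closed polyf.
Proof.
split.
- by move=> c; exists c%:P => z; rewrite hornerC.
- by move=> f g [p hp] [q hq]; exists (p + q) => z; rewrite hornerD hp hq.
- by move=> f g [p hp] [q hq]; exists (p * q) => z; rewrite hornerM hp hq.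
Qed.

Lemma polyf_id : polyf id.
Proof. by exists 'X => z; rewrite hornerX. Qed.

Lemma appr_exh_far P G n a : lin_closed P -> P id -> n%:R < cmod a ->
  appr P (exh G n) (fun z => (z - a)^-1).
Proof. by move=> lP Pid na; apply: appr_pole_far na => // z []. Qed.

Lemma exh_far_neq G n b z : ~ G b -> exh G n z -> z != b.
Proof.
move=> nGb [_ /(_ b nGb) h]; apply/eqP => zb; move: h; rewrite zb subrr cmod0 mulr0; lra.
Qed.

Lemma appr_exh_step P G n a b : lin_closed P -> ~ G b -> n%:R * cmod (a - b) < 1 ->
  appr P (exh G n) (fun z => (z - b)^-1) -> appr P (exh G n) (fun z => (z - a)^-1).
Proof.
move=> lP nGb nab; apply: (appr_pole_step _ _ a b n%:R _ lP nab).
- by move=> z; exact: exh_far_neq.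
- move=> z hz; have zb := exh_far_neq _ _ _ _ nGb hz; case: hz => _ /(_ b nGb) h.
  by rewrite cmodV -[leLHS]mul1r ler_pdivrMr // cmod_gt0 subr_eq0.
- by move=> z [_ /(_ b nGb) h]; have := cmod_ge0 (a - b); nra.
Qed.

(** Every pole off the compact set is moved in small steps to one of modulus > n, where the kernel
    is a limit of polynomials in z. *)
Lemma polyf_Runge (G W : set C) n f : simply_connected G -> open W -> exh G n `<=` W -> hol W f ->
  appr polyf (exh G n) f.
Proof.
move=> scG oW GW hf; apply: (Runge polyf (exh G n) W f polyf_lin (exh_compact G n) oW GW hf).
apply: (simply_connected_ind G n _ scG).
  by move=> a na; exact: appr_exh_far polyf_lin polyf_id na.
by move=> a b nGb ab; exact: appr_exh_step polyf_lin nGb ab.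
Qed.

Definition has_prim (A : set C) (g : Cx -> Cx) := exists W : set C, exists lam : Cx -> Cx,
  [/\ open W, A `<=` W & forall z, W z -> cder lam z (g z)].

Lemma has_primD A f g : has_prim A f -> has_prim A g -> has_prim A (fun z => f z + g z).
Proof.
move=> [W [l [oW AW hl]]] [W' [l' [oW' AW' hl']]].
exists (W `&` W'), (fun z => l z + l' z); split; first exact: openI.
  by move=> z Az; split; [exact: AW|exact: AW'].
by move=> z [/hl h /hl' h']; exact: cderD.
Qed.

Lemma has_prim_ext A f g : (forall z, f z = g z) -> has_prim A f -> has_prim A g.
Proof. by move=> /funext ->. Qed.

Lemma has_primN A f : has_prim A f -> has_prim A (fun z => - f z).
Proof.
by move=> [W [l [oW AW hl]]]; exists W, (fun z => - l z); split => // z /hl; exact: cderN.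
Qed.

Lemma open_cmod (f : Cx -> Cx) (U : set C) (c : R) : open U -> hol U f ->
  open (U `&` [set z | cmod (f z) < c]).
Proof.
move=> oU hf; have := open_preim U f (disc 0 c) oU hf (open_disc 0 c).
rewrite (_ : f @^-1` _ = [set z | cmod (f z) < c]) //.
by apply/seteqP; split=> z; rewrite /disc /= subr0.
Qed.

Lemma openD1 (U : set C) a : open U -> open (U `&` [set z | z != a]).
Proof.
move=> oU; apply/open_discP => z [Uz za].
have [r r0 hr] := proj1 (open_discP _) oU z Uz.
have za0 : 0 < cmod (z - a) by rewrite cmod_gt0 subr_eq0.
exists (Num.min r (cmod (z - a))); first by rewrite lt_min r0.
move=> w; rewrite /disc /= lt_min => /andP[/hr Uw wz]; split=> //=.
by apply: contraTneq wz => ->; rewrite cmodB ltxx.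
Qed.

(** The primitive is log(1 - z/a), defined since |z| <= n < |a|. *)
Lemma exh_prim_far G n a : n%:R < cmod a -> has_prim (exh G n) (fun z => (z - a)^-1).
Proof.
move=> na; have a0 : a != 0 by rewrite -cmod_gt0; apply: le_lt_trans na; rewrite ler0n.
have ca : 0 < cmod a by rewrite cmod_gt0.
have [Log hLog] := log_ex.
exists (disc 0 (cmod a)), (fun z => Log (a^-1 * z)); split; first exact: open_disc.
  by move=> z [zn _]; rewrite /disc /= subr0; apply: le_lt_trans na.
move=> z; rewrite /disc /= subr0 => za.
have q1 : cmod (a^-1 * z) < 1 by rewrite cmodM cmodV mulrC ltr_pdivrMr // mul1r.
have za0 : z - a != 0 by rewrite subr_eq0; apply: contraTneq za => ->; rewrite ltxx.
have := cder_comp _ Log _ _ _ (cderZ a^-1 _ _ _ (cder_id z)) (hLog _ q1).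
rewrite (_ : _ * _ = (z - a)^-1) //; field.
by rewrite za0 a0 -opprB oppr_eq0 za0.
Qed.

(** The primitive is log((z-a)/(z-b)) = log(1 - (a-b)/(z-b)), with ratio of modulus < 1 since |z-b|
    >= 1/n. *)
Lemma exh_prim_step G n a b : ~ G b -> n%:R * cmod (a - b) < 1 ->
  has_prim (exh G n) (fun z => (z - a)^-1 - (z - b)^-1).
Proof.
move=> nGb nab; have [Log hLog] := log_ex.
have hq : hol [set z : C | z != b] (fun z => (a - b) * (z - b)^-1).
  by apply: holM; [exact: hol_cst|exact: hol_cauchy].
have oq : open [set z : C | z != b].
  by have := openD1 setT b openT; rewrite setTI.
exists ([set z : C | z != b] `&` [set z | cmod ((a - b) * (z - b)^-1) < 1]),
  (fun z => Log ((a - b) * (z - b)^-1)); split; first exact: open_cmod.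
  move=> z hz; have zb := exh_far_neq _ _ _ _ nGb hz; split=> //=.
  have zb0 : 0 < cmod (z - b) by rewrite cmod_gt0 subr_eq0.
  case: hz => _ /(_ b nGb) h; rewrite cmodM cmodV ltr_pdivrMr // mul1r.
  have := cmod_ge0 (a - b); nra.
move=> z [/= zb q1].
have zb0 : z - b != 0 by rewrite subr_eq0.
have za0 : z - a != 0.
  rewrite subr_eq0; apply/eqP => za; move: q1; rewrite -za mulfV // cmod1; lra.
have dzb : cder (fun z => z - b) z 1.
  by have := cderB _ _ _ _ _ (cder_id z) (cder_cst b z); rewrite subr0.
have := cder_comp _ Log _ _ _ (cderZ (a - b) _ _ _ (cderV (fun z => z - b) _ _ zb0 dzb)) (hLog _ q1).
rewrite (_ : _ * _ = (z - a)^-1 - (z - b)^-1) //.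
have E : 1 - (a - b) / (z - b) = (z - a) / (z - b) by field.
by rewrite E; field; rewrite za0 zb0.
Qed.

Lemma exh_prim (G : set C) n : simply_connected G -> forall a, ~ exh G n a ->
  has_prim (exh G n) (fun z => (z - a)^-1).
Proof.
move=> scG; apply: (simply_connected_ind G n _ scG).
  by move=> a; exact: exh_prim_far.
move=> a b nGb ab hb; have := has_primD _ _ _ (exh_prim_step G n a b nGb ab) hb.
by apply: has_prim_ext => z; rewrite subrK.
Qed.

(** A logarithm is encoded as a primitive of u'/u near A; the exponential function does not
    enter. *)
Definition has_log (A : set C) (u : Cx -> Cx) := exists W : set C, exists lam : Cx -> Cx,
  [/\ open W, A `<=` W & forall z, W z -> u z != 0 /\ exists2 D, cder u z D & cder lam z (D / u z)].

Lemma has_logM A u v : has_log A u -> has_log A v -> has_log A (fun z => u z * v z).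
Proof.
move=> [W [l [oW AW hl]]] [W' [l' [oW' AW' hl']]].
exists (W `&` W'), (fun z => l z + l' z); split; first exact: openI.
  by move=> z Az; split; [exact: AW|exact: AW'].
move=> z [/hl[u0 [D dD dl]] /hl'[v0 [E dE dl']]].
split; first by rewrite mulf_neq0.
exists (D * v z + u z * E); first exact: cderM.
rewrite (_ : _ / _ = D / u z + E / v z); first exact: cderD.
by field; rewrite u0 v0.
Qed.

Lemma has_log_cst A c : c != 0 -> has_log A (fun=> c).
Proof.
move=> c0; exists setT, (fun=> 0); split => //; first exact: openT.
move=> z _; split => //; exists 0; first exact: cder_cst.
by rewrite mul0r; exact: cder_cst.
Qed.

Lemma has_log_sub A a : ~ A a -> has_prim A (fun z => (z - a)^-1) -> has_log A (fun z => z - a).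
Proof.
move=> nAa [W [l [oW AW hl]]]; exists (W `&` [set z | z != a]), l; split; first exact: openD1.
  by move=> z Az; split; [exact: AW|apply/eqP => za; apply: nAa; rewrite -za].
move=> z [/hl dl /= za]; split; first by rewrite subr_eq0.
exists 1; last by rewrite mul1r.
by have := cderB _ _ _ _ _ (cder_id z) (cder_cst a z); rewrite subr0.
Qed.

Lemma has_log_ext (A W : set C) u v : open W -> A `<=` W -> (forall z, W z -> u z = v z) ->
  has_log A u -> has_log A v.
Proof.
move=> oW AW uv [W' [l [oW' AW' hl]]]; exists (W `&` W'), l; split; first exact: openI.
  by move=> z Az; split; [exact: AW|exact: AW'].
move=> z [Wz /hl[u0 [D dD dl]]]; rewrite -(uv z Wz); split => //; exists D => //.
have [r r0 hr] := proj1 (open_discP _) oW z Wz.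
by apply: cder_ext r0 _ dD => w /hr /uv.
Qed.

Lemma polyf_hol U f : polyf f -> hol U f.
Proof.
move=> [p hp]; rewrite (_ : f = fun z => p.[z]); last exact/funext.
elim/poly_ind: p {hp} => [|p c IH].
  by rewrite (_ : (fun _ => _) = fun=> 0); [exact: hol_cst|apply/funext => z; rewrite horner0].
rewrite (_ : (fun _ => _) = fun z => p.[z] * z + c); last first.
  by apply/funext => z; rewrite hornerMXaddC.
by apply: holD; [apply: holM => //; exact: hol_id|exact: hol_cst].
Qed.

(** For a polynomial f close to u, write u = f (1 - (f-u)/f). The second factor has a logarithm
    because the ratio is < 1 in modulus, and f is a product of linear factors with roots off K, each
    with a logarithm by [exh_prim]. *)
Lemma exh_log (G W : set C) n u : simply_connected G -> open W -> exh G n `<=` W -> hol W u ->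
  (forall z, exh G n z -> u z != 0) -> has_log (exh G n) u.
Proof.
move=> scG oW KW hu u0; set K := exh G n in KW u0 *.
have [[z0 Kz0]|nK] := pselect (exists z, K z); last first.
  exists set0, (fun=> 0); split; [exact: open0| |by []].
  by move=> z Kz; apply: nK; exists z.
have [c c0 hc] := compact_ccont_lower K u (exh_compact G n) (fun z Kz => hol_cont _ _ _ hu (KW z Kz)) u0.
(* With |u| >= c and |f - u| <= c/3 on K one gets |f| >= 2c/3, so the ratio (f-u)/f is at most 1/2
   in modulus. *)
have [|f [p hp] fu] := polyf_Runge G W n u scG oW KW hu (c / 3); first by lra.
have hf : hol setT f by apply: polyf_hol; exists p.
have fK z : K z -> 2 * c / 3 <= cmod (f z).
  by move=> Kz; have := hc z Kz; have := fu z Kz; have := cmod_leB (u z) (f z); rewrite (cmodB (u z)); lra.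
have f0 z : K z -> f z != 0.
  by move=> /fK h; rewrite -cmod_gt0; apply: lt_le_trans h; lra.
pose W1 := W `&` [set z | f z != 0].
have oW1 : open W1.
  have := open_preim W f [set z : C | z != 0] oW (fun z _ => hf z I).
  by apply; have := openD1 setT 0 openT; rewrite setTI.
have hs : hol W1 (fun z => (f z - u z) / f z).
  apply: holM; last by apply: holV => [z _|z []//]; exact: hf.
  by apply: holB => [z _|z [Wz _]]; [exact: hf|exact: hu].
have logp : has_log K f.
  have [rs prs] := closed_field_poly_normal (p : {poly Cx}).
  have fE z : f z = lead_coef p * \prod_(r <- rs) (z - r).
    rewrite hp {1}prs hornerZ horner_prod; congr (_ * _).
    by apply: eq_bigr => r _; rewrite hornerXsubC.
  have lc0 : lead_coef p != 0.
    by apply: contraNneq (f0 z0 Kz0) => l0; rewrite fE l0 mul0r.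
  have rsK r : r \in rs -> ~ K r.
    move=> rrs Kr; have := f0 r Kr; rewrite fE (big_rem r) //= subrr mul0r mulr0 eqxx //.
  rewrite (_ : f = fun z => lead_coef p * \prod_(r <- rs) (z - r)); last exact/funext.
  apply: has_logM; first exact: has_log_cst.
  elim: rs rsK {prs fE} => [|r rs IH] rsK.
    rewrite (_ : (fun _ => _) = fun=> 1); first exact/has_log_cst/oner_neq0.
    by apply/funext => z; rewrite big_nil.
  rewrite (_ : (fun _ => _) = fun z => (z - r) * \prod_(j <- rs) (z - j)); last first.
    by apply/funext => z; rewrite big_cons.
  apply: has_logM; last by apply: IH => x xrs; apply: rsK; rewrite inE xrs orbT.
  have nKr : ~ K r by apply: rsK; rewrite inE eqxx.
  by apply: has_log_sub => //; exact: exh_prim.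
have [Log hLog] := log_ex.
have logs : has_log K (fun z => 1 - (f z - u z) / f z).
  exists (W1 `&` [set z | cmod ((f z - u z) / f z) < 1]), (fun z => Log ((f z - u z) / f z)); split.
  - exact: open_cmod.
  - move=> z Kz; split; first by split; [exact: KW|exact: f0].
    rewrite /= cmodM cmodV ltr_pdivrMr ?mul1r; last by rewrite cmod_gt0 f0.
    by have := fK z Kz; have := fu z Kz; lra.
  - move=> z [/hs[D dD] /= s1].
    have n0 : 1 - (f z - u z) / f z != 0.
      rewrite -cmod_gt0; have := cmod_leB 1 ((f z - u z) / f z); rewrite cmod1; lra.
    split => //; exists (0 - D); first exact: cderB (cder_cst 1 z) dD.
    have := cder_comp _ Log _ _ _ dD (hLog _ s1).
    by rewrite sub0r mulNr mulNr mulrC.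
apply: (has_log_ext K W1 _ u oW1 _ _ (has_logM _ _ _ logp logs)).
  by move=> z Kz; split; [exact: KW|exact: f0].
by move=> z [_ /= fz]; field.
Qed.

(* The logarithm of phi - a on K transported by the inverse of phi. *)
Lemma image_prim (G U : set C) (phi : Cx -> Cx) n : simply_connected G -> open U ->
  exh G n `<=` U -> hol U phi -> (forall z w, U z -> U w -> phi z = phi w -> z = w) ->
  forall a, ~ (phi @` exh G n) a -> has_prim (phi @` exh G n) (fun w => (w - a)^-1).
Proof.
move=> scG oU KU hphi inj a na.
have [||W [l [oW KW hl]]] := exh_log G U n (fun z => phi z - a) scG oU KU.
- by apply: holB => //; exact: hol_cst.
- by move=> z Kz; rewrite subr_eq0; apply/eqP => E; apply: na; exists z.
have hphi' : hol (U `&` W) phi by apply: hol_sub hphi => z [].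
have [z w [Uz _] [Uw _]|oI [psi [psiK hpsi]]] := injective_hol_inverse (U `&` W) phi (openI oU oW) hphi'.
  exact: inj.
exists (phi @` (U `&` W)), (fun w => l (psi w)); split => //.
  by move=> w [z Kz <-]; exists z => //; split; [exact: KU|exact: KW].
move=> w [z UWz <-]; have [Uz Wz] := UWz.
have [E dE] : exists E, cder psi (phi z) E by apply: hpsi; exists z.
have [u0 [D dD dl]] := hl z Wz.
have [F dF] := hphi z Uz.
have FD : F = D.
  by apply: cder_unique dD; have := cderB _ _ _ _ _ dF (cder_cst a z); rewrite subr0.
(* The chain rule for psi o phi = id: the factor phi' of phi'/(phi - a) cancels against psi'. *)
have EF : E * F = 1.
  apply: (cder_unique _ _ _ _ (cder_comp _ _ _ _ _ dF dE)).
  have [r r0 hr] := proj1 (open_discP _) (openI oU oW) z UWz.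
  by apply: cder_ext r0 _ (cder_id z) => v /hr /psiK.
have := cder_comp psi l _ _ _ dE; rewrite psiK // => /(_ _ dl).
rewrite (_ : _ * E = (phi z - a)^-1) //.
by rewrite -FD mulrAC (mulrC F) EF mul1r.
Qed.

(** * Approximation on two disjoint compact sets *)

Lemma separate_compacts (L B W1 W2 : set C) : compact L -> compact B -> (forall z, L z -> ~ B z) ->
  open W1 -> open W2 -> L `<=` W1 -> B `<=` W2 ->
  exists U1 U2 : set C, [/\ open U1, open U2, L `<=` U1 /\ U1 `<=` W1, B `<=` U2 /\ U2 `<=` W2
    & forall z, U1 z -> ~ U2 z].
Proof.
move=> cL cB LB oW1 oW2 LW BW; have [d d0 hd] := compact_dist L B cL cB LB.
have d20 : 0 < d / 2 by lra.
exists (W1 `&` \bigcup_(l in L) disc l (d / 2)), (W2 `&` \bigcup_(b in B) disc b (d / 2)); split.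
- by apply: openI => //; apply: bigcup_open => *; exact: open_disc.
- by apply: openI => //; apply: bigcup_open => *; exact: open_disc.
- by split=> z; [move=> Lz; split; [exact: LW|exists z => //; exact: disc_center]|case].
- by split=> z; [move=> Lz; split; [exact: BW|exists z => //; exact: disc_center]|case].
- move=> z [_ [l Ll zl]] [_ [b Bb zb]]; have := hd l b Ll Bb.
  move: zl zb; rewrite /disc /= => zl zb.
  by have := cmod_tri z l b; rewrite (cmodB l z); lra.
Qed.

Definition glue (O : set C) (f g : Cx -> Cx) (z : Cx) : Cx := if `[< O z >] then f z else g z.

Lemma glue_cder1 (O : set C) f g z D : open O -> O z -> cder f z D -> cder (glue O f g) z D.
Proof.
move=> oO Oz; have [r r0 hr] := proj1 (open_discP _) oO z Oz.
by apply: cder_ext r0 _ => w /hr Ow; rewrite /glue asboolT.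
Qed.

Lemma glue_cder2 (O O' : set C) f g z D : open O' -> (forall z, O z -> ~ O' z) -> O' z ->
  cder g z D -> cder (glue O f g) z D.
Proof.
move=> oO OO Oz; have [r r0 hr] := proj1 (open_discP _) oO z Oz.
by apply: cder_ext r0 _ => w /hr Ow; rewrite /glue asboolF // => /OO.
Qed.

(** Disjoint compact sets have disjoint neighbourhoods, so the two primitives need not match. This
    is how the disjointness of phi_n(K) and L enters the pole argument. *)
Lemma has_primU (L B : set C) g : compact L -> compact B -> (forall z, L z -> ~ B z) ->
  has_prim L g -> has_prim B g -> has_prim (L `|` B) g.
Proof.
move=> cL cB LB [W1 [l1 [oW1 LW1 h1]]] [W2 [l2 [oW2 BW2 h2]]].
have [U1 [U2 [opU1 opU2 [LO OW1] [BO OW2] OO]]] := separate_compacts L B W1 W2 cL cB LB oW1 oW2 LW1 BW2.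
exists (U1 `|` U2), (glue U1 l1 l2); split; first exact: openU.
  by move=> z [/LO|/BO] ?; [left|right].
move=> z [U1z|U2z]; first by apply: glue_cder1 => //; apply: h1; exact: OW1.
by apply: (glue_cder2 U1 U2) => //; apply: h2; exact: OW2.
Qed.

(** Approximability is locally constant in the pole off M. If M is at distance d from a and |b - a|
    < d/3, the geometric ratio is at most 1/2 in both directions. *)
Lemma appr_pole_near P (M : set C) a : lin_closed P -> compact M -> ~ M a ->
  exists2 d : R, 0 < d & forall b, cmod (b - a) < d -> ~ M b /\
    (appr P M (fun z => (z - b)^-1) <-> appr P M (fun z => (z - a)^-1)).
Proof.
move=> lP cM nMa.
have cMcl : open (~` M) by rewrite openC; apply: compact_closed => //; exact: norm_hausdorff.
have [d d0 hd] := proj1 (open_discP _) cMcl a nMa.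
exists (d / 3); first by lra.
move=> b ba; have far z : M z -> d <= cmod (z - a).
  by move=> Mz; rewrite leNgt; apply/negP => za; exact: (hd z za).
have farb z : M z -> 2 * d / 3 <= cmod (z - b).
  by move=> /far; have := cmod_tri b z a; lra.
have nMb : ~ M b by move=> /farb; rewrite subrr cmod0; lra.
have inv_le z c : d / 3 <= cmod (z - c) -> z != c /\ cmod (z - c)^-1 <= (d / 3)^-1.
  move=> h; have h0 : 0 < cmod (z - c) by apply: lt_le_trans h; lra.
  split; first by rewrite -subr_eq0 -cmod_gt0.
  by rewrite cmodV lef_pV2 // posrE; lra.
have half : (1 / 2 : R) < 1 by lra.
split=> //; split.
- apply: (appr_pole_step P M a b (d / 3)^-1 (1 / 2) lP half).
  + by move=> z /farb h; apply: (proj1 (inv_le z b _)); lra.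
  + by move=> z /farb h; apply: (proj2 (inv_le z b _)); lra.
  + by move=> z /farb h; rewrite cmodB; lra.
- apply: (appr_pole_step P M b a (d / 3)^-1 (1 / 2) lP half).
  + by move=> z /far h; apply: (proj1 (inv_le z a _)); lra.
  + by move=> z /far h; apply: (proj2 (inv_le z a _)); lra.
  + by move=> z /far h; lra.
Qed.

Lemma hol_lin U : lin_closed (hol U).
Proof.
split; [by move=> c; exact: hol_cst|by move=> f g; exact: holD|by move=> f g; exact: holM].
Qed.

(* The poles that cannot be pushed out of Omega would fill an open set V, bounded and contained
   in Omega, with boundary in M; but 1/(z-a) has a primitive near M up to a term without
   singularities in V. *)
Lemma two_compacts_poles (Omega B : set C) n : compact B -> B `<=` Omega ->
  (forall z, exh Omega n z -> ~ B z) ->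
  (forall a, ~ B a -> has_prim B (fun w => (w - a)^-1)) ->
  forall a, ~ (exh Omega n `|` B) a -> appr (hol Omega) (exh Omega n `|` B) (fun z => (z - a)^-1).
Proof.
move=> cB BO LB primB a nMa; set L := exh Omega n in LB nMa *; set M := L `|` B in nMa *.
have cL : compact L by exact: exh_compact.
have cM : compact M by exact: compactU.
apply: contrapT => nappr.
have lP := hol_lin Omega.
pose V : set C := [set b : C | ~ M b /\ ~ appr (hol Omega) M (fun z => (z - b)^-1)].
have [m hm] := compact_bounded M cM.
have VO : V `<=` Omega.
  move=> b [nMb nb]; apply: contrapT => nOb; apply: nb; apply: appr_in.
  by apply: hol_cauchy => z Oz; apply/eqP => zb; apply: nOb; rewrite -zb.
have oV : open V.
  apply/open_discP => b [nMb nb]; have [d d0 hd] := appr_pole_near _ _ b lP cM nMb.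
  by exists d => // c /hd[nMc h]; split => // /h.
have Vm b : V b -> cmod b <= m.
  move=> [nMb nb]; rewrite leNgt; apply/negP => mb; apply: nb.
  by apply: appr_pole_far hm mb => //; exact: hol_id.
have bV z : ~ V z -> ~ M z -> exists2 r : R, 0 < r & forall w, disc z r w -> ~ V w.
  move=> nVz nMz; have [d d0 hd] := appr_pole_near _ _ z lP cM nMz.
  exists d => // w /hd[nMw h] [_ nw]; apply: nw; apply/h.
  by apply: contrapT => nz; apply: nVz.
have Va : V a by [].
have contra kappa : hol V kappa -> has_prim M (fun z => (z - a)^-1 - kappa z) -> False.
  move=> hk [W [lam [oW MW hl]]].
  apply: (no_log_around V M (W `&` [set z | z != a]) m a kappa lam oV Vm bV Va hk (openD1 W a oW)).
  - by move=> z Mz; split; [exact: MW|apply/eqP => za; apply: nMa; rewrite -za].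
  - by move=> [_ /=]; rewrite eqxx.
  - by move=> z [/hl].
have nBa : ~ B a by move=> Ba; apply: nMa; right.
have nLa : ~ L a by move=> La; apply: nMa; left.
(* If a is far away, 1/(z-a) has a primitive near L and kappa = 0 will do. Otherwise kappa = 1/(z-b)
   with b off Omega, hence without singularity in V; near L the difference has a primitive, near B
   each term has one. *)
have [na|[b nOb ab]] := exhP Omega n a nLa.
  apply: (contra (fun=> 0)); first exact: hol_cst.
  apply: (has_prim_ext _ (fun z => (z - a)^-1)) => [z|]; first by rewrite subr0.
  by apply: has_primU => //; [exact: exh_prim_far|exact: primB].
apply: (contra (fun z => (z - b)^-1)).
  by apply: hol_cauchy => z /VO Oz; apply/eqP => zb; apply: nOb; rewrite -zb.
apply: has_primU => //; first exact: exh_prim_step.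
apply: has_primD; first exact: primB.
by apply: has_primN; apply: primB => /BO.
Qed.

(** Runge's theorem for the function equal to 0 near the first compact set and to h near the
    second. *)
Lemma two_compacts_Runge (Omega B W : set C) n h (e : R) : compact B -> B `<=` Omega ->
  (forall z, exh Omega n z -> ~ B z) ->
  (forall a, ~ B a -> has_prim B (fun w => (w - a)^-1)) ->
  open W -> B `<=` W -> hol W h -> 0 < e ->
  exists q, [/\ hol Omega q, forall z, exh Omega n z -> cmod (q z) <= e &
    forall z, B z -> cmod (q z - h z) <= e].
Proof.
move=> cB BO LB primB oW BW hh e0.
have cL := exh_compact Omega n.
have [U1 [U2 [opU1 opU2 [LO _] [BO2 OW2] OO]]] := separate_compacts _ B setT W cL cB LB openT oW
  (fun z _ => I) BW.
have hg : hol (U1 `|` U2) (glue U1 (fun=> 0) h).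
  move=> z [U1z|U2z]; first by exists 0; apply: glue_cder1 => //; exact: cder_cst.
  by have [D dD] := hh z (OW2 z U2z); exists D; exact: (glue_cder2 U1 U2).
have MO : exh Omega n `|` B `<=` U1 `|` U2 by move=> z [/LO|/BO2] ?; [left|right].
have [q hq qe] := Runge (hol Omega) _ _ _ (hol_lin Omega) (compactU cL cB) (openU opU1 opU2) MO hg
  (two_compacts_poles Omega B n cB BO LB primB) e e0.
exists q; split=> // z hz.
  by have := qe z (or_introl hz); rewrite /glue asboolT ?subr0 //; exact: LO.
have := qe z (or_intror hz); rewrite /glue asboolF // => U1z.
by apply: (OO z U1z); exact: BO2.
Qed.

(** With psi the inverse of phi_n, a correction q that is small on L and close to g o psi - f0 on
    phi_n(K) is added to f0. *)
Lemma universal_step (G Omega : set C) (Phi : nat -> Cx -> Cx) : simply_connected G ->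
  (forall n, hol G (Phi n) /\ forall z, G z -> Omega (Phi n z)) ->
  (forall K L : set C, compact K -> K `<=` G -> compact L -> L `<=` Omega ->
    exists n : nat, (Phi n @` K) `&` L = set0 /\
      exists U : set C, open U /\ K `<=` U /\ U `<=` G /\ {in U &, injective (Phi n)}) ->
  forall (k l : nat) (f0 g : Cx -> Cx) (e : R), hol Omega f0 -> hol G g -> 0 < e ->
  exists n f, [/\ hol Omega f, forall z, exh Omega l z -> cmod (f z - f0 z) <= e &
    forall z, exh G k z -> cmod (f (Phi n z) - g z) <= e].
Proof.
move=> scG hPhi H k l f0 g e hf0 hg e0.
have [n [KL [U [oU [KU [UG injU]]]]]] := H _ _ (exh_compact G k) (@exh_sub G k) (exh_compact Omega
  l) (@exh_sub Omega l).
have [hn nO] := hPhi n.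
have inj z w : U z -> U w -> Phi n z = Phi n w -> z = w.
  by move=> Uz Uw; apply: injU; rewrite inE.
have hnU : hol U (Phi n) by apply: hol_sub hn.
have [oI [psi [psiK hpsi]]] := injective_hol_inverse U (Phi n) oU hnU inj.
have cB : compact (Phi n @` exh G k : set C) by apply: (hol_image_compact _ U) => //; exact: exh_compact.
have BO : Phi n @` exh G k `<=` Omega by move=> w [z /exh_sub Gz <-]; exact: nO.
have LB z : exh Omega l z -> ~ (Phi n @` exh G k) z.
  by move=> Lz Bz; have : ((Phi n @` exh G k) `&` exh Omega l) z by []; rewrite KL.
have hh : hol (Phi n @` U) (fun w => g (psi w) - f0 w).
  apply: holB.
    apply: (hol_comp _ G psi g hpsi hg) => w [z Uz <-]; rewrite psiK //; exact: UG.
  apply: hol_sub hf0 => w [z /UG Gz <-]; exact: nO.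
have [q [hq q1 q2]] := two_compacts_Runge Omega _ _ l _ e cB BO LB
  (image_prim G U (Phi n) k scG oU KU hnU inj) oI (@image_subset _ _ (Phi n) _ _ KU) hh e0.
exists n, (fun z => f0 z + q z); split.
- exact: holD.
- by move=> z /q1; rewrite addrAC subrr add0r.
- move=> z Kz; have := q2 (Phi n z) (ex_intro2 _ _ z Kz erefl).
  by rewrite psiK; [rewrite opprB addrA (addrC (q _)); rewrite -addrA|exact: KU].
Qed.

(** * Construction of a universal function *)

Definition qcst (q : rat * rat) : Cx := Complex (ratr q.1) (ratr q.2).

(** Horner evaluation of polynomials with Gaussian rational coefficients; as lists of pairs of
    rationals they form a countable type, which provides the enumeration of targets. *)
Fixpoint qpoly (s : seq (rat * rat)) (z : Cx) : Cx :=
  if s is q :: s' then qpoly s' z * z + qcst q else 0.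

Lemma qcst_dense (c : Cx) (e : R) : 0 < e -> exists q, cmod (qcst q - c) <= e.
Proof.
move=> e0; case: c => a b.
have h (x : R) : exists q : rat, `|ratr q - x| <= e / 2.
  have xe : x - e / 2 < x + e / 2 by lra.
  have [q] := rat_in_itvoo xe; rewrite in_itv /= => /andP[h1 h2].
  by exists q; rewrite ler_norml; apply/andP; split; lra.
have [q1 h1] := h a; have [q2 h2] := h b; exists (q1, q2).
by apply: le_trans (cmod_ReIm _) _; rewrite ReB ImB /=; lra.
Qed.

Lemma qpoly_dense (p : {poly Cx}) (m e : R) : 0 <= m -> 0 < e ->
  exists s, forall z, cmod z <= m -> cmod (qpoly s z - p.[z]) <= e.
Proof.
move=> m0; elim/poly_ind: p e => [|p c IH] e e0.
  by exists [::] => z _; rewrite horner0 subrr cmod0 ltW.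
have [|s hs] := IH (e / (2 * (m + 1))); first by rewrite divr_gt0 //; lra.
have [|q hq] := qcst_dense c (e / 2); first by lra.
exists (q :: s) => z zm; rewrite hornerMXaddC /=.
rewrite (_ : _ - _ = (qpoly s z - p.[z]) * z + (qcst q - c)); last by ring.
apply: le_trans (cmodD _ _) _; rewrite cmodM.
have := ler_pM (cmod_ge0 _) (cmod_ge0 _) (hs z zm) zm.
have : e / (2 * (m + 1)) * m <= e / 2.
  rewrite mulrAC ler_pdivrMr; last by lra.
  nra.
lra.
Qed.

Lemma qpoly_hol U s : hol U (qpoly s).
Proof.
elim: s => [|q s IH] /=; first exact: hol_cst.
by apply: holD; [apply: holM => //; exact: hol_id|exact: hol_cst].
Qed.

Lemma geometric_cauchy_real (u : nat -> R) : (forall j, `|u j.+1 - u j| <= (2 ^+ j)^-1) ->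
  exists l, forall j, `|u j - l| <= 2 / 2 ^+ j.
Proof.
move=> hu.
have p2 n : (2 ^+ n : R)^-1 = 2 * (2 ^+ n.+1)^-1 by rewrite exprS invfM mulrA divff ?mul1r.
have p0 n : 0 < (2 ^+ n : R)^-1 by rewrite invr_gt0 exprn_gt0.
have [|||l hl] := nested_intervals (fun n => u n - 2 / 2 ^+ n) (fun n => u n + 2 / 2 ^+ n).
- by move=> n; have := hu n; have := p2 n; rewrite ler_norml => h /andP[? ?]; rewrite h; lra.
- by move=> n; have := hu n; have := p2 n; rewrite ler_norml => h /andP[? ?]; rewrite h; lra.
- by move=> n; have := p0 n; lra.
by exists l => j; have /andP[? ?] := hl j; rewrite ler_norml; apply/andP; split; lra.
Qed.

Lemma geometric_cauchy (u : nat -> Cx) (J : nat) :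
  (forall j, (J <= j)%N -> cmod (u j.+1 - u j) <= (2 ^+ j)^-1) ->
  exists l, forall j, (J <= j)%N -> cmod (u j - l) <= 4 / 2 ^+ j.
Proof.
move=> hu.
have p0 n : 0 < (2 ^+ n : R) by rewrite exprn_gt0.
(* Shifting the index by J and multiplying by 2^J reduces to a sequence controlled from the start,
   keeping the rate 4/2^j independent of J. *)
have st i : cmod (2 ^+ J * u (J + i.+1)%N - 2 ^+ J * u (J + i)%N) <= (2 ^+ i)^-1.
  have c2 : cmod (2 ^+ J) = 2 ^+ J.
    by rewrite cmodX (_ : (2 : Cx) = (2 : R)%:C%C) ?cmod_real ?normr_nat //; exact/esym/(rmorph_nat _ 2).
  rewrite -mulrBr cmodM c2 addnS; apply: le_trans (ler_wpM2l (ltW (p0 J)) (hu (J + i)%N (leq_addr _ _))) _.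
  by rewrite exprD invfM mulrA divff ?mul1r // gt_eqF.
have [i|a ha] := geometric_cauchy_real (fun i => Re (2 ^+ J * u (J + i)%N)).
  by rewrite -ReB; apply: le_trans (normRe _) (st i).
have [i|b hb] := geometric_cauchy_real (fun i => Im (2 ^+ J * u (J + i)%N)).
  by rewrite -ImB; apply: le_trans (normIm _) (st i).
exists ((2 ^+ J)^-1 * Complex a b) => j Jj.
rewrite -(subnKC Jj); set i := (j - J)%N.
have c2 : cmod (2 ^+ J) = 2 ^+ J.
  by rewrite cmodX (_ : (2 : Cx) = (2 : R)%:C%C) ?cmod_real ?normr_nat //; exact/esym/(rmorph_nat _ 2).
have n2 : (2 ^+ J : Cx) != 0 by rewrite -cmod_gt0 c2.
have E : cmod (2 ^+ J * u (J + i)%N - Complex a b) <= 4 / 2 ^+ i.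
  by apply: le_trans (cmod_ReIm _) _; rewrite ReB ImB /=; have := ha i; have := hb i; rewrite /=; lra.
rewrite -(ler_pM2l (p0 J)) -{1}c2 -cmodM mulrBr mulrA divff // mul1r.
rewrite (_ : 2 ^+ J * (4 / 2 ^+ (J + i)) = 4 / 2 ^+ i :> R) // exprD.
have := p0 J; have := p0 i; move: (2 ^+ J) (2 ^+ i) => x y y0 x0.
by field; rewrite !gt_eqF.
Qed.

Lemma exh_mono G m n : (m <= n)%N -> exh G m `<=` exh G n.
Proof.
move=> mn z [zm h]; split; first by apply: le_trans zm _; rewrite ler_nat.
move=> b nGb; apply: le_trans (h b nGb) _.
by rewrite ler_wpM2r ?cmod_ge0 // ler_nat.
Qed.

(** Later corrections must not spoil an approximation already obtained. The state is a pair (f_j,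
    l_j): step j changes f_j by at most 2^-j on [exh Omega l_j], and the next level is raised until
    its compact set contains the image phi_n(K) just treated. *)
Lemma universal_exists (G Omega : set C) (Phi : nat -> Cx -> Cx) : open G -> open Omega ->
  simply_connected G ->
  (forall n, hol G (Phi n) /\ forall z, G z -> Omega (Phi n z)) ->
  (forall (k l : nat) (f0 g : Cx -> Cx) (e : R), hol Omega f0 -> hol G g -> 0 < e ->
    exists n f, [/\ hol Omega f, forall z, exh Omega l z -> cmod (f z - f0 z) <= e &
      forall z, exh G k z -> cmod (f (Phi n z) - g z) <= e]) ->
  exists f, hol Omega f /\ forall g, hol G g -> forall K : set C, compact K -> K `<=` G ->
    forall e : R, 0 < e -> exists n, forall z, K z -> cmod (f (Phi n z) - g z) < e.
Proof.
move=> oG oO scG hPhi step.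
have p0 n : 0 < (2 ^+ n : R)^-1 by rewrite invr_gt0 exprn_gt0.
(* A code consists of a polynomial, a level in G and a dummy number, which lets each target recur at
   arbitrarily late steps, where the tolerance 2^-j is small. *)
pose T := (seq (rat * rat) * nat * nat)%type.
pose tgt (j : nat) : Cx -> Cx := if (unpickle j : option T) is Some t then qpoly t.1.1 else fun=> 0.
pose lev (j : nat) : nat := if (unpickle j : option T) is Some t then t.1.2 else 0%N.
have tgt_hol j : hol G (tgt j) by rewrite /tgt; case: unpickle => [t|]; [exact: qpoly_hol|exact: hol_cst].
pose St := ((Cx -> Cx) * nat)%type.
pose rel (j : nat) (s s' : St) := [/\ hol Omega s'.1, (s.2 <= s'.2)%N, (j <= s'.2)%N,
  forall z, exh Omega s.2 z -> cmod (s'.1 z - s.1 z) <= (2 ^+ j)^-1 &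
  exists n, forall z, exh G (lev j) z -> exh Omega s'.2 (Phi n z) /\
     cmod (s'.1 (Phi n z) - tgt j z) <= (2 ^+ j)^-1].
have /choice[nx hnx] : forall js : nat * St, exists s', hol Omega js.2.1 -> rel js.1 js.2 s'.
  move=> [j [f l]] /=; have [hf|nf] := pselect (hol Omega f); last by exists (f, l).
  have [n [f' [hf' h1 h2]]] := step (lev j) l f (tgt j) _ hf (tgt_hol j) (p0 j).
  have [hn nO] := hPhi n.
  have cB : compact (Phi n @` exh G (lev j) : set C).
    by apply: (hol_image_compact _ G) => //; [exact: exh_compact|exact: exh_sub].
  have BO : Phi n @` exh G (lev j) `<=` Omega by move=> w [z /exh_sub Gz <-]; exact: nO.
  have [l' [r r0 hl']] := exh_absorb Omega _ oO cB BO.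
  exists (f', maxn j (maxn l l')) => _; split => //=.
  - by rewrite !leq_max leqnn orbT.
  - by rewrite leq_maxl.
  exists n => z hz; split; last exact: h2.
  apply: (exh_mono Omega l'); first by rewrite !leq_max leqnn !orbT.
  by apply: (hl' (Phi n z)); [exists z|rewrite subrr cmod0 ltW].
pose s := fix s j : St := if j is i.+1 then nx (i, s i) else (fun=> 0, 0%N).
have sh j : hol Omega (s j).1.
  by elim: j => [|j IH]; [exact: hol_cst|case: (hnx (j, s j) IH)].
have sr j : rel j (s j) (s j.+1) by exact: (hnx (j, s j) (sh j)).
have lmono i j : (i <= j)%N -> ((s i).2 <= (s j).2)%N.
  move=> ij; rewrite -(subnKC ij); elim: (j - i)%N => [|d IH]; first by rewrite addn0.
  by rewrite addnS; apply: leq_trans IH _; case: (sr (i + d)%N).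
have lbig j : (j <= (s j.+1).2)%N by case: (sr j).
have conv J z : exh Omega (s J).2 z -> forall j, (J <= j)%N -> cmod ((s j.+1).1 z - (s j).1 z) <= (2 ^+ j)^-1.
  by move=> hz j Jj; case: (sr j) => _ _ _ h _; apply: h; apply: exh_mono hz; exact: lmono.
(* The limit is taken from the least J that captures z, so that one value serves every J; points
   never captured get the value 0. *)
have /choice[f hf] : forall z : Cx, exists l : Cx, forall J, exh Omega (s J).2 z ->
    forall j, (J <= j)%N -> cmod ((s j).1 z - l) <= 4 / 2 ^+ j.
  move=> z; have [[J hJ]|nJ] := pselect (exists J, exh Omega (s J).2 z); last first.
    by exists 0 => J hJ; case: nJ; exists J.
  have exP : exists J, `[< exh Omega (s J).2 z >] by exists J; apply/asboolP.
  have [J0 /asboolP hJ0 minJ] := ex_minnP exP.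
  have [l hl] := geometric_cauchy (fun j => (s j).1 z) J0 (conv J0 z hJ0).
  exists l => J' hJ' j J'j; apply: hl; apply: leq_trans J'j; apply: minJ; exact/asboolP.
have small (e : R) (N : nat) : 0 < e -> exists2 j, (N <= j)%N & 4 / 2 ^+ j < e.
  move=> e0; have [n hn] := pow2_small 4 e e0; exists (maxn N n); first by rewrite leq_maxl.
  apply: le_lt_trans hn; rewrite ler_pM2l // lef_pV2 ?posrE ?exprn_gt0 //.
  by rewrite ler_eXn2l ?leq_maxr // ltr1n.
exists f; split.
  apply: hol_unif_limit => z Oz.
  have [||l [r r0 hl]] := exh_absorb Omega [set z : C] oO.
  - exact: compact_set1.
  - by move=> w ->.
  exists (r / 2); first by lra.
  (* The level reached after step i is at least i, so it is at least l from index l + 1 on. *)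
  move=> e e0; have [j lj je] := small e l.+1 e0.
  have sqO w : square z (r / 2) w -> exh Omega (s j).2 w.
    move=> /square_cmod wz; apply: (exh_mono Omega l).
      by case: j lj {je} => // j lj; apply: leq_trans (lbig j).
    by apply: (hl z) => //; lra.
  exists (s j).1; split=> w /sqO hw; first by apply: sh; exact: exh_sub hw.
  by apply: le_trans (ltW je); exact: (hf w j).
move=> g hg K cK KG e e0.
have [k [r r0 hk]] := exh_absorb G K oG cK KG.
have Kk : K `<=` exh G k by move=> z Kz; apply: (hk z) => //; rewrite subrr cmod0 ltW.
have [|q [p hp] hq] := polyf_Runge G G k g scG oG (@exh_sub G k) hg (e / 4); first by lra.
have [||c hc] := qpoly_dense p k%:R (e / 4); [by rewrite ler0n|lra|].
have [N0 _ hN0] := small (e / 4) 0%N ltac:(by lra).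
(* Pigeonhole: the codes for distinct i are distinct, so they cannot all be at most [N0]. *)
have [i hi] : exists i : nat, (N0 < pickle ((c, k, i) : T))%N.
  apply: contrapT => hn.
  have hn' i : (pickle ((c, k, i) : T) <= N0)%N by rewrite leqNgt; apply/negP => h; apply: hn; exists i.
  pose h (i : 'I_N0.+2) : 'I_N0.+1 := Ordinal (hn' i : (_ < N0.+1)%N).
  have injh : injective h.
    move=> x y [] /(congr1 (unpickle : nat -> option T)); rewrite !pickleK => -[] xy.
    exact/val_inj.
  by have := leq_card h injh; rewrite !card_ord ltnn.
set j := pickle ((c, k, i) : T) in hi.
have tj : tgt j = qpoly c by rewrite /tgt /j pickleK.
have lj : lev j = k by rewrite /lev /j pickleK.
have [_ _ _ _ [n hn]] := sr j; rewrite lj tj in hn.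
exists n => z /Kk hz; have [h1 h2] := hn z hz.
have h3 := hf (Phi n z) j.+1 h1 j.+1 (leqnn _).
have h4 : cmod (qpoly c z - p.[z]) <= e / 4 by apply: hc; case: hz.
have h5 : cmod (p.[z] - g z) <= e / 4 by rewrite -hp; exact: hq.
(* Passing to the limit costs 2/2^j and step j costs 1/2^j, both well below e/4; the two polynomial
   approximations cost e/4 each. *)
have E2 : 4 / 2 ^+ j < e / 4.
  apply: le_lt_trans hN0; rewrite ler_pM2l // lef_pV2 ?posrE ?exprn_gt0 //.
  by rewrite ler_eXn2l ?ltr1n // ltnW.
have E3 : 4 / 2 ^+ j.+1 = (4 / 2 ^+ j) / 2 :> R by rewrite exprS invfM (mulrC 2^-1) mulrA.
have pj := p0 j.
have t1 := cmod_tri (qpoly c z) (f (Phi n z)) (g z).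
have t2 := cmod_tri p.[z] (qpoly c z) (g z).
have t3 := cmod_tri ((s j.+1).1 (Phi n z)) (f (Phi n z)) (qpoly c z).
have t4 := cmodB (f (Phi n z)) ((s j.+1).1 (Phi n z)).
rewrite t4 in t3; rewrite E3 in h3.
move: h2 E2 h3; move: (2 ^+ j)^-1 pj => x; lra.
Qed.

(** * Universality forces injectivity and disjointness *)

Lemma universal_injective_disjoint (G Omega K L : set C) (Phi : nat -> Cx -> Cx) (f : Cx -> Cx) :
  open G -> hol Omega f -> (forall n, hol G (Phi n) /\ forall z, G z -> Omega (Phi n z)) ->
  (forall g, hol G g -> forall K : set C, compact K -> K `<=` G ->
    forall e : R, 0 < e -> exists n, forall z, K z -> cmod (f (Phi n z) - g z) < e) ->
  compact K -> K `<=` G -> compact L -> L `<=` Omega ->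
  exists n, (forall z, K z -> ~ L (Phi n z)) /\
    exists U : set C, [/\ open U, K `<=` U, U `<=` G &
      forall z w, U z -> U w -> Phi n z = Phi n w -> z = w].
Proof.
move=> oG hf hPhi univ cK KG cL LO.
have [k [r r0 hk]] := exh_absorb G K oG cK KG.
have [m m0 hm] := compact_ccont_bounded L f cL (fun z Lz => hol_cont _ _ _ hf (LO z Lz)).
have [M hM] := compact_bounded K cK.
pose rho := r / 4; have rho0 : 0 < rho by rewrite /rho; lra.
have rE : r = 4 * rho by rewrite /rho; field.
clearbody rho.
(* The first condition makes the Cauchy bound for the derivative of h at most 1/4; the second
   confines points with equal images to distance rho/2, the range of the Cauchy estimate. *)
have [e [e0 e1 e2]] : exists e : R, [/\ 0 < e, 2 * cbound * e <= rho / 2 & 2 * e <= rho / 2].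
  have c0 := cbound_gt0; exists (Num.min (rho / (4 * cbound)) (rho / 4)).
  have h1 : Num.min (rho / (4 * cbound)) (rho / 4) <= rho / (4 * cbound) by rewrite ge_min lexx.
  have h2 : Num.min (rho / (4 * cbound)) (rho / 4) <= rho / 4 by rewrite ge_min lexx orbT.
  split; first by rewrite lt_min; apply/andP; split; apply: divr_gt0 => //; exact: mulr_gt0.
    move: h1; rewrite ler_pdivlMr; [move: (Num.min (rho / (4 * cbound)) (rho / 4)) => x; lra|exact: mulr_gt0].
  by move: h2; move: (Num.min (rho / (4 * cbound)) (rho / 4)) => x; lra.
(* On K this gives |f o phi_n| > c - M - e > m, whereas |f| <= m on L. *)
pose c : R := m + `|M| + e + 1.
have c0 : 0 < c by rewrite /c; have := normr_ge0 M; lra.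
pose g (z : Cx) : Cx := z + c%:C%C.
have hg : hol G g by apply: holD; [exact: hol_id|exact: hol_cst].
have [n hn] := univ g hg _ (exh_compact G k) (@exh_sub G k) e e0.
have [hphi phiO] := hPhi n.
pose h z := f (Phi n z) - g z.
have hh : hol G h by apply: holB => //; exact: (hol_comp _ Omega).
exists n; split.
  move=> z Kz Lz; have zk : exh G k z by apply: (hk z) => //; rewrite subrr cmod0 ltW.
  have := hn z zk; have := hm _ Lz; have := hM z Kz; have := ler_norm M.
  have := cmod_leB (g z) (f (Phi n z)); rewrite (cmodB (g z)).
  have gz : c - cmod z <= cmod (g z).
    have -> : g z = c%:C%C - (- z) by rewrite /g opprK addrC.
    by apply: le_trans (cmod_leB _ _); rewrite cmodN cmod_real gtr0_norm.
  by move: gz; rewrite /c; lra.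
exists (\bigcup_(z in K) disc z rho); split.
- by apply: bigcup_open => *; exact: open_disc.
- by move=> z Kz; exists z => //; exact: disc_center.
- move=> w [z Kz zw]; apply: (exh_sub G k); apply: (hk z) => //.
  by move: zw; rewrite /disc /=; lra.
move=> z w [z0 Kz0 zz0] [w0 Kw0 ww0] zw.
move: zz0 ww0; rewrite /disc /= => zz0 ww0.
have Ek v : cmod (v - z) <= 2 * rho -> exh G k v.
  by move=> vz; apply: (hk z0) => //; have := cmod_tri z v z0; lra.
have zk : exh G k z by apply: Ek; rewrite subrr cmod0; lra.
have wk : exh G k w by apply: (hk w0) => //; lra.
(* Equal images turn the increment of h into z - w, but the estimates bound the increment by half of
   |w - z|. *)
have hE : h w - h z = z - w by rewrite /h /g zw; ring.
have wz2 : cmod (w - z) <= rho / 2.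
  have := hn z zk; have := hn w wk; rewrite -/(h z) -/(h w) => h1 h2.
  by have := cmodD (h w) (- h z); rewrite cmodN hE cmodB; lra.
have [||D [_ D1 D2]] := Cauchy_estimate h z rho e rho0 (ltW e0).
- by move=> v /square_cmod vz; apply: hh; apply: exh_sub; exact: Ek.
- by move=> v /square_cmod /Ek /hn /ltW.
have := D2 w wz2; rewrite hE.
have cz := cmod_ge0 (w - z); have cb := cbound_gt0.
have i1 : cbound * e / rho <= 1 / 4 by rewrite ler_pdivrMr //; lra.
have i2 : cbound * e / rho ^+ 2 * cmod (w - z) ^+ 2 <= 1 / 4 * cmod (w - z).
  rewrite expr2 invfM [X in X * _]mulrA expr2 -mulrA.
  have : rho^-1 * (cmod (w - z) * cmod (w - z)) <= cmod (w - z).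
    rewrite mulrA -[leRHS]mul1r ler_wpM2r // mulrC ler_pdivrMr // mul1r; lra.
  have k0 : 0 <= cbound * e / rho by apply: divr_ge0; [apply: mulr_ge0; exact: ltW|exact: ltW].
  move: (rho^-1 * _) => x hx.
  by apply: le_trans (ler_wpM2l k0 hx) _; exact: ler_wpM2r.
have i3 : cmod (D * (w - z)) <= 1 / 4 * cmod (w - z).
  by rewrite cmodM; apply: ler_wpM2r => //; exact: le_trans D1 i1.
have i4 : cmod (w - z) <= cmod (z - w - D * (w - z)) + cmod (D * (w - z)).
  by rewrite (cmodB w); have := cmod_leB (z - w) (D * (w - z)); lra.
move=> i5; have wz0 : cmod (w - z) <= 0 by lra.
apply/eqP; rewrite eq_sym -subr_eq0 -cmod_eq0 eq_le cmod_ge0 andbT; exact: wz0.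
Qed.

Theorem mainTheorem7 (G Omega : set C) (Phi : nat -> C -> C) :
  domain G -> domain Omega -> simply_connected G ->
  (forall n, holomorphic_map G Omega (Phi n)) ->
  ((exists f : C -> C, universal Phi G Omega f) <->
   (forall K L : set C, compact K -> K `<=` G -> compact L -> L `<=` Omega ->
    exists n : nat, (Phi n @` K) `&` L = set0 /\
      exists U : set C, open U /\ K `<=` U /\ U `<=` G /\
        {in U &, injective (Phi n)})).
Proof.
move=> [oG _] [oO _] scG hPhi0.
have hPhi n : hol G (Phi n) /\ forall z, G z -> Omega (Phi n z).
  have [/holomorphic_hol h1 h2] := hPhi0 n; split=> // z Gz.
  by apply: h2; exists z.
split.
  move=> [f [/holomorphic_hol hf univ]] K L cK KG cL LO.
  have [g hg K' cK' KG' e e0|n [h1 [U [oU KU UG inj]]]] :=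
    universal_injective_disjoint G Omega K L Phi f oG hf hPhi _ cK KG cL LO.
    have [|n hn] := univ g (proj2 (holomorphic_hol G g) hg) K' cK' KG' (e%:C%C : C).
      by rewrite ltcR.
    by exists n => z /hn; rewrite cmod_norm ltcR.
  exists n; split; first by apply/seteqP; split=> w // [[z Kz <-]]; exact: h1.
  exists U; split=> //; split=> //; split=> //.
  by move=> z w /set_mem Uz /set_mem Uw; exact: inj.
move=> H.
have [f [hf univ]] := universal_exists G Omega Phi oG oO scG hPhi (universal_step G Omega Phi scG hPhi H).
exists f; split; first exact/holomorphic_hol.
move=> g /holomorphic_hol hg K cK KG e' /gt0_realP[e e0 ->].
have [n hn] := univ g hg K cK KG e e0.
by exists n => z /hn; rewrite cmod_norm ltcR.
Qed.
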